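(* Let $\mathbb{F}$ be an algebraically closed field of characteristic different from $2$, $\mathcal{C}$ the Cayley algebra over $\mathbb{F}$, $G$ an abelian group, and $\Gamma$ a $G$-grading on $\mathcal{C}\otimes\mathcal{C}$. Suppose that, for the induced $G$-grading on the subspace $(\mathcal{C}_0\otimes\mathbb{F}1)\oplus(\mathbb{F}1\otimes\mathcal{C}_0)$, considered as an algebra with the product given by the commutator, this algebra is graded-simple. Then $\Gamma$ is isomorphic to either $\Gamma^1_{\mathcal{C}\otimes\mathcal{C}}(G,h,\overline{\gamma})$ or $\Gamma^2_{\mathcal{C}\otimes\mathcal{C}}(G,h,\overline{H})$, for an element $h\in G$ of order $2$, a triple $\overline{\gamma}=(\bar g_1,\bar g_2,\bar g_3)$ of elements of $\overline{G}=G/\langle h\rangle$ with $\bar g_1\bar g_2\bar g_3=e$, and a subgroup $\overline{H}\subseteq\overline{G}$ isomorphic to $(\mathbb{Z}/2)^3$. Moreover, no grading of the first type is isomorphic to one of the second type, and - $\Gamma^1_{\mathcal{C}\otimes\mathcal{C}}(G,h,\overline{\gamma})$ is isomorphic to $\Gamma^1_{\mathcal{C}\otimes\mathcal{C}}(G,h',\overline{\gamma}')$ if and only if $h=h'$ and $\overline{\gamma}\sim\overline{\gamma}'$; - $\Gamma^2_{\mathcal{C}\otimes\mathcal{C}}(G,h,\overline{H})$ is isomorphic to $\Gamma^2_{\mathcal{C}\otimes\mathcal{C}}(G,h',\overline{H}')$ if and only if $h=h'$ and $\overline{H}=\overline{H}'$.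
   Context: A $G$-grading on an algebra $\mathcal{A}$ is a decomposition $\mathcal{A}=\bigoplus_{g\in G}\mathcal{A}_g$ with $\mathcal{A}_g\mathcal{A}_h\subseteq\mathcal{A}_{gh}$; two $G$-gradings are isomorphic if some algebra isomorphism maps the component of degree $g$ onto the component of degree $g$ for all $g\in G$. A graded algebra is graded-simple if its product is nonzero and its only graded ideals are $0$ and itself. (Every $G$-grading and every automorphism of $\mathcal{C}\otimes\mathcal{C}$ preserves the tensor product of the standard involutions, whose space of skew elements is $(\mathcal{C}_0\otimes\mathbb{F}1)\oplus(\mathbb{F}1\otimes\mathcal{C}_0)$; this is therefore a graded subspace, closed under commutators.) The Cayley algebra $\mathcal{C}$ (unique $8$-dimensional unital composition algebra over $\mathbb{F}$) has a canonical basis $\{e_1,e_2,u_1,u_2,u_3,v_1,v_2,v_3\}$ with (indices mod $3$) $e_1,e_2$ orthogonal idempotents, $e_1+e_2=1$, $e_1u_i=u_i=u_ie_2$, $e_2v_i=v_i=v_ie_1$, $u_iv_i=-e_1$, $v_iu_i=-e_2$, $u_iu_{i+1}=-u_{i+1}u_i=v_{i+2}$, $v_iv_{i+1}=-v_{i+1}v_i=u_{i+2}$, all other products of basis elements $0$. $\mathcal{C}_0=\mathrm{span}\{e_1-e_2,u_i,v_i\}$ is the space of skew elements for the standard involution. For an abelian group $\overline{G}$ and a triple $\overline\gamma=(\bar g_1,\bar g_2,\bar g_3)$ in $\overline G$ with product $e$, $\Gamma^1_{\mathcal{C}}(\overline G,\overline\gamma)$ is the $\overline G$-grading on $\mathcal{C}$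 with $\deg e_1=\deg e_2=e$, $\deg u_i=\bar g_i$, $\deg v_i=\bar g_i^{-1}$. For triples, $\overline\gamma\sim\overline\gamma'$ means there is a permutation $\pi$ of $\{1,2,3\}$ with $\bar g'_i=\bar g_{\pi(i)}$ for all $i$, or $\bar g'_i=\bar g_{\pi(i)}^{-1}$ for all $i$. For a subgroup $\overline H\le\overline G$ isomorphic to $(\mathbb{Z}/2)^3$, $\Gamma^2_{\mathcal{C}}(\overline G,\overline H)$ is the $\overline G$-grading with support $\overline H=\langle \bar a,\bar b,\bar c\rangle$ in which $\deg u=\bar a$, $\deg v=\bar b$, $\deg w=\bar c$, where $u=e_1-e_2$, $v=u_1+v_1$, $w=u_2+v_2$ and $1,u,v,w,uv,uw,vw,(uv)w$ is a homogeneous basis (up to isomorphism, independent of the choice of generators). Let $h\in G$ have order $2$, $\pi:G\to\overline G=G/\langle h\rangle$ the projection, and let $\chi:G\to\mathbb{F}^\times$ be a character with $\chi(h)=-1$. Given a $\overline G$-grading on $\mathcal{C}$, the associated $G$-grading on $\mathcal{C}\times\mathcal{C}$ (transported from the loop algebra $L_\pi(\mathcal{C})=\sum_{g\in G}\mathcal{C}_{\pi(g)}\otimes g\subseteq\mathcal{C}\otimes\mathbb{F}G$ by $x\otimes g\mapsto(x,\chi(g)x)$) is $(\mathcal{C}\times\mathcal{C})_g=\{(x,\chi(g)x):x\in\mathcal{C}_{\pi(g)}\}$, which up to isomorphism does not depend on $\chi$. Starting from $\Gamma^1_{\mathcal{C}}(\overline G,\overline\gamma)$ and $\Gamma^2_{\mathcal{C}}(\overline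 G,\overline H)$ one obtains $\Gamma^1_{\mathcal{C}\times\mathcal{C}}(G,h,\overline\gamma)$ and $\Gamma^2_{\mathcal{C}\times\mathcal{C}}(G,h,\overline H)$. Then $\Gamma^1_{\mathcal{C}\otimes\mathcal{C}}(G,h,\overline\gamma)$ (resp. $\Gamma^2_{\mathcal{C}\otimes\mathcal{C}}(G,h,\overline H)$) is the unique $G$-grading on $\mathcal{C}\otimes\mathcal{C}$ such that for every $(x,y)\in\mathcal{C}_0\times\mathcal{C}_0$ homogeneous of degree $g$ in $\Gamma^1_{\mathcal{C}\times\mathcal{C}}(G,h,\overline\gamma)$ (resp. $\Gamma^2_{\mathcal{C}\times\mathcal{C}}(G,h,\overline H)$), the element $x\otimes1+1\otimes y$ is homogeneous of degree $g$. *)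

(* Defs.v *)
From HB Require Import structures.
From mathcomp Require Import all_boot all_order all_algebra.
From mathcomp Require Import perm.
From mathcomp Require Import boolp classical_sets.

Set Implicit Arguments.
Unset Strict Implicit.
Unset Printing Implicit Defensive.

Import GRing.Theory.
Local Open Scope ring_scope.

(* Abelian groups are written additively (zmodType): the product of the
   multiplicative notation is +, and the neutral element is 0. *)

(* MathComp has no non-associative algebras: an algebra is a finite-dimensional
   vector space together with a product, and a subalgebra is a subspace W. *)

Section Gradings.
Variables (F : fieldType) (V : vectType F) (mul : V -> V -> V) (G : zmodType).
Implicit Types (A : G -> {vspace V}) (W I : {vspace V}).

(* G may be infinite, hence the finite sequences of degrees. *)
Definition direct_decomposition W A : Prop :=
  [/\ forall g, (A g <= W)%VS,
      forall x, x \in W -> exists s : seq G, x \in (\sum_(g <- s) A g)%VS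
    & forall s : seq G, uniq s -> directv (\sum_(g <- s) A g)%VS].

Definition is_grading A : Prop :=
  direct_decomposition fullv A /\
  forall g k x y, x \in A g -> y \in A k -> mul x y \in A (g + k).

Definition graded_iso A A' : Prop :=
  exists f : 'End(V),
    [/\ bijective f, {morph f : x y / mul x y}
      & forall g, (f @: A g)%VS = A' g].

Definition graded_ideal W A I : Prop :=
  [/\ (I <= W)%VS,
      forall x y, x \in I -> y \in W -> mul x y \in I /\ mul y x \in I
    & direct_decomposition I (fun g => I :&: A g)%VS].

Definition graded_simple W A : Prop :=
  (exists x y, [/\ x \in W, y \in W & mul x y != 0]) /\
  (forall I, graded_ideal W A I -> I = 0%VS \/ I = W).

Definition commutator x y := mul x y - mul y x.

(* The family of subspaces for which each b j is homogeneous of degree deg j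
   (of interest when b is a basis of V). *)
Definition basis_grading (J : finType) (b : J -> V) (deg : J -> G) :
  G -> {vspace V} := fun g => (\sum_(j | deg j == g) <[b j]>)%VS.

End Gradings.

(* Index set of the canonical basis.  inl false, inl true stand for e_1, e_2;
   inr (false, i), inr (true, i) stand for u_{i+1}, v_{i+1}.  The indices are
   in 'Z_3, so that + is addition modulo 3. *)
Definition cayley_idx : finType := (bool + bool * 'Z_3)%type.

(* Pointwise operations give the vector space structure; the product is cmul. *)
Notation cayley F := {ffun cayley_idx -> F^o}.

(* C (x) C in coordinates: the value at (i, j) is the coefficient of the tensor
   product of the i-th and j-th elements of the canonical basis. *)
Notation cayley2 F := {ffun cayley_idx * cayley_idx -> F^o}.

Section Cayley.
Variable F : fieldType.

Definition cbase (i : cayley_idx) : cayley F := [ffun j => (i == j)%:R].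

Definition ce (b : bool) : cayley F := cbase (inl b).
Definition cu (i : 'Z_3) : cayley F := cbase (inr (false, i)).
Definition cv (i : 'Z_3) : cayley F := cbase (inr (true, i)).

Definition cbase_mul (p q : cayley_idx) : cayley F :=
  match p, q with
  | inl b, inl c => if b == c then ce b else 0
  | inl b, inr (c, i) => if b == c then cbase (inr (c, i)) else 0
  | inr (b, i), inl c => if b != c then cbase (inr (b, i)) else 0
  | inr (b, i), inr (c, j) =>
      if b == c then
        if j == i + 1 then cbase (inr (~~ b, i + 2%:R))
        else if i == j + 1 then - cbase (inr (~~ b, j + 2%:R))
        else 0
      else if i == j then - ce b else 0
  end.

Definition cmul (x y : cayley F) : cayley F :=
  \sum_p \sum_q (x p * y q) *: cbase_mul p q.

Definition cone : cayley F := ce false + ce true.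

Definition cskew : {vspace cayley F} :=
  (<[ce false - ce true]> + \sum_i <[cu i]> + \sum_i <[cv i]>)%VS.

Definition tens (x y : cayley F) : cayley2 F := [ffun p => x p.1 * y p.2].

(* The bilinear extension of (x (x) y)(x' (x) y') = xx' (x) yy'. *)
Definition tmul (z t : cayley2 F) : cayley2 F :=
  \sum_p \sum_q (z p * t q) *: tens (cbase_mul p.1 q.1) (cbase_mul p.2 q.2).

(* (C_0 (x) F1) + (F1 (x) C_0), see tskewP *)
Definition tskew : {vspace cayley2 F} :=
  (linfun (tens^~ cone) @: cskew + linfun (tens cone) @: cskew)%VS.

Lemma tens_linear_l y : linear (tens^~ y).
Proof.
move=> a x x'; apply/ffunP => p; rewrite !ffunE mulrDl.
by congr (_ + _); rewrite /GRing.scale /= mulrA.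
Qed.

Lemma tens_linear_r x : linear (tens x).
Proof.
move=> a y y'; apply/ffunP => p; rewrite !ffunE mulrDr.
by congr (_ + _); rewrite /GRing.scale /= mulrCA.
Qed.

Lemma linfunE (U V : vectType F) (f : U -> V) : linear f -> linfun f =1 f.
Proof.
move=> flin x.
pose m := GRing.isLinear.Build F U V *:%R f flin.
pose f' : {linear U -> V} := HB.pack f m.
exact: (lfunE f' x).
Qed.

Lemma tskewP z :
  z \in tskew <->
  exists x y, [/\ x \in cskew, y \in cskew & z = tens x cone + tens cone y].
Proof.
split=> [/memv_addP[_ /memv_imgP[x xS ->]] [_ /memv_imgP[y yS ->]] -> |].
  exists x, y; split=> //.
  by rewrite (linfunE (tens_linear_l cone)) (linfunE (tens_linear_r cone)).
case=> x [y [xS yS ->]]; apply: memv_add; apply/memv_imgP.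
  by exists x => //; rewrite (linfunE (tens_linear_l cone)).
by exists y => //; rewrite (linfunE (tens_linear_r cone)).
Qed.

Lemma tmul_tens x y x' y' :
  tmul (tens x y) (tens x' y') = tens (cmul x x') (cmul y y').
Proof.
apply/ffunP => -[k l].
have E (z : cayley F) w i :
    cmul z w i = \sum_p \sum_q z p * w q * cbase_mul p q i.
  rewrite /cmul !sum_ffunE; apply: eq_bigr => p _.
  by rewrite sum_ffunE; apply: eq_bigr => q _; rewrite ffunE.
rewrite [RHS]ffunE /= !E /tmul sum_ffunE.
rewrite (eq_bigr (fun p : cayley_idx * cayley_idx =>
   \sum_q \sum_q' x p.1 * y p.2 * (x' q * y' q') *
     (cbase_mul p.1 q k * cbase_mul p.2 q' l))); last first.
  move=> p _; rewrite sum_ffunE pair_bigA; apply: eq_bigr => q _.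
  by rewrite !ffunE.
rewrite -(pair_bigA _ (fun p p' => \sum_q \sum_q' x p * y p' * (x' q * y' q') *
     (cbase_mul p q k * cbase_mul p' q' l))) mulr_suml /=.
apply: eq_bigr => p _; rewrite mulr_sumr; apply: eq_bigr => p' _.
rewrite mulr_suml; apply: eq_bigr => q _.
rewrite mulr_sumr; apply: eq_bigr => q' _.
by rewrite (mulrACA (x p)) (mulrACA (x p * x' q)).
Qed.

End Cayley.

Section Quotient.
Variable G : zmodType.

Definition cyc (h : G) : {pred G} := fun x => `[< exists n : int, x = h *~ n >].

Fact cyc_zmod_closed h : zmod_closed (cyc h).
Proof.
split=> [|x y /asboolP[m ->] /asboolP[n ->]]; apply/asboolP.
  by exists 0; rewrite mulr0z.
by exists (m - n); rewrite mulrzBr.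
Qed.
HB.instance Definition _ h :=
  GRing.isZmodClosed.Build G (cyc h) (cyc_zmod_closed h).

(* G/<h>; the projection is \pi_(quot_cyc h)%qT. *)
Definition quot_cyc (h : G) : zmodType := Quotient.quot (cyc h).

Definition order2 (h : G) : Prop := h != 0 /\ h *+ 2 = 0.

(* chi 0 = 1 follows. *)
Definition is_character (F : fieldType) (chi : G -> F) : Prop :=
  (forall g, chi g != 0) /\ (forall g k, chi (g + k) = chi g * chi k).

End Quotient.

Section CayleyGradings.
Variables (F : fieldType) (G : zmodType).

(* gamma, a triple with product e, is indexed by 'Z_3 as the u_i and v_i are *)
Definition deg1 (gamma : 'Z_3 -> G) (i : cayley_idx) : G :=
  match i with
  | inl _ => 0
  | inr (b, j) => if b then - gamma j else gamma j
  end.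

Definition Gamma1_C (gamma : 'Z_3 -> G) : G -> {vspace cayley F} :=
  basis_grading (@cbase F) (deg1 gamma).

Definition triple_sim (gamma gamma' : 'Z_3 -> G) : Prop :=
  exists s : {perm 'Z_3},
    (forall i, gamma' i = gamma (s i)) \/ (forall i, gamma' i = - gamma (s i)).

(* (b1, b2, b3) stands for (u^b1 v^b2) w^b3, where u = e_1 - e_2,
   v = u_1 + v_1, w = u_2 + v_2. *)
Definition uvw_base (j : bool * bool * bool) : cayley F :=
  let u := ce F false - ce F true in
  let v := cu F 0 + cv F 0 in
  let w := cu F 1 + cv F 1 in
  let pow (b : bool) x := if b then x else cone F in
  cmul (cmul (pow j.1.1 u) (pow j.1.2 v)) (pow j.2 w).

Definition deg2 (a b c : G) (j : bool * bool * bool) : G :=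
  a *+ j.1.1 + b *+ j.1.2 + c *+ j.2.

Definition Gamma2_C (a b c : G) : G -> {vspace cayley F} :=
  basis_grading uvw_base (deg2 a b c).

Definition elem_abelian8 (H : set G) : Prop :=
  exists f : {additive 'rV['Z_2]_3 -> G}, injective f /\ H = range f.

Definition generated3 (H : set G) (a b c : G) : Prop :=
  H = [set x | exists i j k : int, x = a *~ i + b *~ j + c *~ k]%classic.

End CayleyGradings.

Section LoopGradings.
Variables (F : fieldType) (G : zmodType).
Variables (h : G) (chi : G -> F) (A : quot_cyc h -> {vspace cayley F}).

(* {(x, chi(g) x) : x in A_(pi g)}, see mem_prod_grading *)
Definition prod_grading (g : G) : {vspace (cayley F * cayley F)%type} :=
  (linfun (fun x : cayley F => (x, chi g *: x)) @:
     A (\pi_(quot_cyc h)%qT g))%VS.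

Lemma mem_prod_grading g x y :
  (x, y) \in prod_grading g <->
  x \in A (\pi_(quot_cyc h)%qT g) /\ y = chi g *: x.
Proof.
have lin : linear (fun x : cayley F => (x, chi g *: x)).
  by move=> a u v; rewrite scalerDr scalerA mulrC -scalerA.
split=> [/memv_imgP[z zA]|[xA ->]].
  by rewrite (linfunE lin) => -[-> ->].
by apply/memv_imgP; exists x => //; rewrite (linfunE lin).
Qed.

(* The unique G-grading on C (x) C for which x (x) 1 + 1 (x) y has degree g
   whenever (x, y) in C_0 x C_0 has degree g. *)
Definition tensor_grading : G -> {vspace cayley2 F} :=
  xget (fun=> 0%VS)
    [set B : G -> {vspace cayley2 F} |
       is_grading (@tmul F) B /\
       forall g x y, x \in cskew F -> y \in cskew F ->
         (x, y) \in prod_grading g ->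
         tens x (cone F) + tens (cone F) y \in B g]%classic.

End LoopGradings.

Section TensorGradings.
Variables (F : fieldType) (G : zmodType) (h : G) (chi : G -> F).

Definition Gamma1_CC (gamma : 'Z_3 -> quot_cyc h) : G -> {vspace cayley2 F} :=
  tensor_grading chi (Gamma1_C F gamma).

Definition Gamma2_CC (a b c : quot_cyc h) : G -> {vspace cayley2 F} :=
  tensor_grading chi (Gamma2_C F a b c).

(* Up to isomorphism Gamma1_CC and Gamma2_CC do not
   depend on the choice of chi, nor on that of the generators a, b, c. *)
Definition params1 (gamma : 'Z_3 -> quot_cyc h) : Prop :=
  [/\ order2 h, is_character chi, chi h = -1 & \sum_i gamma i = 0].

Definition params2 (H : set (quot_cyc h)) (a b c : quot_cyc h) : Prop :=
  [/\ order2 h, is_character chi, chi h = -1, elem_abelian8 H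
    & generated3 H a b c].

End TensorGradings.

(* Main.v *)
(** The subspace C (x) 1 + 1 (x) C of C (x) C is cut out by the identity
(z, x, y) = - (x, z, y) for associators, and its commutators span the space S of
skew elements; so every grading and every automorphism preserves S, and two
gradings of C (x) C that agree on S are equal.

The centroid of S under commutators is spanned by 1 and by theta, which is 1 on
C_0 (x) 1 and -1 on 1 (x) C_0.  If S is graded-simple, the homogeneous components
of theta, which lie in the centroid, force theta to be homogeneous of some degree
h of order 2.  A character chi with chi(h) = -1 (Zorn, as F^* is divisible) acts
on C (x) C by an automorphism anticommuting with theta on S, hence exchanging
C (x) 1 and 1 (x) C.  This makes S the loop algebra of a grading of C by G/<h>.

A grading of C whose component of degree 0 is larger than F1 has w of degree 0
with w^2 = 1, and homogeneous x_1, x_2, x_3 in the Peirce space e C (1 - e) of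
e = (1 + w)/2 with (x_1 x_2) x_3 = e - 1 generate a canonical basis.  Otherwise
all components are lines and the degrees of three of them generate (Z/2)^3.

Conversely h is recovered as the degree of theta, up to sign the only square root
of 1 in the centroid other than 1 and -1, and the dimensions of the components of
S determine gamma up to equivalence, resp. the subgroup H. *)

From HB Require Import structures.
Require Import Defs.
From mathcomp Require Import all_boot all_order all_algebra.
From mathcomp Require Import perm.
From mathcomp Require Import boolp classical_sets.
From mathcomp Require Import ring.

Set Implicit Arguments.
Unset Strict Implicit.
Unset Printing Implicit Defensive.

Import GRing.Theory.
Local Open Scope ring_scope.

(** * The octonion algebra in coordinates *)

(** G may have too few characters to recover a grading from automorphisms, for instance when it has
    p-torsion in characteristic p. Gradings are therefore handled through the linear projections
    [hcomp] onto their components, and the one special character, with value -1 at h, is asked only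
    to exchange the two factors. Subspaces are described by multilinear identities for the same
    reason: such identities pass to homogeneous components.

    A second obstacle is that the degrees of a model grading are prescribed on S only, and have to
    be extended to C (x) C. Tensoring a G/<h>-grading of C with itself gives a G/<h>-grading of C
    (x) C. It is refined by a twisted exchange Q of the factors, an automorphism whose square is the
    scalar chi(g)^-2 in degree pi(g): the eigenvalues chi(g)^-1 and -chi(g)^-1 of Q correspond to
    the two lifts g and g + h of pi(g).

    Isomorphisms onto the models have the form f (x) g with f and g automorphisms of C. Since a
    grading is determined by its restriction to S, they need to be compared on S only. *)

Lemma Z3_cases (P : 'Z_3 -> Prop) : P 0 -> P 1 -> P 2%:R -> forall i, P i.
Proof.
move=> P0 P1 P2 [[|[|[|//]]] i].
- by rewrite (_ : Ordinal i = 0) //; apply: val_inj.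
- by rewrite (_ : Ordinal i = 1) //; apply: val_inj.
- by rewrite (_ : Ordinal i = 2%:R) //; apply: val_inj.
Qed.

Lemma big_Z3 (R : nmodType) (f : 'Z_3 -> R) :
  \sum_i f i = f 0 + f 1 + f 2%:R.
Proof.
rewrite !big_ord_recl big_ord0 addr0 addrA.
by congr (f _ + f _ + f _); apply: val_inj.
Qed.

Section Cayley.
Variable F : fieldType.
Implicit Types x y z : cayley F.

Lemma big_cayley_idx (R : nmodType) (f : cayley_idx -> R) :
  \sum_p f p = f (inl false) + f (inl true)
    + (f (inr (false, 0)) + f (inr (false, 1)) + f (inr (false, 2%:R)))
    + (f (inr (true, 0)) + f (inr (true, 1)) + f (inr (true, 2%:R))).
Proof.
rewrite big_sumType /= big_bool /=.
rewrite (eq_bigr (fun p => f (inr (p.1, p.2)))); last by case.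
rewrite -(pair_bigA _ (fun i j => f (inr (i, j)))) big_bool !big_Z3 /=.
rewrite (addrC (f (inl true))) -[RHS]addrA; congr (_ + _).
exact: addrC.
Qed.

Definition oct (a b u0 u1 u2 v0 v1 v2 : F) : cayley F :=
  [ffun p => match p with
   | inl b' => if b' then b else a
   | inr (b', i) =>
     if b' then if i == 0 then v0 else if i == 1 then v1 else v2
     else if i == 0 then u0 else if i == 1 then u1 else u2
   end].

Lemma cayley_ext x y : (forall b, x (inl b) = y (inl b)) ->
  (forall b i, x (inr (b, i)) = y (inr (b, i))) -> x = y.
Proof. by move=> e f; apply/ffunP => -[b|[b i]]. Qed.

Lemma octE x : x = oct (x (inl false)) (x (inl true))
  (x (inr (false, 0))) (x (inr (false, 1))) (x (inr (false, 2%:R)))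
  (x (inr (true, 0))) (x (inr (true, 1))) (x (inr (true, 2%:R))).
Proof. by apply: cayley_ext => [[]|[]]; [..|elim/Z3_cases|elim/Z3_cases];
  rewrite ffunE. Qed.

Lemma cmulE x y r : cmul x y r = \sum_p \sum_q x p * y q * cbase_mul F p q r.
Proof.
rewrite /cmul !sum_ffunE; apply: eq_bigr => p _.
by rewrite sum_ffunE; apply: eq_bigr => q _; rewrite ffunE.
Qed.

(** Zorn's vector matrices: with [u] and [v] vectors of F^3, the diagonal entries of the product
    involve the scalar products u.v' and v.u', the other entries the cross products of v, v' and of
    u, u'. Identities in C become polynomial identities in coordinates, within reach of [ring]. *)
Lemma cmul_oct a b u0 u1 u2 v0 v1 v2 a' b' u0' u1' u2' v0' v1' v2' :
  cmul (oct a b u0 u1 u2 v0 v1 v2) (oct a' b' u0' u1' u2' v0' v1' v2') =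
  oct (a * a' - (u0 * v0' + u1 * v1' + u2 * v2'))
      (b * b' - (v0 * u0' + v1 * u1' + v2 * u2'))
      (a * u0' + u0 * b' + (v1 * v2' - v2 * v1'))
      (a * u1' + u1 * b' + (v2 * v0' - v0 * v2'))
      (a * u2' + u2 * b' + (v0 * v1' - v1 * v0'))
      (b * v0' + v0 * a' + (u1 * u2' - u2 * u1'))
      (b * v1' + v1 * a' + (u2 * u0' - u0 * u2'))
      (b * v2' + v2 * a' + (u0 * u1' - u1 * u0')).
Proof.
(* The structure constants as scalars, so that every term of the 64-term sum computes. *)
pose cm (p q r : cayley_idx) : F := match p, q with
  | inl b, inl c => if b == c then (inl b == r)%:R else 0
  | inl b, inr (c, i) => if b == c then (inr (c, i) == r)%:R else 0
  | inr (b, i), inl c => if b != c then (inr (b, i) == r)%:R else 0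
  | inr (b, i), inr (c, j) =>
      if b == c then
        if j == i + 1 then (inr (~~ b, i + 2%:R) == r)%:R
        else if i == j + 1 then - (inr (~~ b, j + 2%:R) == r)%:R
        else 0
      else if i == j then - (inl b == r)%:R else 0
  end.
have cmP p q r : cbase_mul F p q r = cm p q r.
  by case: p q => [c|[c i]] [c'|[c' i']] /=; do ?case: ifP => _; rewrite !ffunE.
have -> : cmul (oct a b u0 u1 u2 v0 v1 v2)
    (oct a' b' u0' u1' u2' v0' v1' v2') = [ffun r => \sum_p \sum_q
  (match p with
   | inl b' => if b' then b else a
   | inr (b', i) =>
     if b' then if i == 0 then v0 else if i == 1 then v1 else v2
     else if i == 0 then u0 else if i == 1 then u1 else u2
   end) * (match q with
   | inl c => if c then b' else a'
   | inr (c, i) =>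
     if c then if i == 0 then v0' else if i == 1 then v1' else v2'
     else if i == 0 then u0' else if i == 1 then u1' else u2'
   end) * cm p q r].
  apply/ffunP => r; rewrite cmulE ffunE; apply: eq_bigr => p _.
  by apply: eq_bigr => q _; rewrite !ffunE cmP.
apply: cayley_ext => [[]|[]]; [..|elim/Z3_cases|elim/Z3_cases];
  rewrite !ffunE !big_cayley_idx /=; ring.
Qed.
End Cayley.

Section CayleyCoordinates.
Variable F : fieldType.
Implicit Types x y z : cayley F.

Lemma oct_ind (P : cayley F -> Prop) :
  (forall a b u0 u1 u2 v0 v1 v2, P (oct a b u0 u1 u2 v0 v1 v2)) -> forall x, P x.
Proof. by move=> H x; rewrite (octE x). Qed.

Lemma octD a b u0 u1 u2 v0 v1 v2 a' b' u0' u1' u2' v0' v1' v2' :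
  oct a b u0 u1 u2 v0 v1 v2 + oct a' b' u0' u1' u2' v0' v1' v2' =
  oct (a + a') (b + b') (u0 + u0') (u1 + u1') (u2 + u2')
      (v0 + v0') (v1 + v1') (v2 + v2') :> cayley F.
Proof.
by apply: cayley_ext => [[]|[]]; [..|elim/Z3_cases|elim/Z3_cases]; rewrite !ffunE.
Qed.

Lemma octZ (c : F) a b u0 u1 u2 v0 v1 v2 :
  c *: oct a b u0 u1 u2 v0 v1 v2 =
  oct (c * a) (c * b) (c * u0) (c * u1) (c * u2) (c * v0) (c * v1) (c * v2).
Proof.
by apply: cayley_ext => [[]|[]]; [..|elim/Z3_cases|elim/Z3_cases]; rewrite !ffunE.
Qed.

Lemma octN a b u0 u1 u2 v0 v1 v2 :
  - oct a b u0 u1 u2 v0 v1 v2 =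
  oct (- a) (- b) (- u0) (- u1) (- u2) (- v0) (- v1) (- v2) :> cayley F.
Proof.
by apply: cayley_ext => [[]|[]]; [..|elim/Z3_cases|elim/Z3_cases]; rewrite !ffunE.
Qed.

Lemma oct0 : 0 = oct 0 0 0 0 0 0 0 0 :> cayley F.
Proof.
by apply: cayley_ext => [[]|[]]; [..|elim/Z3_cases|elim/Z3_cases]; rewrite !ffunE.
Qed.

Lemma ce_oct b : ce F b = oct (~~ b)%:R b%:R 0 0 0 0 0 0.
Proof.
case: b; rewrite /ce /cbase; by apply: cayley_ext => [[]|[]];
  [..|elim/Z3_cases|elim/Z3_cases]; rewrite !ffunE.
Qed.

Lemma cu_oct i :
  cu F i = oct 0 0 (i == 0)%:R (i == 1)%:R (i == 2%:R)%:R 0 0 0.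
Proof.
rewrite /cu /cbase; elim/Z3_cases: i.
all: by apply: cayley_ext => [[]|[]]; [..|elim/Z3_cases|elim/Z3_cases];
  rewrite !ffunE.
Qed.

Lemma cv_oct i :
  cv F i = oct 0 0 0 0 0 (i == 0)%:R (i == 1)%:R (i == 2%:R)%:R.
Proof.
rewrite /cv /cbase; elim/Z3_cases: i.
all: by apply: cayley_ext => [[]|[]]; [..|elim/Z3_cases|elim/Z3_cases];
  rewrite !ffunE.
Qed.

Lemma cone_oct : cone F = oct 1 1 0 0 0 0 0 0.
Proof. by rewrite /cone !ce_oct octD /= !(addr0, add0r). Qed.

Definition tr x : F := x (inl false) + x (inl true).

Lemma tr_oct a b u0 u1 u2 v0 v1 v2 : tr (oct a b u0 u1 u2 v0 v1 v2) = a + b.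
Proof. by rewrite /tr !ffunE. Qed.

Lemma oct_inj a b u0 u1 u2 v0 v1 v2 a' b' u0' u1' u2' v0' v1' v2' :
  oct a b u0 u1 u2 v0 v1 v2 = oct a' b' u0' u1' u2' v0' v1' v2' :> cayley F ->
  (a = a' /\ b = b') /\ (u0 = u0' /\ u1 = u1' /\ u2 = u2') /\
  (v0 = v0' /\ v1 = v1' /\ v2 = v2').
Proof.
move=> /ffunP e.
move: (e (inl false)) (e (inl true)) (e (inr (false, 0))) (e (inr (false, 1)))
  (e (inr (false, 2%:R))) (e (inr (true, 0))) (e (inr (true, 1)))
  (e (inr (true, 2%:R))).
by rewrite !ffunE.
Qed.

Definition octs :=
  (cmul_oct, octD, octZ, octN, cone_oct, ce_oct, cu_oct, cv_oct, tr_oct).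

End CayleyCoordinates.

Ltac oct x := elim/oct_ind: x => ? ? ? ? ? ? ? ?.
Ltac oct_ring := rewrite !octs /=; congr (oct _ _ _ _ _ _ _ _); ring.

(** * Trace, norm and alternative laws *)

Section CayleyLaws.
Variable F : fieldType.
Implicit Types x y z : cayley F.

Lemma cmulDl x x' y : cmul (x + x') y = cmul x y + cmul x' y.
Proof. by oct x; oct x'; oct y; oct_ring. Qed.

Lemma cmulDr x y y' : cmul x (y + y') = cmul x y + cmul x y'.
Proof. by oct x; oct y; oct y'; oct_ring. Qed.

Lemma cmulZl a x y : cmul (a *: x) y = a *: cmul x y.
Proof. by oct x; oct y; oct_ring. Qed.

Lemma cmulZr a x y : cmul x (a *: y) = a *: cmul x y.
Proof. by oct x; oct y; oct_ring. Qed.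

Lemma cmul1 x : cmul (cone F) x = x.
Proof. by oct x; oct_ring. Qed.

Lemma cmulx1 x : cmul x (cone F) = x.
Proof. by oct x; oct_ring. Qed.

Lemma trD x y : tr (x + y) = tr x + tr y.
Proof. by oct x; oct y; rewrite !octs; ring. Qed.

Lemma trZ a x : tr (a *: x) = a * tr x.
Proof. by oct x; rewrite !octs; ring. Qed.

Lemma tr1 : tr (cone F) = 2%:R.
Proof. by rewrite !octs; ring. Qed.

Lemma tr_mulC x y : tr (cmul x y) = tr (cmul y x).
Proof. by oct x; oct y; rewrite !octs; ring. Qed.

Lemma tr_mulA x y z : tr (cmul (cmul x y) z) = tr (cmul x (cmul y z)).
Proof. by oct x; oct y; oct z; rewrite !octs; ring. Qed.

Lemma tr0 : tr (0 : cayley F) = 0.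
Proof. by rewrite oct0 tr_oct addr0. Qed.

Lemma trN x : tr (- x) = - tr x.
Proof. by rewrite -scaleN1r trZ mulN1r. Qed.

Lemma cbase_sum x : x = \sum_q x q *: cbase F q.
Proof.
apply/ffunP => i; rewrite sum_ffunE (bigD1 i) //= big1 => [|j ji].
  by rewrite !ffunE eqxx /GRing.scale /= mulr1 addr0.
by rewrite !ffunE (negPf ji) /GRing.scale /= mulr0.
Qed.

Lemma tr_ce_diff : tr (ce F false - ce F true) = 0.
Proof. by rewrite !octs /=; ring. Qed.

Lemma ce_diff_neq0 : ce F false - ce F true != 0.
Proof.
apply/eqP => /ffunP /(_ (inl false)); rewrite !octs !ffunE /= oppr0 addr0.
by move/eqP; rewrite oner_eq0.
Qed.

(** The polar form of the norm n: [polar x x] is 2 n(x), where x^2 - tr(x) x + n(x) 1 = 0. *)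
Definition polar x y := tr x * tr y - tr (cmul x y).

(** Linearization of the quadratic equation x^2 = tr(x) x - n(x) 1. *)
Lemma cmul_anti x y : cmul x y + cmul y x =
  tr x *: y + tr y *: x - polar x y *: cone F.
Proof. by rewrite /polar; oct x; oct y; oct_ring. Qed.

Lemma left_alt x y z :
  cmul x (cmul y z) + cmul y (cmul x z) = cmul (cmul x y + cmul y x) z.
Proof. by oct x; oct y; oct z; oct_ring. Qed.

Lemma right_alt x y z :
  cmul (cmul z x) y + cmul (cmul z y) x = cmul z (cmul x y + cmul y x).
Proof. by oct x; oct y; oct z; oct_ring. Qed.

Lemma tr_mul_nondeg x : (forall y, tr (cmul x y) = 0) -> x = 0.
Proof.
oct x => H; rewrite oct0.
move: (H (ce F false)) (H (ce F true)) (H (cu F 0)) (H (cu F 1)) (H (cu F 2%:R))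
  (H (cv F 0)) (H (cv F 1)) (H (cv F 2%:R)).
rewrite !octs /= !(mulr0, mulr1, mul0r, mul1r, addr0, add0r, subr0, sub0r, oppr0).
by do 8![move/eqP; rewrite ?oppr_eq0 => /eqP->].
Qed.

(** The three pairs ([cu i], [cu (i + 1)]) suffice: together they kill the six off-diagonal
    coordinates of [x], and the first pair also equates the two diagonal ones. *)
Lemma nucleusP x :
  (forall y z, cmul (cmul x y) z = cmul x (cmul y z)) -> exists a, x = a *: cone F.
Proof.
pose simp := (mulr0, mulr1, mul0r, mul1r, addr0, add0r, subr0, sub0r, oppr0).
oct x => H; move: (H (cu F 0) (cu F 1)); rewrite !octs /= !simp.
move/oct_inj => -[[/esym/eqP]];
  rewrite oppr_eq0 => /eqP u2 _ [[v1 [/esym/eqP v0 _]] [_ [_ ab]]].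
move: (H (cu F 1) (cu F 2%:R)); rewrite !octs /= !simp.
move/oct_inj => -[[/esym/eqP]]; rewrite oppr_eq0 => /eqP u0 _ [[_ [v2 _]] _].
move: (H (cu F 2%:R) (cu F 0)); rewrite !octs /= !simp.
move/oct_inj => -[[/esym/eqP]]; rewrite oppr_eq0 => /eqP u1 _ _.
rewrite oppr_eq0 in v0; rewrite ab u0 u1 u2 (eqP v0) -v1 -v2.
by eexists; rewrite !octs /= !simp.
Qed.

Lemma cskewP x : reflect (tr x = 0) (x \in cskew F).
Proof.
apply: (iffP idP) => [|t0].
  have trs (w : 'Z_3 -> cayley F) : (forall i, tr (w i) = 0) -> tr (\sum_i w i) = 0.
    by move=> w0; rewrite big_Z3 !trD !w0 !addr0.
  case/memv_addP => [y /memv_addP[z /vlineP[k ->] [t /memv_sumP[u uP ->] ->]]].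
  case=> t' /memv_sumP[v vP ->] ->.
  rewrite !trD trZ !trs ?addr0; last first.
  - by move=> i; have /vlineP[c ->] := uP i isT; rewrite trZ cu_oct tr_oct addr0 mulr0.
  - by move=> i; have /vlineP[c ->] := vP i isT; rewrite trZ cv_oct tr_oct addr0 mulr0.
  by rewrite !octs /=; ring.
have -> : x = x (inl false) *: (ce F false - ce F true) +
  \sum_i x (inr (false, i)) *: cu F i + \sum_i x (inr (true, i)) *: cv F i.
  rewrite !big_Z3; move: t0; oct x; rewrite !ffunE /= tr_oct => /eqP.
  by rewrite addrC addr_eq0 => /eqP ->; oct_ring.
apply: memv_add; first apply: memv_add.
- by rewrite memvZ // memv_line.
- by apply: memv_sumr => i _; rewrite memvZ // memv_line.
- by apply: memv_sumr => i _; rewrite memvZ // memv_line.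
Qed.

Lemma neq2 : 2%N \notin [pchar F] -> 2%:R != 0 :> F.
Proof. by rewrite inE. Qed.

Lemma opp_eq0 (a : F) : 2%N \notin [pchar F] -> - a = a -> a = 0.
Proof.
move=> /neq2 n2 /eqP; rewrite -subr_eq0 -opprD oppr_eq0 -mulr2n -mulr_natl.
by rewrite mulf_eq0 (negPf n2) => /eqP.
Qed.

(** Commuting with e_1 - e_2 kills the off-diagonal coordinates, because 2 is invertible. Commuting
    with [cv 0] makes the diagonal ones equal, and they are opposite since the trace is 0. *)
Lemma skew_centerP x : 2%N \notin [pchar F] -> tr x = 0 ->
  (forall y, tr y = 0 -> cmul x y = cmul y x) -> x = 0.
Proof.
move=> char2; oct x; rewrite tr_oct => t0 H.
have := H (ce F false - ce F true); have := H (cv F 0).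
rewrite !octs /= => /(_ ltac:(ring)) Hv /(_ ltac:(ring)).
move: Hv; rewrite !(mulr0, mulr1, mul0r, mul1r, addr0, add0r, subr0, sub0r, oppr0).
rewrite !mulrN1 !mulN1r => /oct_inj[_ [_ [e _]]].
move=> /oct_inj[_ [[a0 [a1 a2]] [/esym b0 [/esym b1 /esym b2]]]].
move: a0 a1 a2 b0 b1 b2; do 6![move/(opp_eq0 char2) ->].
move: t0; rewrite -e => /eqP; rewrite addr_eq0 => /eqP /esym /(opp_eq0 char2) ->.
by rewrite oct0.
Qed.
End CayleyLaws.

(** * Gradings and homogeneous components *)

Section Decompositions.
Variables (F : fieldType) (V : vectType F) (G : zmodType).
Implicit Types (A B : G -> {vspace V}) (W : {vspace V}).

Lemma memv_sum_seq A (s : seq G) g x : g \in s -> x \in A g ->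
  x \in (\sum_(k <- s) A k)%VS.
Proof.
move=> gs xA; rewrite (perm_big _ (perm_to_rem gs)) big_cons /=.
exact: subvP (addvSl _ _) _ xA.
Qed.

Lemma sumv_seq_mono A (s s' : seq G) : {subset s <= s'} ->
  (\sum_(k <- s) A k <= \sum_(k <- s') A k)%VS.
Proof.
elim: s => [|g s IH] ss; first by rewrite big_nil sub0v.
rewrite big_cons subv_add IH ?andbT; last by move=> k ks; apply: ss; rewrite inE ks orbT.
by apply/subvP => x; apply: memv_sum_seq; apply: ss; rewrite inE eqxx.
Qed.

(** One finite sequence of degrees serves all of [W]: it collects those needed for the vectors of a
    basis. *)
Lemma sumv_seq_total A W : direct_decomposition W A ->
  exists2 s : seq G, uniq s & forall x, x \in W -> x \in (\sum_(g <- s) A g)%VS.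
Proof.
case=> _ total _.
have [s sP] : exists s : seq G,
    forall x, x \in (vbasis W : seq V) -> x \in (\sum_(g <- s) A g)%VS.
  have: {subset (vbasis W : seq V) <= W} by move=> x; apply: vbasis_mem.
  elim: (vbasis W : seq V) => [|y X IH] XW; first by exists [::].
  have [x xX|s sP] := IH; first by apply: XW; rewrite inE xX orbT.
  have [t yt] := total y (XW _ (mem_head _ _)).
  exists (t ++ s) => x; rewrite inE => /orP[/eqP->|xX].
    by apply: subvP yt; apply: sumv_seq_mono => k kt; rewrite mem_cat kt.
  by apply: subvP (sP x xX); apply: sumv_seq_mono => k kt; rewrite mem_cat kt orbT.
exists (undup s); first exact: undup_uniq.
move=> x; rewrite -(span_basis (vbasisP W)) => /coord_span->.
apply: memv_suml => i _; apply: memvZ.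
apply: subvP (sP _ (mem_nth 0 _)); last by rewrite size_tuple.
by apply: sumv_seq_mono => k; rewrite mem_undup.
Qed.

Definition is_component A (g : G) : set 'End(V) :=
  fun p => (forall x, x \in A g -> p x = x) /\
           (forall k x, k != g -> x \in A k -> p x = 0).

(** The projection onto [A g] along the other components. The default value is never taken for a
    direct decomposition of the whole space, by [hcomp_spec]. *)
Definition hcomp A (g : G) : 'End(V) := xget 0%VF (is_component A g).

Section Components.
Variable A : G -> {vspace V}.
Hypothesis ddA : direct_decomposition fullv A.

Lemma dd_cap0 g (s : seq G) : uniq (g :: s) -> (A g :&: \sum_(k <- s) A k = 0)%VS.
Proof.
case: ddA => _ _ dA us; have := dA _ us; rewrite directvE /= !big_cons /=.
move: us => /= /andP[_ us]; have := dA _ us; rewrite directvE /= => /eqP <-.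
by rewrite (eq_leqif (dimv_add_leqif _ _)) subv0 => /eqP.
Qed.

(** Take a finite sequence [s] of degrees whose components span V, and project along the sum of
    those other than g. A degree outside [s] has zero component, which is both contained in and
    independent of the sum over [s]. *)
Lemma hcomp_spec g : is_component A g (hcomp A g).
Proof.
suff [p pP] : exists p, is_component A g p by exact: xgetI pP.
have [s us sP] := sumv_seq_total ddA.
pose s' := [seq k <- s | k != g].
have us' : uniq (g :: s') by rewrite /= filter_uniq // mem_filter eqxx.
have cap0 := dd_cap0 us'.
exists (daddv_pi (A g) (\sum_(k <- s') A k)%VS); split=> [x|k x kg xA].
  exact: daddv_pi_id.
have [ks|kns] := boolP (k \in s).
  have xs : x \in (\sum_(k <- s') A k)%VS.
    by apply: memv_sum_seq xA; rewrite mem_filter kg.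
  have := daddv_pi_add cap0 (subvP (addvSr _ _) _ xs).
  rewrite (@daddv_pi_id _ _ _ (A g)) // 1?capvC //.
  by move/eqP; rewrite -subr_eq0 addrK => /eqP.
have : x \in (A k :&: \sum_(k <- s) A k)%VS by rewrite memv_cap xA sP ?memvf.
by rewrite dd_cap0 /= ?kns // memv0 => /eqP ->; rewrite linear0.
Qed.

Lemma hcomp_id g x : x \in A g -> hcomp A g x = x.
Proof. by case: (hcomp_spec g) => + _; apply. Qed.

Lemma hcomp_ne g k x : x \in A k -> k != g -> hcomp A g x = 0.
Proof. by move=> xA kg; case: (hcomp_spec g) => _; apply; eassumption. Qed.

Lemma homogeneous_ind (P : V -> Prop) : (forall x y, P x -> P y -> P (x + y)) ->
  P 0 -> (forall g x, x \in A g -> P x) -> forall x, P x.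
Proof.
move=> PD P0 PA x; have [s us sP] := sumv_seq_total ddA.
move: (sP x (memvf _)); elim: s x {us sP} => [|g s IH] x.
  by rewrite big_nil memv0 => /eqP->.
by rewrite big_cons => /memv_addP[y /PA Py [z /IH Pz ->]]; apply: PD.
Qed.

Lemma hcomp_mem g x : hcomp A g x \in A g.
Proof.
elim/homogeneous_ind: x => [x y xA yA||k x xA]; first by rewrite linearD memvD.
  by rewrite linear0 mem0v.
have [<-|kg] := eqVneq k g; first by rewrite hcomp_id.
by rewrite (hcomp_ne xA kg) mem0v.
Qed.

Lemma mem_hcomp g x : (x \in A g) = (hcomp A g x == x).
Proof. by apply/idP/eqP => [/hcomp_id//|<-]; apply: hcomp_mem. Qed.

Lemma hcomp_sum : exists2 s : seq G, uniq s & forall x, x = \sum_(g <- s) hcomp A g x.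
Proof.
have [s us sP] := sumv_seq_total ddA; exists s => // x.
elim/homogeneous_ind: x => [x y ex ey||k x xA].
- by rewrite {1}ex {1}ey -big_split; apply: eq_bigr => g _; rewrite linearD.
- by rewrite big1 // => g _; rewrite linear0.
have [ks|kns] := boolP (k \in s).
  rewrite (perm_big _ (perm_to_rem ks)) big_cons /= hcomp_id // big_seq big1 ?addr0 //.
  by move=> g; rewrite mem_rem_uniq // inE => /andP[gk _];
    rewrite (hcomp_ne xA) // eq_sym.
have : x \in (A k :&: \sum_(k <- s) A k)%VS by rewrite memv_cap xA sP ?memvf.
rewrite dd_cap0 /= ?kns // memv0 => /eqP ->.
by rewrite big1 // => g _; rewrite linear0.
Qed.

Lemma hcomp_eq0 x : (forall g, hcomp A g x = 0) -> x = 0.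
Proof. by have [s _ sP] := hcomp_sum; move=> x0; rewrite (sP x) big1. Qed.

Lemma hom_uniq g k x : x != 0 -> x \in A g -> x \in A k -> g = k.
Proof.
move=> x0 xg xk; apply/eqP; apply: contraNT x0 => gk.
by rewrite -(hcomp_id xk) (hcomp_ne xg gk).
Qed.

End Components.

(* Projections onto the A g replace the independence of the A g. *)
Lemma direct_decompositionI W A (p : G -> V -> V) :
  (forall g, (A g <= W)%VS) ->
  (forall x, x \in W -> exists s : seq G, x \in (\sum_(g <- s) A g)%VS) ->
  (forall g x y, p g (x + y) = p g x + p g y) ->
  (forall g x, x \in A g -> p g x = x) ->
  (forall g k x, x \in A k -> k != g -> p g x = 0) ->
  direct_decomposition W A.
Proof.
move=> AW total pD pid pne; split=> // s us; apply/directvP => /=.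
have p0 g : p g 0 = 0 by apply: (addIr (p g 0)); rewrite -pD !add0r.
have psum g t x : g \notin t -> x \in (\sum_(k <- t) A k)%VS -> p g x = 0.
  elim: t x => [|k t IH] x; first by rewrite big_nil memv0 => _ /eqP->.
  rewrite inE negb_or big_cons => /andP[gk gt] /memv_addP[y yk [z zs ->]].
  by rewrite pD (pne _ _ _ yk) 1?eq_sym // add0r IH.
elim: s us => [|g s IH] /=; first by rewrite !big_nil dimv0.
case/andP=> gs us; rewrite !big_cons dimv_disjoint_sum ?IH //.
apply/eqP; rewrite -subv0; apply/subvP => x; rewrite memv_cap => /andP[xA xs].
by rewrite memv0 -(pid g x xA) (psum _ s).
Qed.

End Decompositions.

Lemma character0 (F : fieldType) (G : zmodType) (chi : G -> F) :
  is_character chi -> chi 0 = 1.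
Proof.
by case=> nz M; apply: (mulfI (nz 0)); rewrite -M addr0 mulr1.
Qed.

Lemma characterV (F : fieldType) (G : zmodType) (chi : G -> F) :
  is_character chi -> is_character (fun g => (chi g)^-1).
Proof.
by case=> nz M; split=> [g|g k]; rewrite ?invr_eq0 // M invfM.
Qed.

Definition bilinear_mul (F : fieldType) (V : vectType F) (mul : V -> V -> V) : Prop :=
  [/\ forall x x' y, mul (x + x') y = mul x y + mul x' y,
      forall x y y', mul x (y + y') = mul x y + mul x y',
      forall a x y, mul (a *: x) y = a *: mul x y
    & forall a x y, mul x (a *: y) = a *: mul x y].

(* (z, x, y) = - (x, z, y) for the associators. *)
Definition alternating (V : zmodType) (mul : V -> V -> V) (z : V) : Prop :=
  forall x y, mul (mul z x) y + mul (mul x z) y = mul z (mul x y) + mul x (mul z y).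

Lemma bilinear_commutator (F : fieldType) (V : vectType F) (mul : V -> V -> V) :
  bilinear_mul mul -> bilinear_mul (commutator mul).
Proof.
case=> Dl Dr Zl Zr; rewrite /commutator.
split=> *; rewrite ?(Dl, Dr, Zl, Zr) ?scalerBr //.
  by rewrite opprD addrACA.
by rewrite opprD addrACA.
Qed.

(** * Algebras graded by an abelian group *)

Section GradedAlgebras.
Variables (F : fieldType) (V : vectType F) (mul : V -> V -> V) (G : zmodType).
Implicit Types (A B : G -> {vspace V}).

Hypothesis bl : bilinear_mul mul.

Lemma bmul0 x : mul x 0 = 0.
Proof. by case: bl => _ _ _ Z; rewrite -(scale0r x) Z !scale0r. Qed.

Lemma b0mul x : mul 0 x = 0.
Proof. by case: bl => _ _ Z _; rewrite -(scale0r x) Z !scale0r. Qed.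

Lemma bmulN x y : mul x (- y) = - mul x y.
Proof. by case: bl => _ _ _ Z; rewrite -scaleN1r Z scaleN1r. Qed.

Lemma bNmul x y : mul (- x) y = - mul x y.
Proof. by case: bl => _ _ Z _; rewrite -scaleN1r Z scaleN1r. Qed.

Lemma alternating_aut (f : 'End(V)) z : bijective f -> {morph f : x y / mul x y} ->
  alternating mul z -> alternating mul (f z).
Proof.
case=> f' fK f'K fM zP x y.
by rewrite -(f'K x) -(f'K y) -!fM -!linearD zP.
Qed.

Section OneGrading.
Variable A : G -> {vspace V}.
Hypothesis gA : is_grading mul A.
Let ddA : direct_decomposition fullv A := gA.1.

Lemma hcomp_mull k l x y : x \in A k -> hcomp A (k + l) (mul x y) = mul x (hcomp A l y).
Proof.
case: bl => _ Dr _ _ xk.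
elim/(homogeneous_ind ddA): y => [y z ey ez||g y yg].
- by rewrite Dr !linearD /= ey ez Dr.
- by rewrite bmul0 !linear0 bmul0.
have xyg := gA.2 _ _ _ _ xk yg.
have [<-|gl] := eqVneq g l; first by rewrite !(hcomp_id ddA).
by rewrite (hcomp_ne ddA yg gl) bmul0 (hcomp_ne ddA xyg) // (inj_eq (addrI k)).
Qed.

Lemma hcomp_mulr k l x y : y \in A l -> hcomp A (k + l) (mul x y) = mul (hcomp A k x) y.
Proof.
case: bl => Dl _ _ _ yl.
elim/(homogeneous_ind ddA): x => [x z ex ez||g x xg].
- by rewrite Dl !linearD /= ex ez Dl.
- by rewrite b0mul !linear0 b0mul.
have xyg := gA.2 _ _ _ _ xg yl.
have [<-|gl] := eqVneq g k; first by rewrite !(hcomp_id ddA).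
by rewrite (hcomp_ne ddA xg gl) b0mul (hcomp_ne ddA xyg) // (inj_eq (addIr l)).
Qed.

(** Comparing degrees in x 1 = x for homogeneous x shows that the component of degree 0 of the unit
    is a right unit; hence it is the unit. *)
Lemma grading_one one : (forall x, mul one x = x) -> (forall x, mul x one = x) ->
  one \in A 0.
Proof.
move=> m1 mx1; have e x : mul x (hcomp A 0 one) = x.
  case: bl => Dl _ _ _.
  elim/(homogeneous_ind ddA): x => [x y ex ey||g x xg]; first by rewrite Dl ex ey.
    by rewrite b0mul.
  by rewrite -(hcomp_mull _ _ xg) addr0 mx1 (hcomp_id ddA).
by rewrite -(e one) m1; apply: hcomp_mem.
Qed.

Lemma character_aut (chi : G -> F) : is_character chi ->
  exists D : 'End(V), [/\ forall g x, x \in A g -> D x = chi g *: x,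
    bijective D & {morph D : x y / mul x y}].
Proof.
have ex (c : G -> F) : exists D : 'End(V), forall g x, x \in A g -> D x = c g *: x.
  have [s us sP] := hcomp_sum ddA.
  exists (\sum_(g <- s) c g *: hcomp A g)%VF => g x xg.
  rewrite sum_lfunE {2}(sP x) scaler_sumr; apply: eq_bigr => k _.
  rewrite scale_lfunE; have [<-//|gk] := eqVneq g k.
  by rewrite (hcomp_ne ddA xg gk) !scaler0.
move=> cc; have [D DP] := ex chi; have [E EP] := ex (fun g => (chi g)^-1).
have [nz M] := cc; exists D; split=> //.
  exists E; elim/(homogeneous_ind ddA) => [x y ex' ey||g x xg]; rewrite ?linear0 //.
  - by rewrite !linearD /= ex' ey.
  - by rewrite (DP _ _ xg) linearZ /= (EP _ _ xg) scalerA mulfV // scale1r.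
  - by rewrite !linearD /= ex' ey.
  - by rewrite (EP _ _ xg) linearZ /= (DP _ _ xg) scalerA mulVf // scale1r.
case: (bl) => Dl Dr Zl Zr.
elim/(homogeneous_ind ddA) => [x y ex' ey z||g x xg];
  first by rewrite Dl !linearD /= Dl ex' ey.
  by move=> y; rewrite b0mul !linear0 b0mul.
elim/(homogeneous_ind ddA) => [y z ey ez||k y yk];
  first by rewrite Dr !linearD /= Dr ey ez.
  by rewrite bmul0 !linear0 bmul0.
rewrite (DP _ _ xg) (DP _ _ yk) (DP _ _ (gA.2 _ _ _ _ xg yk)) M Zl Zr scalerA.
by rewrite mulrC.
Qed.

(** A component of a commutator is a sum of commutators of components. It serves with [N] the
    alternation identity and [W] the skew elements. *)
Lemma hcomp_commutator_mem (N : V -> Prop) (W : {vspace V}) :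
  (forall g x, N x -> N (hcomp A g x)) ->
  (forall x y, N x -> N y -> commutator mul x y \in W) ->
  forall g x y, N x -> N y -> hcomp A g (commutator mul x y) \in W.
Proof.
move=> hN NW g x y Nx Ny; have [Dl Dr _ _] := bilinear_commutator bl.
have [s us sP] := hcomp_sum ddA.
have suml w z : commutator mul (\sum_(k <- s) hcomp A k w) z =
    \sum_(k <- s) commutator mul (hcomp A k w) z.
  elim: (s) => [|k t IH]; last by rewrite !big_cons Dl IH.
  by rewrite !big_nil /commutator b0mul bmul0 subr0.
have sumr w z : commutator mul w (\sum_(k <- s) hcomp A k z) =
    \sum_(k <- s) commutator mul w (hcomp A k z).
  elim: (s) => [|k t IH]; last by rewrite !big_cons Dr IH.
  by rewrite !big_nil /commutator b0mul bmul0 subr0.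
rewrite (sP x) suml linear_sum; apply: memv_suml => k _.
rewrite (sP y) sumr linear_sum; apply: memv_suml => l _.
have := NW _ _ (hN k _ Nx) (hN l _ Ny).
have : commutator mul (hcomp A k x) (hcomp A l y) \in A (k + l).
  by apply: memvB; [|rewrite addrC]; apply: gA.2; apply: hcomp_mem.
move=> h; have [<-|ne] := eqVneq (k + l) g; first by rewrite /= (hcomp_id ddA h).
by rewrite /= (hcomp_ne ddA h ne) mem0v.
Qed.

(** The identity is trilinear. For x and y of degrees k and l, its component of degree g + k + l is
    the same identity for the component of degree g of z. *)
Lemma alternating_hcomp z g : alternating mul z -> alternating mul (hcomp A g z).
Proof.
have [Dl Dr _ _] := bl.
move=> zP; elim/(homogeneous_ind ddA) => [x x' ex ex' y||k x xk].
- by rewrite !(Dl, Dr) addrACA ex ex' addrACA.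
- by move=> y; rewrite !(bmul0, b0mul).
elim/(homogeneous_ind ddA) => [y y' ey ey'||l y yl].
- by rewrite !(Dl, Dr) addrACA ey ey' addrACA.
- by rewrite !(bmul0, b0mul).
have := congr1 (hcomp A (g + k + l)) (zP x y); rewrite !linearD /=.
rewrite !(hcomp_mulr _ _ yl) (hcomp_mulr _ _ xk) -(addrA g) (hcomp_mulr g _ (gA.2 _ _ _
  _ xk yl)).
rewrite (addrA g) (addrC g) (hcomp_mull _ _ xk) -(addrA k) (hcomp_mull _ _ xk).
by rewrite (hcomp_mulr _ _ yl).
Qed.

Lemma push_grading (f : 'End(V)) : bijective f -> {morph f : x y / mul x y} ->
  is_grading mul (fun g => (f @: A g)%VS).
Proof.
move=> bf fM; have [f' fK f'K] := bf.
have flin : linear f'.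
  by move=> a x y; apply: (bij_inj bf); rewrite linearP /= !f'K.
split; last first.
  move=> g k _ _ /memv_imgP[x xg ->] /memv_imgP[y yk ->].
  by rewrite -fM; apply/memv_img/(gA.2).
apply: (@direct_decompositionI _ _ _ _ _ (fun g x => f (hcomp A g (f' x)))).
- by move=> g; apply: subvf.
- move=> x _; have [s us sP] := hcomp_sum ddA; exists s.
  rewrite -(f'K x) (sP (f' x)) linear_sum.
  rewrite big_seq; apply: memv_suml => g gs; apply: (memv_sum_seq gs).
  exact/memv_img/hcomp_mem.
- move=> g x y; have := flin 1 x y; rewrite !scale1r => ->.
  by rewrite !linearD.
- by move=> g _ /memv_imgP[x xg ->]; rewrite fK (hcomp_id ddA).
- by move=> g k _ /memv_imgP[x xg ->] kg; rewrite fK (hcomp_ne ddA xg kg) linear0.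
Qed.

End OneGrading.

Lemma hcomp_eq_grading A B : direct_decomposition fullv A ->
  direct_decomposition fullv B -> (forall g x, hcomp A g x = hcomp B g x) -> A =1 B.
Proof.
move=> dA dB e g; apply/vspaceP => x.
by rewrite (mem_hcomp dA) (mem_hcomp dB) e.
Qed.

(** Both families decompose the whole space, so the two projections in each degree agree on the
    elements homogeneous for [A], which span. *)
Lemma sub_grading_eq A B : direct_decomposition fullv A ->
  direct_decomposition fullv B -> (forall g, (A g <= B g)%VS) -> A =1 B.
Proof.
move=> dA dB AB; apply: hcomp_eq_grading => // g x.
elim/(homogeneous_ind dA): x => [x y ex ey||k x xk]; first by rewrite !linearD /= ex ey.
  by rewrite !linear0.
have xB := subvP (AB k) _ xk.
have [<-|kg] := eqVneq k g; first by rewrite (hcomp_id dA xk) (hcomp_id dB xB).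
by rewrite (hcomp_ne dA xk kg) (hcomp_ne dB xB kg).
Qed.

End GradedAlgebras.

(** * The tensor square and its skew elements *)

Section Tensor.
Variable F : fieldType.
Implicit Types (x y : cayley F) (z t : cayley2 F).
Local Notation C1 := (cone F).

Lemma cmul_bilinear : bilinear_mul (@cmul F).
Proof.
split=> *; [exact: cmulDl|exact: cmulDr|exact: cmulZl|exact: cmulZr].
Qed.

Lemma tmul_bilinear : bilinear_mul (@tmul F).
Proof.
split=> [z z' t|z t t'|a z t|a z t]; rewrite /tmul.
- rewrite -big_split; apply: eq_bigr => p _; rewrite -big_split; apply: eq_bigr => q _.
  by rewrite ffunE mulrDl scalerDl.
- rewrite -big_split; apply: eq_bigr => p _; rewrite -big_split; apply: eq_bigr => q _.
  by rewrite ffunE mulrDr scalerDl.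
- rewrite scaler_sumr; apply: eq_bigr => p _; rewrite scaler_sumr; apply: eq_bigr => q _.
  by rewrite ffunE scalerA mulrA.
- rewrite scaler_sumr; apply: eq_bigr => p _; rewrite scaler_sumr; apply: eq_bigr => q _.
  by rewrite ffunE scalerA mulrCA.
Qed.

Lemma tensDl x x' y : tens (x + x') y = tens x y + tens x' y.
Proof. by apply/ffunP => p; rewrite !ffunE mulrDl. Qed.

Lemma tensDr x y y' : tens x (y + y') = tens x y + tens x y'.
Proof. by apply/ffunP => p; rewrite !ffunE mulrDr. Qed.

Lemma tensZl a x y : tens (a *: x) y = a *: tens x y.
Proof. by apply/ffunP => p; rewrite !ffunE /GRing.scale /= mulrA. Qed.

Lemma tensZr a x y : tens x (a *: y) = a *: tens x y.
Proof. by apply/ffunP => p; rewrite !ffunE /GRing.scale /= mulrCA. Qed.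

Lemma tensBl x x' y : tens (x - x') y = tens x y - tens x' y.
Proof. by rewrite tensDl -scaleN1r tensZl scaleN1r. Qed.

Lemma tensBr x y y' : tens x (y - y') = tens x y - tens x y'.
Proof. by rewrite tensDr -scaleN1r tensZr scaleN1r. Qed.

Lemma tens0 x : tens x 0 = 0.
Proof. by apply/ffunP => p; rewrite !ffunE mulr0. Qed.

Lemma t0ens x : tens 0 x = 0.
Proof. by apply/ffunP => p; rewrite !ffunE mul0r. Qed.

Lemma tens_ind (P : cayley2 F -> Prop) : (forall z t, P z -> P t -> P (z + t)) ->
  (forall x y, P (tens x y)) -> forall z, P z.
Proof.
move=> PD Pt z.
have -> : z = \sum_p tens (z p *: cbase F p.1) (cbase F p.2).
  apply/ffunP => -[i j]; rewrite sum_ffunE (bigD1 (i, j)) //= big1 => [|[k l] /=].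
    by rewrite !ffunE !eqxx /GRing.scale /= !mulr1 addr0.
  rewrite xpair_eqE negb_and !ffunE /GRing.scale /= => /orP[]/negPf->.
    by rewrite mulr0 mul0r.
  by rewrite mulr0.
by apply: (big_ind P) => [|//|p _]; [have := Pt 0 0; rewrite tens0|exact: Pt].
Qed.

Lemma tmul1 z : tmul (tens C1 C1) z = z.
Proof.
have [_ Dr _ _] := tmul_bilinear.
elim/tens_ind: z => [z t ez et|x y]; first by rewrite Dr ez et.
by rewrite tmul_tens !cmul1.
Qed.

Lemma tmulx1 z : tmul z (tens C1 C1) = z.
Proof.
have [Dl _ _ _] := tmul_bilinear.
elim/tens_ind: z => [z t ez et|x y]; first by rewrite Dl ez et.
by rewrite tmul_tens !cmulx1.
Qed.

(** Not injective on all pairs, since 1 and -1 give 0; this is why [emb_inj] asks for trace 0. *)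
Definition emb x y : cayley2 F := tens x C1 + tens C1 y.

Lemma embD x x' y y' : emb (x + x') (y + y') = emb x y + emb x' y'.
Proof. by rewrite /emb tensDl tensDr addrACA. Qed.

Lemma embZ a x y : emb (a *: x) (a *: y) = a *: emb x y.
Proof. by rewrite /emb tensZl tensZr scalerDr. Qed.

Lemma emb_commutator x y x' y' : commutator (@tmul F) (emb x y) (emb x' y') =
  emb (commutator (@cmul F) x x') (commutator (@cmul F) y y').
Proof.
have [Dl Dr _ _] := bilinear_commutator tmul_bilinear.
rewrite /emb !(Dl, Dr) /commutator !tmul_tens !cmul1 !cmulx1 !subrr addr0 add0r.
by rewrite tensBl tensBr.
Qed.

Lemma alternating_tens w : (forall x x' y y',
    tmul (tmul w (tens x x')) (tens y y') + tmul (tmul (tens x x') w) (tens y y') =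
    tmul w (tmul (tens x x') (tens y y')) + tmul (tens x x') (tmul w (tens y y'))) ->
  alternating (@tmul F) w.
Proof.
have [Dl Dr _ _] := tmul_bilinear => H.
elim/tens_ind => [z t ez et u|x1 x2]; first by rewrite !(Dl, Dr) addrACA ez et addrACA.
elim/tens_ind => [z t ez et|y1 y2]; last exact: H.
by rewrite !Dr addrACA ez et addrACA.
Qed.

(** For x (x) 1 the identity is the linearized left alternative law in the first factor, tensored
    with a fixed product in the second; symmetrically for 1 (x) y. *)
Lemma alternating_emb x y : alternating (@tmul F) (emb x y).
Proof.
have [Dl Dr _ _] := tmul_bilinear.
apply: alternating_tens => a a' b b'.
rewrite /emb !(Dl (tens x _)) !(Dr _ (tens x _)) !Dl !Dr !tmul_tens !cmul1 !cmulx1.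
rewrite addrACA -!tensDl -!tensDr -!cmulDl -!left_alt.
by rewrite [RHS]addrACA -!tensDl -!tensDr.
Qed.

(* Contraction of the second, resp. first, factor with the functional whose
   values on the canonical basis are phi. *)
Definition contr (phi : cayley_idx -> F) z : cayley F :=
  [ffun p => \sum_q phi q * z (p, q)].
Definition contl (phi : cayley_idx -> F) z : cayley F :=
  [ffun q => \sum_p phi p * z (p, q)].

Lemma contrD phi z t : contr phi (z + t) = contr phi z + contr phi t.
Proof.
apply/ffunP => p; rewrite !ffunE -big_split; apply: eq_bigr => q _.
by rewrite ffunE mulrDr.
Qed.

Lemma contlD phi z t : contl phi (z + t) = contl phi z + contl phi t.
Proof.
apply/ffunP => p; rewrite !ffunE -big_split; apply: eq_bigr => q _.
by rewrite ffunE mulrDr.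
Qed.

Lemma contrB phi z t : contr phi (z - t) = contr phi z - contr phi t.
Proof.
apply/ffunP => p; rewrite !ffunE -sumrB; apply: eq_bigr => q _.
by rewrite !ffunE mulrBr.
Qed.

Lemma contrZ phi a z : contr phi (a *: z) = a *: contr phi z.
Proof.
apply/ffunP => p; rewrite !ffunE scaler_sumr; apply: eq_bigr => q _.
by rewrite ffunE /GRing.scale /= mulrCA.
Qed.

Lemma contlZ phi a z : contl phi (a *: z) = a *: contl phi z.
Proof.
apply/ffunP => p; rewrite !ffunE scaler_sumr; apply: eq_bigr => q _.
by rewrite ffunE /GRing.scale /= mulrCA.
Qed.

Lemma contr_tens phi x y : contr phi (tens x y) = (\sum_q phi q * y q) *: x.
Proof.
apply/ffunP => p; rewrite !ffunE /GRing.scale /= mulr_suml.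
by apply: eq_bigr => q _; rewrite ffunE /= mulrCA mulrC.
Qed.

Lemma contl_tens phi x y : contl phi (tens x y) = (\sum_q phi q * x q) *: y.
Proof.
apply/ffunP => p; rewrite !ffunE /GRing.scale /= mulr_suml.
by apply: eq_bigr => q _; rewrite ffunE /= mulrA.
Qed.

(* If z is the sum of the z_q (x) c_q, alternation at x (x) c and y (x) 1 says
   that the sum of the (z_q, x, y) (x) [c_q, c] vanishes. *)
Lemma alternating_contr z (c : cayley F) r : alternating (@tmul F) z ->
  exists a, contr (fun q => commutator (@cmul F) (cbase F q) c r) z = a *: C1.
Proof.
move=> zP; apply: nucleusP => x y.
set phi := (fun q : cayley_idx => commutator (@cmul F) (cbase F q) c r).
have phiE (b : cayley F) : \sum_q phi q * b q = commutator (@cmul F) b c r.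
  have [Dl _ Zl _] := bilinear_commutator cmul_bilinear.
  rewrite {2}(cbase_sum b).
  elim/big_rec2: _ => [|i u v _ ->]; last first.
    by rewrite /phi Dl Zl /commutator !ffunE /GRing.scale /=; ring.
  by rewrite /commutator (b0mul cmul_bilinear) (bmul0 cmul_bilinear) subr0 ffunE.
have [Dl Dr _ _] := tmul_bilinear.
(* [D z] measures the failure of alternation at x (x) c and y (x) 1. Its contraction with the
   coordinate [r] is the associator of the contraction of [z] with x and y, as is checked on pure
   tensors. *)
pose D z := tmul (tmul z (tens x c)) (tens y C1) + tmul (tmul (tens x c) z) (tens y C1) -
  (tmul z (tmul (tens x c) (tens y C1)) + tmul (tens x c) (tmul z (tens y C1))).
pose r' : cayley_idx -> F := fun q => (q == r)%:R.
have e : contr r' (D z) = 0.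
  rewrite /D zP subrr; apply/ffunP => p; rewrite !ffunE big1 // => q _.
  by rewrite ffunE mulr0.
apply/eqP; rewrite -subr_eq0 -e; apply/eqP.
elim/tens_ind: z {zP e} => [z t ez et|a b].
  rewrite contrD !cmulDl opprD addrACA ez et -contrD; congr contr.
  by rewrite /D !Dr !Dl !Dr [LHS]addrACA -opprD; congr (_ - _); apply: addrACA.
have r'E (w : cayley F) : \sum_q r' q * w q = w r.
  rewrite (bigD1 r) //= big1 /r' ?eqxx ?mul1r ?addr0 // => i /negPf->.
  by rewrite mul0r.
rewrite contr_tens phiE /D !tmul_tens !cmulx1 contrB !contrD !contr_tens !r'E.
rewrite /commutator ffunE !cmulZl.
set k := cmul b c r; set l := cmul c b r.
have alt := left_alt a x y; rewrite cmulDl in alt.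
rewrite -scalerBr [_ - _ in RHS](_ : _ = k *: (cmul (cmul a x) y - cmul a (cmul x y))
   + l *: (cmul (cmul x a) y - cmul x (cmul a y))).
  have -> : cmul (cmul x a) y - cmul x (cmul a y) =
      - (cmul (cmul a x) y - cmul a (cmul x y)).
    apply/eqP; rewrite opprB subr_eq addrAC eq_sym subr_eq.
    by rewrite alt addrC.
  by rewrite scalerN -scalerBl !ffunE.
by rewrite !scalerBr opprD addrACA.
Qed.

(** View z as a matrix with columns indexed by the basis of the second factor. Contraction with
    commutators by e_1 - e_2 shows that the columns of the u_i and v_i are multiples of 1;
    commutators with [cu 0] show it for the difference of the columns of e_1 and e_2. What remains
    is the column of e_2 tensored with 1. *)
Lemma alternatingP z : 2%N \notin [pchar F] -> alternating (@tmul F) z ->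
  exists x y, z = emb x y.
Proof.
move=> char2 zP.
have n2 := neq2 char2.
have cb i : cbase F (inl i) = ce F i by [].
have cub i : cbase F (inr (false, i)) = cu F i by [].
have cvb i : cbase F (inr (true, i)) = cv F i by [].
have key i : exists a, forall p, z (p, inr i) = a * C1 p.
  have [a] := alternating_contr (ce F false - ce F true) (inr i) zP.
  (* The commutator with e_1 - e_2 multiplies [cu i] by -2 and [cv i] by 2. *)
  move=> /ffunP e; exists (if i.1 then a / 2%:R else - a / 2%:R) => p.
  have := e p; rewrite [RHS]ffunE /GRing.scale /=; move: (C1 p) => c1.
  rewrite [LHS]ffunE big_cayley_idx !(cb, cub, cvb) /commutator !octs /=.
  case: i {e} => -[] /=; elim/Z3_cases; rewrite !ffunE => e;
    by rewrite 2?mulNr mulrAC -e /=; field.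
have [a ea] : exists a, forall p, z (p, inl false) - z (p, inl true) = a * C1 p.
  have [a] := alternating_contr (cu F 0) (inr (false, 0)) zP.
  move=> /ffunP e; exists a => p.
  have := e p; rewrite [RHS]ffunE /GRing.scale /=; move: (C1 p) => c1.
  rewrite [LHS]ffunE big_cayley_idx  !(cb, cub, cvb) /commutator !octs /=.
  rewrite !ffunE => <- /=; ring.
have /boolp.choice[b bP] := key.
exists [ffun p => z (p, inl true)].
exists [ffun q => match q with inl c => if c then 0 else a | inr i => b i end].
apply/ffunP => -[p [[]|i]]; rewrite !ffunE /=.
- by rewrite mulr0 add0r mulr1 addr0.
- by rewrite addr0 mulr1 mulrC; move: (ea p); rewrite !ffunE => <-; rewrite addrC subrK.
- by rewrite addr0 mulr0 add0r bP mulrC !ffunE.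
Qed.

End Tensor.

(** * Skew elements under projections and automorphisms *)

Section Skew.
Variable F : fieldType.
Hypothesis char2 : 2%N \notin [pchar F].
Implicit Types (x y : cayley F) (z t : cayley2 F).
Local Notation C1 := (cone F).

Lemma tr_commutator x y : tr (commutator (@cmul F) x y) = 0.
Proof. by rewrite /commutator trD trN tr_mulC subrr. Qed.

Lemma skew_part x : exists a x', tr x' = 0 /\ x = a *: C1 + x'.
Proof.
exists (tr x / 2%:R), (x - (tr x / 2%:R) *: C1); split; last by rewrite addrC subrK.
by rewrite trD trN trZ tr1 (divfK (neq2 char2)) subrr.
Qed.

Lemma tskewE z : z \in tskew F <-> exists x y, [/\ tr x = 0, tr y = 0 & z = emb x y].
Proof.
split=> [/tskewP[x [y [/cskewP x0 /cskewP y0 ->]]]|[x [y [x0 y0 ->]]]].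
  by exists x, y.
by apply/tskewP; exists x, y; split=> //; apply/cskewP.
Qed.

Lemma emb_skew x y : tr x = 0 -> tr y = 0 -> emb x y \in tskew F.
Proof. by move=> x0 y0; apply/tskewE; exists x, y. Qed.

(** Half the trace, normalized to take the value 1 at the unit and 0 on C_0. Contracting one factor
    of [emb x y] with it isolates x or y. *)
Definition half_tr (p : cayley_idx) : F := if p is inl _ then 2%:R^-1 else 0.
Definition pr1 z := contr half_tr z.
Definition pr2 z := contl half_tr z.

Lemma half_trE x : \sum_q half_tr q * x q = tr x / 2%:R.
Proof. by rewrite big_cayley_idx /= !mul0r !addr0 -mulrDr mulrC. Qed.

Lemma pr1_emb x y : tr y = 0 -> pr1 (emb x y) = x.
Proof.
move=> y0; rewrite /pr1 contrD !contr_tens !half_trE y0 tr1 mul0r scale0r addr0.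
by rewrite (mulfV (neq2 char2)) scale1r.
Qed.

Lemma pr2_emb x y : tr x = 0 -> pr2 (emb x y) = y.
Proof.
move=> x0; rewrite /pr2 contlD !contl_tens !half_trE x0 tr1 mul0r scale0r add0r.
by rewrite (mulfV (neq2 char2)) scale1r.
Qed.

Lemma emb_inj x y x' y' : tr x = 0 -> tr y = 0 -> tr x' = 0 -> tr y' = 0 ->
  emb x y = emb x' y' -> x = x' /\ y = y'.
Proof.
move=> x0 y0 x0' y0' e; split.
  by rewrite -(pr1_emb x y0) e pr1_emb.
by rewrite -(pr2_emb y x0) e pr2_emb.
Qed.

Lemma skew_commutators x : tr x = 0 -> exists a b c d,
  x = commutator (@cmul F) a b + commutator (@cmul F) c d.
Proof.
have n2 := neq2 char2.
elim/oct_ind: x => a b u0 u1 u2 v0 v1 v2; rewrite tr_oct => /eqP;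
  rewrite addrC addr_eq0 => /eqP->.
(* The commutator with (e_1 - e_2)/2 fixes the u_i and negates the v_i, which yields the
   off-diagonal part. As [u_1, v_1] = -(e_1 - e_2), the second commutator yields the diagonal
   part. *)
exists (2%:R^-1 *: (ce F false - ce F true)), (oct 0 0 u0 u1 u2 (- v0) (- v1) (- v2)).
exists (- a *: cu F 0), (cv F 0).
by rewrite /commutator !octs /=; congr (oct _ _ _ _ _ _ _ _); field.
Qed.

Lemma tskew_commutator z t :
  (exists x y, z = emb x y) -> (exists x y, t = emb x y) ->
  commutator (@tmul F) z t \in tskew F.
Proof.
case=> x [y ->] [x' [y' ->]]; rewrite emb_commutator.
by apply: emb_skew; apply: tr_commutator.
Qed.

(** Since C_0 is spanned by commutators, so is [tskew], by commutators of alternating elements.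
    Alternation is inherited by homogeneous components and by images under automorphisms, so this
    induction carries both over to [tskew]. *)
Lemma tskew_ind (P : cayley2 F -> Prop) : (forall z t, P z -> P t -> P (z + t)) ->
  (forall z t, alternating (@tmul F) z -> alternating (@tmul F) t ->
     P (commutator (@tmul F) z t)) -> forall z, z \in tskew F -> P z.
Proof.
move=> PD Pc z /tskewE[x [y [/skew_commutators[a [b [c [d ->]]]]]]].
case/skew_commutators=> [a' [b' [c' [d' ->]]]] ->.
by rewrite embD -!emb_commutator; apply: PD; apply: Pc; apply: alternating_emb.
Qed.

Lemma tskew_hcomp (G : zmodType) (A : G -> {vspace cayley2 F}) g z :
  is_grading (@tmul F) A -> z \in tskew F -> hcomp A g z \in tskew F.
Proof.
move=> gA; elim/tskew_ind => [u v hu hv|u v]; first by rewrite linearD memvD.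
apply: (hcomp_commutator_mem (@tmul_bilinear F) gA (N := alternating (@tmul F))).
  by move=> k w; apply: (alternating_hcomp (@tmul_bilinear F)).
by move=> {}u {}v /(alternatingP char2) hu /(alternatingP char2) hv;
  apply: tskew_commutator.
Qed.

Lemma tskew_aut (f : 'End(cayley2 F)) z : bijective f -> {morph f : u v / tmul u v} ->
  z \in tskew F -> f z \in tskew F.
Proof.
move=> bf fM; elim/tskew_ind => [u v hu hv|u v hu hv]; first by rewrite linearD memvD.
rewrite /commutator linearB /= !fM -/(commutator _ _ _).
by apply: tskew_commutator; apply: (alternatingP char2);
  apply: alternating_aut.
Qed.

(* C (x) C is spanned by 1, tskew and the products of two elements of tskew. *)
Lemma tskew_grading_unique (G : zmodType) (A B : G -> {vspace cayley2 F}) :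
  is_grading (@tmul F) A -> is_grading (@tmul F) B ->
  (forall g z, z \in A g -> z \in tskew F -> z \in B g) -> A =1 B.
Proof.
move=> gA gB AB; have dA := gA.1; have dB := gB.1.
pose E z := forall g, hcomp A g z = hcomp B g z.
have ED z t : E z -> E t -> E (z + t) by move=> ez et g; rewrite !linearD /= ez et.
have EZ a z : E z -> E (a *: z) by move=> ez g; rewrite !linearZ /= ez.
have Eh g z : z \in A g -> z \in B g -> E z.
  move=> zA zB k; have [<-|gk] := eqVneq g k;
    first by rewrite (hcomp_id dA zA) (hcomp_id dB zB).
  by rewrite (hcomp_ne dA zA gk) (hcomp_ne dB zB gk).
have E0 : E 0 by move=> g; rewrite !linear0.
have E1 : E (tens C1 C1).
  by apply: (Eh 0); [apply: grading_one gA _ _ _|apply: grading_one gB _ _ _];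
    [exact: tmul_bilinear|exact: tmul1|exact: tmulx1|exact: tmul_bilinear|exact:
      tmul1|exact: tmulx1].
have ES z : z \in tskew F -> E z.
  have [s _ sP] := hcomp_sum dA.
  move=> zS; rewrite (sP z); apply: big_ind => // g _; apply: (Eh g).
    exact: hcomp_mem.
  by apply: AB; [apply: hcomp_mem|apply: tskew_hcomp].
have [Dl Dr Zl Zr] := @tmul_bilinear F.
have [s _ sP] := hcomp_sum dA.
(* Split both factors for [A]: the pieces are skew, hence homogeneous of the same degrees for [B],
   and so are their products. *)
have EM z t : z \in tskew F -> t \in tskew F -> E (tmul z t).
  move=> zS tS; rewrite (sP z).
  elim/big_rec: _ => [|g w _ Ew].
    by rewrite (b0mul (@tmul_bilinear F)).
  rewrite Dl; apply: (ED _ _) => //; rewrite (sP t).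
  elim/big_rec: _ => [|k w' _ Ew'].
    by rewrite (bmul0 (@tmul_bilinear F)).
  rewrite Dr; apply: (ED _ _) => //; apply: (Eh (g + k)).
    by apply: gA.2; apply: hcomp_mem.
  by apply: gB.2; apply: AB; (apply: hcomp_mem || apply: tskew_hcomp).
apply: hcomp_eq_grading => // g z; move: z g.
apply: tens_ind => // x y.
have [a [x' [x0 ->]]] := skew_part x; have [b [y' [y0 ->]]] := skew_part y.
rewrite [tens _ _](_ : _ = (a * b) *: tens C1 C1 + a *: emb 0 y' + b *: emb x' 0
   + tmul (emb x' 0) (emb 0 y')).
  apply: (ED _ _); last by apply: EM; apply: emb_skew => //; apply: tr0.
  apply: (ED _ _); last by apply/EZ/ES/emb_skew => //; apply: tr0.
  apply: (ED _ _); first exact: EZ.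
  by apply/EZ/ES/emb_skew => //; apply: tr0.
rewrite /emb !tens0 !t0ens !addr0 !add0r tmul_tens cmul1 cmulx1.
by rewrite tensDl !(tensDr _ (b *: C1)) !tensZl !tensZr scalerA -!addrA.
Qed.

End Skew.

(** * The centroid of the skew elements *)

Section Centroid.
Variable F : fieldType.
Hypothesis char2 : 2%N \notin [pchar F].
Implicit Types (x y : cayley F) (z t : cayley2 F).
Local Notation C1 := (cone F).
Local Notation tcomm := (commutator (@tmul F)).
Local Notation ccomm := (commutator (@cmul F)).

(** Indexing the two factors by a boolean lets one argument treat both. *)
Definition embb (b : bool) x := if b then emb 0 x else emb x 0.

Lemma embbD b x y : embb b (x + y) = embb b x + embb b y.
Proof. by case: b; rewrite /embb -embD addr0. Qed.

Lemma embbZ b a x : embb b (a *: x) = a *: embb b x.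
Proof. by case: b; rewrite /embb -embZ scaler0. Qed.

Lemma embb_skew b x : tr x = 0 -> embb b x \in tskew F.
Proof. by move=> x0; case: b; apply: emb_skew; rewrite ?tr0. Qed.

Lemma embb0 b : embb b 0 = 0 :> cayley2 F.
Proof. by rewrite -[X in embb b X](scale0r 0) embbZ scale0r. Qed.

Lemma embb_eq0 b x : tr x = 0 -> embb b x = 0 -> x = 0.
Proof.
move=> x0; rewrite -(embb0 b).
by case: b => /= /(emb_inj char2); rewrite !tr0 => -[].
Qed.

Lemma tskew_embb b z : z \in tskew F -> exists x y,
  [/\ tr x = 0, tr y = 0 & z = embb b x + embb (~~ b) y].
Proof.
case/tskewE => x [y [x0 y0 ->]].
by case: b; [exists y, x|exists x, y]; rewrite -embD addr0 add0r.
Qed.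

Lemma embb_comm b x y : tcomm (embb b x) (embb b y) = embb b (ccomm x y).
Proof.
have c00 : ccomm 0 0 = 0 by rewrite /commutator subrr.
by case: b; rewrite emb_commutator c00.
Qed.

Lemma embb_commN b x y : tcomm (embb b x) (embb (~~ b) y) = 0.
Proof.
have bl := cmul_bilinear F.
case: b; rewrite emb_commutator /commutator !(bmul0 bl) !(b0mul bl) subrr.
  exact: (embb0 true).
exact: (embb0 true).
Qed.

(* T (C_0 (x) 1) centralizes 1 (x) C_0, and e_1 - e_2 spans its own centralizer
   in C_0, which it generates together with its image under ad. *)
Lemma centroid_embb (T : 'End(cayley2 F)) b :
  (forall z, z \in tskew F -> T z \in tskew F) ->
  (forall z t, z \in tskew F -> t \in tskew F -> T (tcomm z t) = tcomm (T z) t) ->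
  exists a, forall x, tr x = 0 -> T (embb b x) = a *: embb b x.
Proof.
move=> TS TM; have [Dl Dr Zl Zr] := bilinear_commutator (@tmul_bilinear F).
have step x : tr x = 0 -> exists2 a, tr a = 0 & T (embb b x) = embb b a.
  move=> x0; have [a [c [a0 c0 e]]] := tskew_embb b (TS _ (embb_skew b x0)).
  exists a => //; rewrite e; suff -> : c = 0 by rewrite embb0 addr0.
  apply: (skew_centerP char2 c0) => y y0.
  have := TM _ _ (embb_skew b x0) (embb_skew (~~ b) y0).
  rewrite embb_commN linear0 e Dl embb_commN add0r embb_comm => /esym.
  by move/(embb_eq0 (tr_commutator _ _)) => /eqP; rewrite subr_eq0 => /eqP.
pose d := ce F false - ce F true.
have d0 : tr d = 0 by apply: tr_ce_diff.
have [d' d'0 ed] := step d d0.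
have [a ea] : exists a, d' = a *: d.
  have := TM _ _ (embb_skew b d0) (embb_skew b d0).
  rewrite embb_comm {1}/commutator subrr embb0 linear0 ed embb_comm => /esym.
  move/(embb_eq0 (tr_commutator _ _)) => /eqP; rewrite subr_eq0 => /eqP.
  move: d'0; rewrite /d; elim/oct_ind: d' {ed} => a c u0 u1 u2 v0 v1 v2.
  rewrite !octs /= => ac /oct_inj[_ [[p0 [p1 p2]] [q0 [q1 q2]]]].
  have nz (u w w' : F) : w = w' -> u - - u = w' - w -> u = 0.
    by move=> -> /eqP; rewrite subrr subr_eq0 => /eqP /esym /(opp_eq0 char2).
  have -> : u0 = 0 by apply: (nz _ _ _ p0); ring.
  have -> : u1 = 0 by apply: (nz _ _ _ p1); ring.
  have -> : u2 = 0 by apply: (nz _ _ _ p2); ring.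
  have -> : v0 = 0 by apply: (nz _ _ _ (esym q0)); ring.
  have -> : v1 = 0 by apply: (nz _ _ _ (esym q1)); ring.
  have -> : v2 = 0 by apply: (nz _ _ _ (esym q2)); ring.
  exists a; rewrite !octs; move/eqP: ac; rewrite addrC addr_eq0 => /eqP ->.
  by congr (oct _ _ _ _ _ _ _ _); ring.
exists a => x x0.
have [y [l [y0 ->]]] : exists y l, tr y = 0 /\ x = 2%:R^-1 *: ccomm d y + l *: d.
  move: x0; elim/oct_ind: x => c e u0 u1 u2 v0 v1 v2.
  rewrite tr_oct => /eqP; rewrite addrC addr_eq0 => /eqP->.
  exists (oct 0 0 u0 u1 u2 (- v0) (- v1) (- v2)), c.
  rewrite tr_oct addr0; split=> //; have n2 := neq2 char2.
  by rewrite /d /commutator !octs /=; congr (oct _ _ _ _ _ _ _ _); field.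
rewrite embbD !embbZ linearD !linearZ /= -embb_comm TM ?embb_skew //.
by rewrite ed ea embbZ Zl [RHS]scalerDr !scalerA !(mulrC a).
Qed.

(* On tskew, theta is 1 on C_0 (x) 1 and -1 on 1 (x) C_0; its values elsewhere
   are irrelevant. *)
Definition theta z : cayley2 F := emb (pr1 z) (- pr2 z).

Lemma theta_linear : linear theta.
Proof.
move=> a z t; rewrite /theta /pr1 /pr2 contrD contlD contrZ contlZ opprD -scalerN.
by rewrite embD embZ.
Qed.

Lemma theta_emb x y : tr x = 0 -> tr y = 0 -> theta (emb x y) = emb x (- y).
Proof. by move=> x0 y0; rewrite /theta pr1_emb ?pr2_emb. Qed.

Lemma theta_tskew z : z \in tskew F -> theta z \in tskew F.
Proof.
by case/tskewE => x [y [x0 y0 ->]]; rewrite theta_emb // emb_skew // trN y0 oppr0.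
Qed.

Lemma thetaK z : z \in tskew F -> theta (theta z) = z.
Proof.
case/tskewE => x [y [x0 y0 ->]].
by rewrite !theta_emb ?opprK // trN y0 oppr0.
Qed.

Lemma theta_commutator z t : z \in tskew F -> t \in tskew F ->
  theta (tcomm z t) = tcomm (theta z) t.
Proof.
case/tskewE => x [y [x0 y0 ->]] /tskewE[x' [y' [x0' y0' ->]]].
rewrite emb_commutator !theta_emb ?tr_commutator // emb_commutator; congr emb.
by rewrite /commutator (bmulN (@cmul_bilinear F)) (bNmul (@cmul_bilinear F)) opprB
  opprK addrC.
Qed.

Lemma centroidP (T : 'End(cayley2 F)) :
  (forall z, z \in tskew F -> T z \in tskew F) ->
  (forall z t, z \in tskew F -> t \in tskew F -> T (tcomm z t) = tcomm (T z) t) ->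
  exists a b, forall z, z \in tskew F -> T z = a *: z + b *: theta z.
Proof.
move=> TS TM; have n2 := neq2 char2.
have [a aP] := centroid_embb false TS TM; have [b bP] := centroid_embb true TS TM.
exists ((a + b) / 2%:R), ((a - b) / 2%:R) => z /tskewE[x [y [x0 y0 ->]]].
rewrite theta_emb // -!embZ -embD scalerN -!scalerDl -scalerBl.
rewrite [X in emb (X *: _)](_ : _ = a); last by field.
rewrite [X in emb _ (X *: _)](_ : _ = b); last by field.
have := aP x x0; have := bP y y0; rewrite -!embbZ /= => ey ex.
have -> : emb x y = emb x 0 + emb 0 y by rewrite -embD addr0 add0r.
by rewrite linearD /= ex ey -embD addr0 add0r.
Qed.

End Centroid.

(** * Homogeneity of the centroid element [theta] *)

Section ThetaDegree.
Variable F : fieldType.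
Hypothesis char2 : 2%N \notin [pchar F].
Variables (G : zmodType) (A : G -> {vspace cayley2 F}).
Hypothesis gA : is_grading (@tmul F) A.
Let dA : direct_decomposition fullv A := gA.1.
Implicit Types (x y : cayley F) (z t : cayley2 F).
Local Notation C1 := (cone F).
Local Notation tcomm := (commutator (@tmul F)).

Lemma tskew_hom_ind (P : cayley2 F -> Prop) : (forall z t, P z -> P t -> P (z + t)) ->
  P 0 -> (forall g z, z \in A g -> z \in tskew F -> P z) ->
  forall z, z \in tskew F -> P z.
Proof.
move=> PD P0 PA z zS; have [s _ sP] := hcomp_sum dA.
rewrite (sP z); apply: big_ind => // g _; apply: (PA g); first exact: hcomp_mem.
exact: tskew_hcomp.
Qed.

Lemma tskew_commutator_mem z t : z \in tskew F -> t \in tskew F ->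
  tcomm z t \in tskew F.
Proof.
case/tskewE => x [y [_ _ ->]] /tskewE[x' [y' [_ _ ->]]].
by apply: tskew_commutator; [exists x, y|exists x', y'].
Qed.

Lemma commutator_hom g k z t : z \in A g -> t \in A k -> tcomm z t \in A (g + k).
Proof.
by move=> zg tk; apply: memvB; [|rewrite addrC]; apply: gA.2.
Qed.

Lemma thetaD z t : theta (z + t) = theta z + theta t.
Proof. by have := theta_linear 1 z t; rewrite !scale1r. Qed.

Lemma theta0 : theta (0 : cayley2 F) = 0.
Proof. by have := thetaD 0 0; rewrite addr0 => /eqP;
  rewrite addrC -subr_eq subrr => /eqP. Qed.

Lemma thetaZ a z : theta (a *: z) = a *: theta z.
Proof. by have := theta_linear a z 0; rewrite !addr0 theta0 addr0. Qed.

(* The component of degree g of theta lies in the centroid. *)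
Lemma theta_component g : exists a b, forall k z, z \in A k -> z \in tskew F ->
  hcomp A (g + k) (theta z) = a *: z + b *: theta z.
Proof.
have [s us sP] := hcomp_sum dA.
have [T TE] : exists T : 'End(cayley2 F),
    forall k z, z \in A k -> T z = hcomp A (g + k) (theta z).
  (* The part of [theta] that raises degrees by g, assembled over a finite sequence of degrees. *)
  exists (\sum_(k <- s) (hcomp A (g + k) \o linfun (@theta F) \o hcomp A k))%VF => k z zk.
  rewrite sum_lfunE.
  have comp l : (hcomp A (g + l) \o linfun (@theta F) \o hcomp A l)%VF z =
     hcomp A (g + l) (theta (hcomp A l z)).
    by rewrite !comp_lfunE /= (linfunE (@theta_linear F)).
  rewrite (eq_bigr _ (fun l _ => comp l)).
  have ne l : k != l -> hcomp A (g + l) (theta (hcomp A l z)) = 0.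
    by move=> kl; rewrite (hcomp_ne dA zk kl) theta0 linear0.
  have [ks|kns] := boolP (k \in s).
    rewrite (perm_big _ (perm_to_rem ks)) big_cons /= (hcomp_id dA zk).
    rewrite big_seq big1 ?addr0 // => l; rewrite mem_rem_uniq // inE => /andP[lk _].
    by rewrite ne // eq_sym.
  have z0 : z = 0.
    rewrite (sP z) big_seq big1 // => l ls; apply: (hcomp_ne dA zk).
    by apply: contraNneq kns => ->.
  by rewrite z0 theta0 linear0 big1 // => l _; rewrite linear0 theta0 linear0.
have TS z : z \in tskew F -> T z \in tskew F.
  elim/tskew_hom_ind => [z1 z2 h1 h2||k z1 zk zS].
  - by rewrite linearD memvD.
  - by rewrite linear0 mem0v.
  by rewrite (TE k) // tskew_hcomp // theta_tskew.
have [Dl Dr _ _] := bilinear_commutator (@tmul_bilinear F).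
have TM z t : z \in tskew F -> t \in tskew F -> T (tcomm z t) = tcomm (T z) t.
  move=> + tS; elim/tskew_hom_ind => [z1 z2 h1 h2||k z' zk zS].
  - by rewrite Dl [in LHS]linearD [T (z1 + z2)]linearD /= Dl h1 h2.
  - by rewrite (b0mul (bilinear_commutator (@tmul_bilinear F))) !linear0 (b0mul
      (bilinear_commutator (@tmul_bilinear F))).
  elim/tskew_hom_ind: t / tS => [t1 t2 h1 h2||l t' tl tS'].
  - by rewrite !Dr [in LHS]linearD /= h1 h2.
  - by rewrite !(bmul0 (bilinear_commutator (@tmul_bilinear F))) !linear0.
  rewrite (TE _ _ (commutator_hom zk tl)) (TE _ _ zk) theta_commutator //.
  rewrite /commutator linearB /= -(hcomp_mulr (@tmul_bilinear F) gA _ _ tl).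
  by rewrite -(hcomp_mull (@tmul_bilinear F) gA _ _ tl) (addrC l) addrA.
have [a [b abP]] := centroidP char2 TS TM.
by exists a, b => k z zk zS; rewrite -TE // abP.
Qed.

Lemma tskew_neq0 : exists g z, [/\ z \in A g, z \in tskew F & z != 0].
Proof.
pose w := emb (ce F false - ce F true) 0.
have w0 := tr_ce_diff F.
have wS : w \in tskew F by apply: emb_skew => //; apply: tr0.
have wn0 : w != 0.
  by apply/eqP => /(embb_eq0 char2 (b := false) w0) /eqP;
    rewrite (negPf (ce_diff_neq0 F)).
have /boolp.existsNP[g /eqP gw] : ~ (forall g, hcomp A g w = 0).
  by move=> H; move/eqP: wn0; apply; apply: (hcomp_eq0 dA).
by exists g, (hcomp A g w); split=> //; [apply: hcomp_mem|apply: tskew_hcomp].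
Qed.

Hypothesis simple : graded_simple tcomm (tskew F) (fun g => tskew F :&: A g)%VS.

Lemma two_eq0 (x : cayley F) : 2%N \notin [pchar F] -> - x = x -> x = 0.
Proof.
move=> /neq2 n2 e; apply: (scalerI n2).
by rewrite scaler0 scaler_nat mulr2n -{1}e addNr.
Qed.

(** Otherwise the eigenspace of [theta] for 1, which is C_0 (x) 1, would be a graded ideal, neither
    zero nor everything. *)
Lemma theta_not_degree0 :
  ~ (forall g z, z \in A g -> z \in tskew F -> theta z \in A g).
Proof.
move=> th0.
have hcth g z : z \in tskew F -> hcomp A g (theta z) = theta (hcomp A g z).
  elim/tskew_hom_ind => [z1 z2 h1 h2||k z1 zk zS].
  - by rewrite thetaD [in LHS]linearD [hcomp A g (z1 + z2)]linearD /= thetaD h1 h2.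
  - by rewrite !(theta0, linear0).
  have tk := th0 _ _ zk zS.
  have [<-|kg] := eqVneq k g; first by rewrite (hcomp_id dA zk) (hcomp_id dA tk).
  by rewrite (hcomp_ne dA zk kg) (hcomp_ne dA tk kg) theta0.
pose I := (linfun (fun x : cayley F => emb x 0) @: cskew F)%VS.
have lin : linear (fun x : cayley F => emb x 0).
  by move=> a x y; rewrite -embZ -embD scaler0 addr0.
have IP z : z \in I <-> z \in tskew F /\ theta z = z.
  split=> [/memv_imgP[x /cskewP x0 ->]|[/tskewE[x [y [x0 y0 ->]]]]].
    by rewrite (linfunE lin) emb_skew ?tr0 // theta_emb ?tr0 // oppr0.
  rewrite theta_emb // => /(emb_inj char2).
  rewrite trN y0 oppr0 => /(_ x0 erefl x0 erefl)[_].
  move/(two_eq0 char2) ->.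
  by apply/memv_imgP; exists x; [apply/cskewP|rewrite (linfunE lin)].
have IS : (I <= tskew F)%VS by apply/subvP => z /IP[].
have idI : graded_ideal tcomm (tskew F) (fun g => tskew F :&: A g)%VS I.
  split=> // [z t /IP[zS ez] tS|]; [split; apply/IP; split|].
  - exact: tskew_commutator_mem.
  - by rewrite theta_commutator // ez.
  - exact: tskew_commutator_mem.
  - have anti u v : tcomm u v = - tcomm v u by rewrite /commutator opprB.
    by rewrite anti -scaleN1r thetaZ theta_commutator // ez.
  apply: (@direct_decompositionI _ _ _ _ _ (hcomp A)).
  - by move=> g; apply: capvSl.
  - move=> z /IP[zS ez]; have [s us sP] := hcomp_sum dA; exists s.
    rewrite {1}(sP z) big_seq; apply: memv_suml => g gs; apply: (memv_sum_seq gs).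
    rewrite !memv_cap (tskew_hcomp char2 _ gA zS) hcomp_mem // !andbT.
    by apply/IP; rewrite tskew_hcomp // -hcth // ez.
  - by move=> g x y; rewrite linearD.
  - by move=> g x; rewrite !memv_cap => /and3P[_ _ xg]; rewrite (hcomp_id dA xg).
  - by move=> g k x; rewrite !memv_cap => /and3P[_ _ xk] kg; rewrite (hcomp_ne dA xk kg).
pose d := ce F false - ce F true.
have d0 : tr d = 0 := tr_ce_diff F.
have dn0 : d != 0 := ce_diff_neq0 F.
case: simple => _ /(_ I idI)[I0|IS'].
  have : emb d 0 \in I by apply/IP; rewrite emb_skew ?theta_emb ?tr0 ?oppr0.
  rewrite I0 memv0 => /eqP /(embb_eq0 char2 (b := false) d0) /eqP.
  by rewrite (negPf dn0).
have : emb 0 d \in I by rewrite IS' emb_skew ?tr0.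
case/IP => _; rewrite theta_emb ?tr0 // => /(emb_inj char2).
rewrite trN d0 oppr0 !tr0 => /(_ erefl erefl erefl erefl)[_ e].
by have := two_eq0 char2 e; move/eqP; rewrite (negPf dn0).
Qed.

(** Some component of [theta] of degree h != 0 is nonzero, and it is a + b theta for scalars a, b. A
    multiple of the identity does not shift degrees, so b != 0. Comparing degrees in the square of a
    + b theta gives a = 0. Thus [theta] itself has degree h, and theta^2 = 1 gives 2h = 0. *)
Lemma theta_degree : exists h : G, order2 h /\
  forall g z, z \in A g -> z \in tskew F -> theta z \in A (g + h).
Proof.
have n2 := neq2 char2.
have [h [h0 [k [w [wk wS wn]]]]] : exists h, h != 0 /\ exists k z,
    [/\ z \in A k, z \in tskew F & hcomp A (h + k) (theta z) != 0].
  apply: boolp.contrapT => H; apply: theta_not_degree0 => g z zg zS.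
  rewrite (mem_hcomp dA) -subr_eq0; apply/eqP/(hcomp_eq0 dA) => l; rewrite linearB /=.
  have [<-|gl] := eqVneq g l; first by rewrite (hcomp_id dA (hcomp_mem dA _ _)) subrr.
  rewrite (hcomp_ne dA (hcomp_mem dA _ _) gl) sub0r; apply/eqP; rewrite oppr_eq0.
  apply: boolp.contrapT => /negP nz; apply: H; exists (l - g); split.
    by rewrite subr_eq0 eq_sym.
  by exists g, z; rewrite subrK.
have [a [b abP]] := theta_component h.
have hk g : g + h != g by rewrite -subr_eq0 addrAC subrr add0r.
have Tmem g z : z \in A g -> z \in tskew F -> a *: z + b *: theta z \in A (g + h).
  by move=> zg zS; rewrite -(abP g) // addrC hcomp_mem.
have b0 : b != 0.
  apply: contraNneq wn => b0; rewrite (abP k) //; have := Tmem _ _ wk wS.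
  rewrite b0 scale0r addr0 => /(hcomp_ne dA) /(_ (hk k)).
  by rewrite (hcomp_id dA (memvZ a wk)) => ->.
have a0 : a = 0.
  apply/eqP; apply: contraNT wn => a0; rewrite (abP k) //.
  set t := _ + _; have th := Tmem _ _ wk wS; rewrite -/t in th.
  have tS : t \in tskew F by rewrite memvD // memvZ // theta_tskew.
  have := Tmem _ _ th tS.
  (* The square of a + b theta is 2a (a + b theta) + (b^2 - a^2). Applied to [w] it has degree k +
     2h, so the part 2a t, of degree k + h, vanishes. *)
  have -> : a *: t + b *: theta t = (a *+ 2) *: t + (b * b - a * a) *: w.
    rewrite /t thetaD !thetaZ thetaK //; move: (theta w) => v.
    rewrite !scalerDr !scalerA.
    rewrite [(b * a) *: _ + _]addrC addrACA [RHS]addrAC -!scalerDl.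
    by congr (_ *: _ + _ *: _); ring.
  move/(hcomp_ne dA) => /(_ (k + h)); rewrite hk => /(_ isT).
  rewrite linearD !linearZ /= (hcomp_id dA th) (hcomp_ne dA wk) 1?eq_sym // scaler0 addr0.
  move/eqP; rewrite scaler_eq0 -mulr_natl mulf_eq0 (negPf n2) (negPf a0) /=.
  by rewrite eq_sym.
have th' g z : z \in A g -> z \in tskew F -> theta z \in A (g + h).
  move=> zg zS; have := Tmem _ _ zg zS; rewrite a0 scale0r add0r => bm.
  by rewrite -(scale1r (theta z)) -(mulVf b0) -scalerA memvZ.
exists h; split=> //; split=> //; rewrite mulr2n.
have := th' _ _ (th' _ _ wk wS) (theta_tskew char2 wS); rewrite thetaK // => wkh.
have w0 : w != 0 by apply: contraNneq wn => ->; rewrite theta0 linear0.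
have /eqP := hom_uniq dA w0 wk wkh.
by rewrite -addrA -[X in X == _]addr0 (inj_eq (addrI k)) eq_sym => /eqP.
Qed.

End ThetaDegree.

(** * Characters of abelian groups *)

Section Characters.
Variables (F : closedFieldType) (G : zmodType).

(* Graphs of characters of subgroups of G, together with the empty set. *)
Definition partial_character (X : set (G * F)) : Prop :=
  [/\ forall g c g' c', X (g, c) -> X (g', c') -> X (g - g', c / c'),
      forall c, X (0, c) -> c = 1 & forall g c, X (g, c) -> c != 0].

Lemma closed_root (n : nat) (c : F) : (0 < n)%N -> exists d, d ^+ n = c.
Proof.
move=> n0; have /closed_rootP[d] : size ('X^n - c%:P : {poly F}) != 1%N.
  by rewrite size_XnsubC // eqSS -lt0n.
by rewrite /root !hornerE subr_eq0 => /eqP; exists d.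
Qed.

Section Extension.
Variable X : set (G * F).
Hypotheses (pcX : partial_character X) (neX : exists p, X p).

Lemma pchar01 : X (0, 1).
Proof.
have [XB _ X0] := pcX; have [[g c] gc] := neX.
by have := XB _ _ _ _ gc gc; rewrite subrr divff // (X0 _ _ gc).
Qed.

Lemma pcharN g c : X (g, c) -> X (- g, c^-1).
Proof.
have [XB _ _] := pcX; move=> /(XB _ _ _ _ pchar01).
by rewrite sub0r div1r.
Qed.

Lemma pcharD g c g' c' : X (g, c) -> X (g', c') -> X (g + g', c * c').
Proof.
have [XB _ _] := pcX; move=> gc /pcharN /(XB _ _ _ _ gc).
by rewrite opprK invrK.
Qed.

Lemma pcharMn g c n : X (g, c) -> X (g *+ n, c ^+ n).
Proof.
move=> gc; elim: n => [|n IH]; first by rewrite mulr0n expr0; apply: pchar01.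
by rewrite mulrS exprS; apply: pcharD.
Qed.

Lemma pchar_uniq g c c' : X (g, c) -> X (g, c') -> c = c'.
Proof.
have [XB X1 X0] := pcX; move=> gc gc'.
have := XB _ _ _ _ gc gc'; rewrite subrr => /X1 e.
by rewrite -[LHS](divfK (X0 _ _ gc')) e mul1r.
Qed.

(** If some positive multiple of [g] is in the domain, let n be the least; then [d] is an n-th root
    of the value at n g, and every k with k g in the domain is divisible by n. Otherwise k = 0 is
    the only case and d = 1 works. *)
Lemma pchar_extend g : exists2 d, d != 0 &
  forall (k : int) c, X (g *~ k, c) -> c = d ^ k.
Proof.
have [XB X1 X0] := pcX.
suff [d d0 dP] : exists2 d, d != 0 & forall k c, X (g *+ k, c) -> c = d ^+ k.
  exists d => // -[k|k] c; first exact: dP.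
  rewrite NegzE mulrNz => /pcharN; rewrite opprK => /dP e.
  by rewrite -[c]invrK e.
pose D n := `[< exists c, X (g *+ n, c) >].
have [ex|nex] := boolp.EM (exists n, (0 < n)%N && D n); last first.
  exists 1; rewrite ?oner_neq0 // => -[|k] c kc.
    by rewrite expr0; apply: X1; rewrite -(mulr0n g).
  by case: nex; exists k.+1; apply/asboolP; exists c.
case: (ex_minnP ex) => n /andP[n0 /asboolP[c nc]] nmin.
have [d dc] := closed_root c n0.
have c0 := X0 _ _ nc.
exists d; first by apply: contraNneq c0 => d0; rewrite -dc d0 expr0n gtn_eqF.
move=> k e ke.
have := pcharMn (k %/ n) nc; rewrite -mulrnA mulnC => qc.
have k_n : (k %% n = 0)%N.
  apply/eqP; rewrite -leqn0 leqNgt; apply/negP => r0.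
  have : D (k %% n)%N.
    apply/asboolP; exists (e / c ^+ (k %/ n)).
    have := XB _ _ _ _ ke qc; rewrite {1}(divn_eq k n) mulrnDr addrAC subrr add0r.
    by [].
  move=> Dr; have := nmin (k %% n)%N; rewrite r0 Dr => /(_ isT).
  by rewrite leqNgt ltn_mod n0.
rewrite (divn_eq k n) k_n addn0 in ke *.
by rewrite (pchar_uniq ke qc) -dc -exprM mulnC.
Qed.

End Extension.

Lemma character_order2 (h : G) : 2%N \notin [pchar F] -> order2 h ->
  exists chi : G -> F, is_character chi /\ chi h = -1.
Proof.
move=> char2 [h0 h2].
have n1 : -1 != 1 :> F.
  by rewrite -subr_eq0 -opprD oppr_eq0 -[1 + 1]/(2%:R); move: char2; rewrite inE.
pose P : set (set (G * F)) := fun X =>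
  partial_character X /\ ((exists p, X p) -> X (h, -1)).
have [A [[pA Ah] Amax]] : exists A, P A /\ forall B, (A `<` B)%classic -> ~ P B.
  apply: Zorn_bigcup => C CP tot; split; [split|].
  - move=> g c g' c' [Y CY Yg] [Z CZ Zg].
    case: (tot _ _ CY CZ) => YZ.
      by exists Z => //; have [[ZB _ _] _] := CP _ CZ; apply: ZB => //; apply: YZ.
    by exists Y => //; have [[YB _ _] _] := CP _ CY; apply: YB => //; apply: YZ.
  - by move=> c [Y CY Yc]; have [[_ Y1 _] _] := CP _ CY; apply: Y1.
  - by move=> g c [Y CY Yc]; have [[_ _ Y0] _] := CP _ CY; apply: Y0 Yc.
  by case=> p [Y CY Yp]; exists Y => //; have [_ Yh] := CP _ CY; apply: Yh; exists p.
pose B0 : set (G * F) := fun p => p = (0, 1) \/ p = (h, -1).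
have hN : - h = h by apply/eqP; rewrite eq_sym -addr_eq0 -mulr2n h2.
have PB0 : P B0.
  split; last by right.
  split=> [g c g' c'|c|g c].
  - case=> -[-> ->] [] [-> ->]; rewrite ?subr0 ?sub0r ?subrr ?invr1 ?mulr1 ?invrN
      ?invr1 ?mul1r ?mulrN ?mulN1r ?opprK ?hN ?mulr1; by [left|right].
  - by case=> -[] // /esym/eqP; rewrite (negPf h0).
  - by case=> -[_ ->]; rewrite ?oppr_eq0 oner_neq0.
(* Were the maximal set empty, the graph [B0] of the character of <h> would be strictly larger. *)
have neA : exists p, A p.
  apply: boolp.contrapT => H; apply: (Amax B0) => //; split.
    by move=> p Ap; case: H; exists p.
  by move=> B0A; apply: H; exists (0, 1); apply: B0A; left.
have A_h := Ah neA.
have total g : exists c, A (g, c).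
  have [d d0 dP] := pchar_extend pA neA g.
  (* The subgroup of G x F^* generated by [A] and (g, d). By the choice of [d] it is again the graph
     of a function. *)
  pose A' : set (G * F) := fun p => exists k : int, A (p.1 - g *~ k, p.2 / d ^ k).
  have AA' : (A `<=` A')%classic.
    by move=> [x y] xy; exists 0; rewrite /= mulr0z subr0 expr0z divr1.
  apply: boolp.contrapT => ng; apply: (Amax A'); last first.
    split; last by move=> _; apply: AA'.
    have [AB A1 A0] := pA.
    split=> [x y x' y' [k xy] [l xy']|y [k]|x y [k /A0]] /=.
    - exists (k - l) => /=.
      have -> : x - x' - g *~ (k - l) = x - g *~ k - (x' - g *~ l).
        by rewrite mulrzBr !opprB [LHS]addrACA [RHS]addrACA; congr (_ + _); exact: addrC.
      have -> : y / y' / d ^ (k - l) = y / d ^ k / (y' / d ^ l).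
        rewrite expfzDr // -invr_expz; have dk : d ^ k != 0 by rewrite expfz_neq0.
        have dl : d ^ l != 0 by rewrite expfz_neq0.
        have y'0 : y' != 0 by have := A0 _ _ xy'; rewrite mulf_eq0 negb_or => /andP[].
        by field; rewrite dk dl y'0.
      exact: AB xy xy'.
    - rewrite /= sub0r => /(pcharN pA neA); rewrite opprK invf_div => /dP e.
      have dk : d ^ k != 0 by rewrite expfz_neq0.
      by rewrite -[y]invrK -[y^-1](mulKf dk) e mulVf ?invr1.
    - by rewrite mulf_eq0 negb_or => /andP[].
  split=> // A'A; apply: ng; exists d; apply: A'A; exists 1 => /=.
  by rewrite mulr1z expr1z subrr divff //; apply: pchar01.
have [chi chiP] := boolp.choice total.
exists chi; split; last by apply: (pchar_uniq pA (chiP h)).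
have [AB A1 A0] := pA.
split=> [g|g k]; first exact: A0 (chiP g).
by apply: (pchar_uniq pA (chiP _)); apply: (pcharD pA neA).
Qed.

End Characters.

(** * Gradings on the tensor square from gradings on the octonions *)

Section QuotientByOrder2.
Variables (G : zmodType) (h : G).
Hypothesis oh : order2 h.
Local Notation pi := (\pi_(quot_cyc h)%qT).

Lemma piD g k : pi (g + k) = pi g + pi k.
Proof. exact: raddfD. Qed.

Lemma pi_eqP g k : pi g = pi k <-> g = k \/ g = k + h.
Proof.
have -> : (pi g = pi k) <-> (g - k \in cyc h).
  by rewrite Quotient.idealrBE; split=> [->|/eqP].
have [h0 h2] := oh.
split=> [/asboolP[n e]|[->|->]]; last 2 first.
- by rewrite subrr; apply/asboolP; exists 0; rewrite mulr0z.
- by rewrite addrAC subrr add0r; apply/asboolP; exists 1; rewrite mulr1z.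
have hn (m : nat) : h *+ m = h *+ odd m.
  by rewrite -{1}(odd_double_half m) mulrnDr -mul2n mulrnA h2 mul0rn addr0.
have hN : - h = h by apply/eqP; rewrite eq_sym -addr_eq0 -mulr2n h2.
have {e} : g - k = 0 \/ g - k = h.
  rewrite e; case: n {e} => m; rewrite ?NegzE ?mulrNz -pmulrn hn.
    by case: (odd m); [right|left].
  by case: (odd _); [right; rewrite mulr1n hN|left; rewrite mulr0n oppr0].
by case=> [/eqP|/(congr1 (fun x => x + k))]; [rewrite subr_eq0 => /eqP;
  left|rewrite subrK addrC; right].
Qed.

End QuotientByOrder2.

Lemma tens_map (F : fieldType) (f g : 'End(cayley F)) (sw : bool) :
  exists L : 'End(cayley2 F), forall x y,
    L (tens x y) = if sw then tens (g y) (f x) else tens (f x) (g y).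
Proof.
pose B x y := if sw then tens (g y) (f x) else tens (f x) (g y).
pose L0 (z : cayley2 F) : cayley2 F :=
  \sum_p z p *: B (cbase F p.1) (cbase F p.2).
have lin : linear L0.
  move=> a z t; rewrite /L0 scaler_sumr -big_split; apply: eq_bigr => p _.
  by rewrite !ffunE scalerDl scalerA.
exists (linfun L0) => x y; rewrite (linfunE lin) -/(B x y) /L0.
have BD x1 x2 y' : B (x1 + x2) y' = B x1 y' + B x2 y'.
  by rewrite /B linearD /=; case: (sw); rewrite ?tensDl ?tensDr.
have BD' x' y1 y2 : B x' (y1 + y2) = B x' y1 + B x' y2.
  by rewrite /B linearD /=; case: (sw); rewrite ?tensDl ?tensDr.
have BZ a x' y' : B (a *: x') y' = a *: B x' y'.
  by rewrite /B linearZ /=; case: (sw); rewrite ?tensZl ?tensZr.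
have BZ' a x' y' : B x' (a *: y') = a *: B x' y'.
  by rewrite /B linearZ /=; case: (sw); rewrite ?tensZl ?tensZr.
have B0 y' : B 0 y' = 0 by rewrite -(scale0r 0) BZ scale0r.
have B0' x' : B x' 0 = 0 by rewrite -(scale0r 0) BZ' scale0r.
rewrite {2}(cbase_sum x) (big_morph (fun w => B w y) (fun w w' => BD w w' y) (B0 y)).
rewrite (eq_bigr (fun p => \sum_q (x p * y q) *: B (cbase F p) (cbase F q))); last first.
  move=> p _; rewrite BZ {1}(cbase_sum y) (big_morph _ (BD' (cbase F p)) (B0' _)).
  by rewrite scaler_sumr; apply: eq_bigr => q _; rewrite BZ' scalerA.
by rewrite pair_bigA; apply: eq_bigr => p _; rewrite ffunE.
Qed.

Section TensorGrading.
Variables (F : fieldType) (G : zmodType) (h : G) (chi : G -> F).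
Variable A : quot_cyc h -> {vspace cayley F}.
Hypotheses (char2 : 2%N \notin [pchar F]) (oh : order2 h)
  (chiP : is_character chi) (chih : chi h = -1) (gA : is_grading (@cmul F) A).
Let dA : direct_decomposition fullv A := gA.1.
Local Notation pi := (\pi_(quot_cyc h)%qT).
Local Notation C1 := (cone F).

Lemma tens_hom_ind (P : cayley2 F -> Prop) : (forall z t, P z -> P t -> P (z + t)) ->
  (forall a b x y, x \in A a -> y \in A b -> P (tens x y)) -> forall z, P z.
Proof.
move=> PD PA; have P0 : P 0 by have := PA 0 0 0 0; rewrite tens0 !mem0v; apply.
elim/tens_ind => // x y; elim/(homogeneous_ind dA): x => [x x' ex ex'||a x xa].
- by rewrite tensDl; apply: PD.
- by rewrite t0ens.
elim/(homogeneous_ind dA): y => [y y' ey ey'||b y yb].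
- by rewrite tensDr; apply: PD.
- by rewrite tens0.
exact: PA xa yb.
Qed.

Lemma character_addh g : chi (g + h) = - chi g.
Proof. by rewrite chiP.2 chih mulrN1. Qed.

Lemma character_sqr g k : pi g = pi k -> chi g ^+ 2 = chi k ^+ 2.
Proof. by case/(pi_eqP oh) => -> //; rewrite character_addh sqrrN. Qed.

(** [P q] is the projection onto degree q of the tensor square of the grading [A]: the sum over a of
    the projections onto degree a in the first factor and q - a in the second. *)
Lemma coarse_projections : exists P : quot_cyc h -> 'End(cayley2 F),
  forall a b x y q, x \in A a -> y \in A b ->
    P q (tens x y) = if a + b == q then tens x y else 0.
Proof.
have [s us sP] := hcomp_sum dA.
have /boolp.choice[L LP] : forall aq : quot_cyc h * quot_cyc h, exists L :
  'End(cayley2 F),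
    forall x y, L (tens x y) = tens (hcomp A aq.1 x) (hcomp A (aq.2 - aq.1) y).
  by move=> aq; have [L LP] := tens_map (hcomp A aq.1) (hcomp A (aq.2 - aq.1)) false;
    exists L.
exists (fun q => \sum_(a <- s) L (a, q))%VF => a b x y q xa yb.
rewrite sum_lfunE (eq_bigr _ (fun c _ => LP (c, q) x y)) /=.
have hcE c w d : w \in A d -> hcomp A c w = if d == c then w else 0.
  by move=> wd; case: eqVneq => [<-|dc]; [apply: hcomp_id|apply: hcomp_ne wd dc].
have [as_|ans] := boolP (a \in s); last first.
  have -> : x = 0.
    rewrite (sP x) big_seq big1 // => c cs; apply: (hcomp_ne dA xa).
    by apply: contraNneq ans => ->.
  rewrite big1 ?t0ens ?if_same // => c _.
  by rewrite linear0 t0ens.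
rewrite (perm_big _ (perm_to_rem as_)) big_cons /= (hcE _ _ _ xa) eqxx.
rewrite big_seq big1 ?addr0; last first.
  move=> c; rewrite mem_rem_uniq // inE => /andP[ca _].
  by rewrite (hcE _ _ _ xa) eq_sym (negPf ca) t0ens.
rewrite (hcE _ _ _ yb) -(inj_eq (addrI a)) (addrC a (_ - _)) subrK.
by case: ifP; rewrite ?tens0.
Qed.

(* The swap composed with 1 (x) D, where D is the automorphism of C acting on A_b
   as chi(b)^-2, which depends only on b modulo h. *)
Lemma twisted_swap : exists Q : 'End(cayley2 F), {morph Q : z t / tmul z t} /\
  forall a b x y g, x \in A a -> y \in A b -> pi g = b ->
    Q (tens x y) = (chi g ^+ 2)^-1 *: tens y x.
Proof.
pose c (q : quot_cyc h) := (chi (repr q) ^+ 2)^-1.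
have cpi g : c (pi g) = (chi g ^+ 2)^-1.
  by congr _^-1; apply: character_sqr; rewrite reprK.
have cc : is_character c.
  split=> [q|q q']; first by rewrite invr_eq0 expf_neq0 // chiP.1.
  by rewrite -[q]reprK -[q']reprK -(piD h) !cpi chiP.2 exprMn invfM.
have [D [DA bD DM]] := character_aut (@cmul_bilinear F) gA cc.
have [Q QP] := tens_map \1%VF D true.
have QE x y : Q (tens x y) = tens (D y) x by rewrite QP id_lfunE.
have [Dl Dr _ _] := @tmul_bilinear F.
exists Q; split=> [|a b x y g xa yb gb]; last first.
  by rewrite QE (DA _ _ yb) tensZl -gb cpi.
move=> z t.
elim/tens_ind: z t => [z z' ez ez' t|x y]; first by rewrite Dl !linearD /= Dl ez ez'.
elim/tens_ind => [z z' ez ez'|x' y']; first by rewrite Dr !linearD /= Dr ez ez'.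
by rewrite tmul_tens !QE DM tmul_tens.
Qed.

(** Degree g is the part of the coarse degree pi g fixed by chi(g) Q. These spaces multiply as they
    should because Q and chi are multiplicative. The elements x (x) 1 + 1 (x) chi(g) x are fixed:
    chi(g) Q sends x (x) 1 to 1 (x) chi(g) x, and conversely. *)
Lemma tensor_grading_exists : exists B : G -> {vspace cayley2 F},
  is_grading (@tmul F) B /\
  forall g x, x \in A (pi g) -> emb x (chi g *: x) \in B g.
Proof.
have n2 := neq2 char2.
have [P PE] := coarse_projections; have [Q [QM QE]] := twisted_swap.
have [nz chiM] := chiP.
have [Dl Dr Zl Zr] := @tmul_bilinear F.
have PP q z : P q (P q z) = P q z.
  elim/tens_hom_ind: z => [z t ez et|a b x y xa yb]; first by rewrite !linearD /= ez et.
  by rewrite (PE _ _ _ _ _ xa yb); case: ifP => [e|_];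
    rewrite ?linear0 // (PE _ _ _ _ _ xa yb) e.
have PP0 q q' z : q != q' -> P q (P q' z) = 0.
  move=> qq'; elim/tens_hom_ind: z => [z t ez et|a b x y xa yb].
    by rewrite !linearD /= ez et addr0.
  rewrite (PE _ _ _ _ _ xa yb); case: eqP => [e|_]; rewrite ?linear0 //.
  by rewrite (PE _ _ _ _ _ xa yb) e eq_sym (negPf qq').
have PQ q z : P q (Q z) = Q (P q z).
  elim/tens_hom_ind: z => [z t ez et|a b x y xa yb]; first by rewrite !linearD /= ez et.
  rewrite (PE _ _ _ _ _ xa yb) (QE _ _ _ _ (repr b) xa yb) ?reprK // linearZ /=.
  rewrite (PE _ _ _ _ _ yb xa) addrC; case: ifP => _; last by rewrite scaler0 linear0.
  by rewrite (QE _ _ _ _ (repr b) xa yb) ?reprK.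
have QQ g z : P (pi g) z = z -> Q (Q z) = (chi g ^+ 2)^-1 *: z.
  move=> <-; elim/tens_hom_ind: z => [z t ez et|a b x y xa yb].
    by rewrite !linearD /= ez et.
  rewrite (PE _ _ _ _ _ xa yb); case: eqP => [e|_]; last by rewrite !linear0.
  rewrite (QE _ _ _ _ (repr b) xa yb) ?reprK // linearZ /=.
  rewrite (QE _ _ _ _ (repr a) yb xa) ?reprK // scalerA -invfM -exprMn -chiM.
  congr (_^-1 *: _); apply: character_sqr.
  by rewrite (piD h) !reprK addrC e.
have PM q q' z t : P q z = z -> P q' t = t -> P (q + q') (tmul z t) = tmul z t.
  move=> <- <-; elim/tens_hom_ind: z t => [z z' ez ez' t|a b x y xa yb].
    by rewrite !linearD /= Dl linearD /= ez ez'.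
  elim/tens_hom_ind => [z z' ez ez'|a' b' x' y' xa' yb'].
    by rewrite linearD /= Dr linearD /= ez ez'.
  rewrite (PE _ _ _ _ _ xa yb) (PE _ _ _ _ _ xa' yb').
  case: eqP => [<-|_]; last by rewrite (b0mul (@tmul_bilinear F)) linear0.
  case: eqP => [<-|_]; last by rewrite (bmul0 (@tmul_bilinear F)) linear0.
  rewrite tmul_tens (PE (a + a') (b + b')) ?gA.2 //.
  by rewrite addrACA eqxx.
(* Q^2 = chi(g)^-2 on the component of degree pi g of the product grading, which
   is therefore the sum of the eigenspaces of Q for chi(g)^-1 and chi(g + h)^-1. *)
pose R g := (fixedSpace (P (pi g)) :&: fixedSpace (chi g *: Q))%VS.
have RP g z : reflect (P (pi g) z = z /\ chi g *: Q z = z) (z \in R g).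
  rewrite memv_cap; apply: (iffP andP) => -[].
    by move=> /fixedSpaceP e1 /fixedSpaceP e2; rewrite scale_lfunE in e2.
  by move=> e1 e2; split; apply/fixedSpaceP; rewrite ?scale_lfunE.
have Rsym g z : P (pi g) z = z -> z + chi g *: Q z \in R g.
  move=> e; apply/RP; split; first by rewrite linearD linearZ /= PQ e.
  rewrite linearD linearZ /= (QQ g) // scalerDr !scalerA -expr2 divff ?expf_neq0 //.
  by rewrite scale1r addrC.
exists R; split; [split|].
(* On the coarse degree pi g the map chi(g) Q is an involution; half of 1 + chi(g) Q projects onto
   its fixed points. *)
- apply: (@direct_decompositionI _ _ _ _ _ (fun g z =>
     2%:R^-1 *: (P (pi g) z + chi g *: Q (P (pi g) z)))).
  + by move=> g; apply: subvf.
  + move=> z _; elim/tens_hom_ind: z => [z t [s zs] [s' ts']|a b x y xa yb].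
      exists (s ++ s'); apply: memvD.
        by apply: subvP zs; apply: sumv_seq_mono => g gs; rewrite mem_cat gs.
      by apply: subvP ts'; apply: sumv_seq_mono => g gs; rewrite mem_cat gs orbT.
    pose g := repr (a + b); have eg : pi g = a + b by rewrite reprK.
    have fx : P (pi g) (tens x y) = tens x y by rewrite (PE _ _ _ _ _ xa yb) eg eqxx.
    have eh : pi (g + h) = pi g by apply/(pi_eqP oh); right.
    have -> : tens x y = 2%:R^-1 *: (tens x y + chi g *: Q (tens x y)) +
       2%:R^-1 *: (tens x y + chi (g + h) *: Q (tens x y)).
      rewrite -scalerDr character_addh scaleNr addrACA subrr addr0.
      by rewrite -mulr2n -scaler_nat scalerA mulVf ?scale1r.
    exists [:: g; g + h]; apply: memvD; apply: memvZ.
      by apply: (@memv_sum_seq _ _ _ _ _ g); [rewrite mem_head|apply: Rsym].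
    apply: (@memv_sum_seq _ _ _ _ _ (g + h)); first by rewrite !inE eqxx orbT.
    by apply: Rsym; rewrite eh.
  + by move=> g z t; rewrite !linearD /= addrACA.
  + move=> g z /RP[e1 e2]; rewrite e1 e2 -mulr2n -scaler_nat scalerA mulVf //.
    by rewrite scale1r.
  + move=> g k z /RP[e1 e2] kg; have [e|ne] := eqVneq (pi k) (pi g); last first.
      by rewrite -e1 PP0 1?eq_sym // !(linear0, scaler0) addr0 scaler0.
    rewrite -e e1; case/(pi_eqP oh): e => [e|e]; first by rewrite e eqxx in kg.
    by rewrite -{1}e2 e character_addh scaleNr addNr scaler0.
- move=> g k z t /RP[e1 e2] /RP[e3 e4]; apply/RP; split; first by rewrite (piD h) PM.
  by rewrite QM chiM -scalerA -{2}e2 -{2}e4 Zl Zr.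
move=> g x xA; apply/RP.
have one : C1 \in A 0 by apply: grading_one gA _ (@cmul1 F) (@cmulx1 F);
  exact: cmul_bilinear.
have z0 : chi 0 = 1 by apply: character0.
rewrite /emb tensZr !linearD !linearZ /= (PE _ _ _ _ _ xA one) (PE _ _ _ _ _ one xA).
rewrite addr0 add0r eqxx; split=> //.
rewrite (QE _ _ _ _ 0 xA one) ?(raddf0 pi) // (QE _ _ _ _ g one xA) // z0.
rewrite expr1n invr1 scale1r !scalerA -expr2 divff ?expf_neq0 //.
by rewrite scale1r addrC.
Qed.

Lemma tensor_gradingP : is_grading (@tmul F) (tensor_grading chi A) /\
  forall g x, tr x = 0 -> x \in A (pi g) -> emb x (chi g *: x) \in tensor_grading chi A g.
Proof.
have [B [gB BP]] := tensor_grading_exists.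
have := @xgetI _ (fun=> 0%VS) [set B : G -> {vspace cayley2 F} |
       is_grading (@tmul F) B /\
       forall g x y, x \in cskew F -> y \in cskew F ->
         (x, y) \in prod_grading chi A g ->
         tens x (cone F) + tens (cone F) y \in B g]%classic B.
case=> [|gT TP].
  by split=> // g x y _ _ /mem_prod_grading[xA ->]; apply: BP.
split=> // g x x0 xA; apply: TP; [exact/cskewP|apply/cskewP|].
  by rewrite trZ x0 mulr0.
exact/mem_prod_grading.
Qed.

End TensorGrading.

(** * Classification of the gradings on the octonions *)

Section Peirce.
Variable F : fieldType.
Hypothesis char2 : 2%N \notin [pchar F].
Implicit Types (w x y z : cayley F).
Local Notation C1 := (cone F).
Let n2 := neq2 char2.
Let cbl := @cmul_bilinear F.

Lemma scale_half_two z : 2%:R^-1 *: (z + z) = z.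
Proof. by rewrite -mulr2n -scaler_nat scalerA mulVf ?scale1r. Qed.

Lemma left_alt2 x z : cmul x (cmul x z) = cmul (cmul x x) z.
Proof.
have := left_alt x x z; rewrite cmulDl => e.
by rewrite -[LHS]scale_half_two e scale_half_two.
Qed.

Lemma right_alt2 x z : cmul (cmul z x) x = cmul z (cmul x x).
Proof.
have := right_alt x x z; rewrite cmulDr => e.
by rewrite -[LHS]scale_half_two e scale_half_two.
Qed.

Lemma skew_anti x y : tr x = 0 -> tr y = 0 ->
  cmul x y + cmul y x = tr (cmul x y) *: C1.
Proof.
by move=> x0 y0; rewrite cmul_anti /polar x0 y0 !scale0r mul0r !add0r scaleNr opprK.
Qed.

Lemma skew_sqr x : tr x = 0 -> cmul x x = (tr (cmul x x) / 2%:R) *: C1.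
Proof.
by move=> x0; rewrite -[LHS]scale_half_two skew_anti // scalerA mulrC.
Qed.

Lemma cmul1D w z : cmul (C1 + w) z = z + cmul w z.
Proof. by rewrite cmulDl cmul1. Qed.

Lemma cmulD1 w z : cmul z (C1 + w) = z + cmul z w.
Proof. by rewrite cmulDr cmulx1. Qed.

(* For w^2 = 1 this is e C (1 - e), with the idempotent e = (1 + w) / 2. *)
Definition peirce w x : Prop := cmul w x = x /\ cmul x w = - x.
Definition idem w : cayley F := 2%:R^-1 *: (C1 + w).

Section Fixed.
Variable w : cayley F.
Hypotheses (w0 : tr w = 0) (ww : cmul w w = C1).

Lemma trNw : tr (- w) = 0. Proof. by rewrite trN w0 oppr0. Qed.
Lemma NwNw : cmul (- w) (- w) = C1.
Proof. by rewrite (bmulN cbl) (bNmul cbl) opprK. Qed.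

Lemma peirceN y : peirce (- w) y <-> cmul w y = - y /\ cmul y w = y.
Proof.
rewrite /peirce (bmulN cbl) (bNmul cbl); split=> -[e1 e2].
  by split; [rewrite -e1 opprK e1|rewrite -[LHS]opprK e2 opprK].
by rewrite e1 e2 opprK.
Qed.

Lemma idemD : idem w + idem (- w) = C1.
Proof. by rewrite -scalerDr addrACA subrr addr0 scale_half_two. Qed.

Lemma idemB : idem w - idem (- w) = w.
Proof. by rewrite -scalerBr opprD opprK addrACA subrr add0r scale_half_two. Qed.

Lemma tr_idem : tr (idem w) = 1.
Proof. by rewrite /idem trZ trD w0 addr0 tr1 mulVf. Qed.

Lemma idem_idem : cmul (idem w) (idem w) = idem w.
Proof.
rewrite /idem cmulZl cmulZr cmul1D cmulD1 ww scalerA.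
by rewrite (addrC w) -mulr2n -scaler_nat scalerA -mulrA mulVf ?mulr1.
Qed.

Lemma idem_idemN : cmul (idem w) (idem (- w)) = 0.
Proof.
rewrite /idem cmulZl cmulZr cmul1D cmulD1 (bmulN cbl) ww.
by rewrite addrC addrA subrK subrr !scaler0.
Qed.

Lemma peirce_idem x : peirce w x ->
  [/\ cmul (idem w) x = x, cmul x (idem w) = 0,
      cmul (idem (- w)) x = 0 & cmul x (idem (- w)) = x].
Proof.
case=> e1 e2; rewrite /idem !cmulZl !cmulZr !cmul1D !cmulD1.
rewrite (bmulN cbl) (bNmul cbl) e1 e2 opprK subrr scaler0.
by rewrite scale_half_two.
Qed.

Lemma peirce_tr x : peirce w x -> tr x = 0.
Proof.
case=> e1 e2; apply: (opp_eq0 char2).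
by rewrite -{2}e1 tr_mulC e2 trN.
Qed.

(** As w anticommutes with x, left alternation gives w (x x') = - x (w x') = - x x'; right
    alternation gives the other half. *)
Lemma peirceM x x' : peirce w x -> peirce w x' -> peirce (- w) (cmul x x').
Proof.
move=> [e1 e2] [e3 e4]; apply/peirceN; split.
  apply/eqP; rewrite -addr_eq0; apply/eqP.
  by have := left_alt w x x'; rewrite e3 e1 e2 subrr (b0mul cbl).
apply/eqP; rewrite -subr_eq0; apply/eqP.
have := right_alt w x' x; rewrite e2 e3 e4 subrr (bmul0 cbl) (bNmul cbl).
by rewrite addrC.
Qed.

Lemma peirce_tr0 x x' : peirce w x -> peirce w x' -> tr (cmul x x') = 0.
Proof.
move=> h h'; have [e1 e2] := (peirceN _).1 (peirceM h h').
by apply: (opp_eq0 char2); rewrite -trN -e1 tr_mulC e2.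
Qed.

Lemma peirce_anti x x' : peirce w x -> peirce w x' -> cmul x x' = - cmul x' x.
Proof.
move=> h h'; apply/eqP; rewrite -addr_eq0 (skew_anti (peirce_tr h) (peirce_tr h')).
by rewrite peirce_tr0 // scale0r.
Qed.

Lemma peirce_sqr x : peirce w x -> cmul x x = 0.
Proof. by move=> h; rewrite (skew_sqr (peirce_tr h)) peirce_tr0 // mul0r scale0r. Qed.

End Fixed.

Lemma peirceNN w x : peirce (- - w) x <-> peirce w x.
Proof. by rewrite opprK. Qed.

(** Left multiplication by w fixes x y and negates y x, while x y + y x = tr(x y) 1. Applying w and
    adding gives 2 x y = tr(x y) (1 + w). *)
Lemma peirce_mulN w x y : tr w = 0 -> cmul w w = C1 ->
  peirce w x -> peirce (- w) y -> cmul x y = tr (cmul x y) *: idem w.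
Proof.
move=> w0 ww h h'; have h2 := (peirceN w _).1 h'; case: h (h) => e1 e2 h;
  case: h2 => e3 e4.
have x0 := peirce_tr h; have y0 := peirce_tr h'.
have a := skew_anti x0 y0.
have b : cmul w (cmul x y) = cmul x y.
  apply/eqP; rewrite -subr_eq0; apply/eqP.
  by have := left_alt w x y; rewrite e1 e2 e3 (bmulN cbl) subrr (b0mul cbl).
have c : cmul w (cmul y x) = - cmul y x.
  apply/eqP; rewrite -addr_eq0; apply/eqP.
  by have := left_alt w y x; rewrite e1 e3 e4 addNr (b0mul cbl).
rewrite /idem -[LHS]scale_half_two scalerA mulrC -scalerA; congr (_ *: _).
rewrite scalerDr -a addrC -addrA; congr (_ + _).
have := congr1 (cmul w) a; rewrite cmulDr b c cmulZr cmulx1 => <-.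
by rewrite addrC subrK.
Qed.

(** Left multiplication by w is an involution and z anticommutes with w; these are the projections
    onto its eigenspaces. *)
Lemma peirce_split w z : tr w = 0 -> cmul w w = C1 -> tr z = 0 -> tr (cmul w z) = 0 ->
  peirce w (2%:R^-1 *: (z + cmul w z)) /\ peirce (- w) (2%:R^-1 *: (z - cmul w z)).
Proof.
move=> w0 ww z0 wz0.
have a : cmul z w = - cmul w z.
  by apply/eqP; rewrite -addr_eq0 addrC skew_anti // wz0 scale0r.
have b : cmul w (cmul w z) = z by rewrite left_alt2 ww cmul1.
have c : cmul (cmul w z) w = - z.
  by rewrite -[cmul w z]opprK -a (bNmul cbl) right_alt2 ww cmulx1.
split; last apply/peirceN.
  by split; rewrite ?cmulZr ?cmulZl ?cmulDl ?cmulDr ?a ?b ?c -?scalerN ?opprD 1?addrC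
    // addrC.
split; rewrite ?cmulZr ?cmulZl ?cmulDl ?cmulDr ?(bmulN cbl) ?(bNmul cbl) ?a ?b ?c
  -?scalerN ?opprB ?opprK //.
by rewrite addrC.
Qed.

End Peirce.

Lemma Z3_succ (i j : 'Z_3) : [\/ j = i, j = i + 1 | i = j + 1].
Proof.
elim/Z3_cases: i; elim/Z3_cases: j;
  by [constructor 1 | constructor 2; apply: val_inj | constructor 3; apply: val_inj].
Qed.

(** * Canonical bases from Peirce triples *)

Section CanonicalBasis.
Variable F : fieldType.
Hypothesis char2 : 2%N \notin [pchar F].
Implicit Types (w x y z : cayley F).
Local Notation C1 := (cone F).
Let cbl := @cmul_bilinear F.

Lemma tr_sum (I : Type) (r : seq I) (f : I -> cayley F) :
  tr (\sum_(i <- r) f i) = \sum_(i <- r) tr (f i).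
Proof. exact: (big_morph _ (@trD F) (@tr0 F)). Qed.

Lemma cmul_suml (I : Type) (r : seq I) (f : I -> cayley F) y :
  cmul (\sum_(i <- r) f i) y = \sum_(i <- r) cmul (f i) y.
Proof.
by apply: (big_morph (fun u => cmul u y)) => [u v|]; [apply: cmulDl|apply: (b0mul cbl)].
Qed.

Lemma cmul_sumr (I : Type) (r : seq I) (f : I -> cayley F) y :
  cmul y (\sum_(i <- r) f i) = \sum_(i <- r) cmul y (f i).
Proof.
by apply: (big_morph (cmul y)) => [u v|]; [apply: cmulDr|apply: (bmul0 cbl)].
Qed.

(** The map preserves products and traces, so an element of the kernel is orthogonal to everything
    for the nondegenerate form tr(x y). This gives injectivity without examining the images for
    independence. *)
Lemma basis_aut (im : cayley_idx -> cayley F) :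
  (forall p q, cmul (im p) (im q) = \sum_r cbase_mul F p q r *: im r) ->
  (forall p, tr (im p) = tr (cbase F p)) ->
  exists f : 'End(cayley F), [/\ bijective f, {morph f : x y / cmul x y}
    & forall p, f (cbase F p) = im p].
Proof.
move=> imM imtr.
pose f0 x := \sum_p x p *: im p.
have lin : linear f0.
  move=> a x y; rewrite /f0 scaler_sumr -big_split; apply: eq_bigr => p _.
  by rewrite !ffunE scalerDl scalerA.
pose f := linfun f0; have fE x : f x = \sum_p x p *: im p by rewrite (linfunE lin).
have fM : {morph f : x y / cmul x y}.
  move=> x y; rewrite {1}/cmul linear_sum !fE.
  rewrite cmul_suml.
  apply: eq_bigr => p _; rewrite linear_sum.
  rewrite cmul_sumr.
  apply: eq_bigr => q _.
  by rewrite linearZ /= cmulZl cmulZr imM scalerA fE.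
have ftr x : tr (f x) = tr x.
  rewrite fE {2}(cbase_sum x) !tr_sum; apply: eq_bigr => p _.
  by rewrite !trZ imtr.
have ker0 : lker f == 0%VS.
  rewrite -subv0; apply/subvP => z; rewrite memv_ker memv0 => /eqP fz.
  apply/eqP/tr_mul_nondeg => y.
  by rewrite -ftr fM fz (b0mul cbl) tr0.
exists f; split=> // [|p].
  by exists (f^-1)%VF; [apply: lker0_lfunK|apply: lker0_lfunVK].
rewrite fE (bigD1 p) //= big1 => [|q qp]; first by rewrite ffunE eqxx scale1r addr0.
by rewrite ffunE eq_sym (negPf qp) scale0r.
Qed.

(** With the [x i] as images of the u_i, the relation u_{i+1} u_{i+2} = v_i dictates the images of
    the v_i. The trace -1 is that of (u_1 u_2) u_3 = v_3 u_3 = - e_2. By the Peirce rules each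
    product x_i y_j is determined by its trace, which is -1 for i = j and 0 otherwise. *)
Lemma canonical_basis w (x : 'Z_3 -> cayley F) :
  tr w = 0 -> cmul w w = C1 -> (forall i, peirce w (x i)) ->
  tr (cmul (cmul (x 0) (x 1)) (x 2%:R)) = -1 ->
  exists f : 'End(cayley F), [/\ bijective f, {morph f : x y / cmul x y},
    forall b, f (ce F b) = idem (if b then - w else w),
    forall i, f (cu F i) = x i
    & forall i, f (cv F i) = cmul (x (i + 1)) (x (i + 2%:R))].
Proof.
move=> w0 ww xP x012.
have Nw0 := trNw w0; have NwNw := NwNw ww.
pose y i := cmul (x (i + 1)) (x (i + 2%:R)).
have yP i : peirce (- w) (y i) by apply: peirceM.
have Z3 (i : 'Z_3) : [/\ i + 1 + 1 = i + 2%:R, i + 1 + 2%:R = i,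
  i + 2%:R + 1 = i & i + 2%:R + 2%:R = i + 1].
  by elim/Z3_cases: i; split; apply: val_inj.
have cyc i : tr (cmul (cmul (x i) (x (i + 1))) (x (i + 2%:R))) = -1.
  have rot a b c : tr (cmul (cmul a b) c) = tr (cmul (cmul b c) a).
    by rewrite tr_mulA tr_mulC.
  elim/Z3_cases: i; last 2 first.
  - rewrite rot rot -x012; by congr (tr (cmul (cmul (x _) (x _)) (x _))); apply: val_inj.
  - rewrite rot -x012; by congr (tr (cmul (cmul (x _) (x _)) (x _))); apply: val_inj.
  rewrite -x012; by congr (tr (cmul (cmul (x _) (x _)) (x _))); apply: val_inj.
have trxy i j : tr (cmul (x i) (y j)) = if i == j then -1 else 0.
  case: (Z3_succ i j) => [->|->|->].
  - by rewrite eqxx /y -tr_mulA cyc.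
  - have -> : (i == i + 1) = false by elim/Z3_cases: i.
    rewrite /y; have [-> -> _ _] := Z3 i.
    by rewrite tr_mulC tr_mulA (peirce_sqr char2 (xP i)) (bmul0 cbl) tr0.
  have -> : (j + 1 == j) = false by elim/Z3_cases: j.
  by rewrite /y -tr_mulA (peirce_sqr char2 (xP _)) (b0mul cbl) tr0.
have xy i j : cmul (x i) (y j) = if i == j then - idem w else 0.
  rewrite (peirce_mulN char2 w0 ww (xP i) (yP j)) trxy.
  by case: eqP; rewrite ?scaleN1r ?scale0r.
have yx i j : cmul (y i) (x j) = if i == j then - idem (- w) else 0.
  rewrite (peirce_mulN char2 Nw0 NwNw (yP i)); last by apply/peirceNN.
  by rewrite tr_mulC trxy eq_sym; case: eqP; rewrite ?scaleN1r ?scale0r.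
(* Left alternation at y_i, x_{i+2}, x_i: here x_{i+2} x_i = y_{i+1}, the elements y_i and x_{i+2}
   anticommute, and y_i x_i = -(1 - e) with x_{i+2} (1 - e) = x_{i+2}. *)
have yy i : cmul (y i) (y (i + 1)) = x (i + 2%:R).
  have [z1 z2 z3 z4] := Z3 i.
  have := left_alt (y i) (x (i + 2%:R)) (x i).
  have -> : cmul (x (i + 2%:R)) (x i) = y (i + 1) by rewrite /y z1 z2.
  rewrite skew_anti ?(peirce_tr char2 (xP _)) ?(peirce_tr char2 (yP _)) //.
  rewrite tr_mulC trxy.
  have -> : (i + 2%:R == i) = false by elim/Z3_cases: (i).
  rewrite scale0r (b0mul cbl) yx eqxx (bmulN cbl).
  by have [_ _ _ ->] := peirce_idem char2 (xP (i + 2%:R)); move/eqP;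
    rewrite subr_eq0 => /eqP.
pose im (p : cayley_idx) := match p with
  | inl b => idem (if b then - w else w)
  | inr (b, i) => if b then y i else x i end.
have ims (c : cayley_idx) : \sum_r cbase F c r *: im r = im c.
  rewrite (bigD1 c) //= big1 => [|q qp]; first by rewrite ffunE eqxx scale1r addr0.
  by rewrite ffunE eq_sym (negPf qp) scale0r.
have imsN (c : cayley_idx) : \sum_r (- cbase F c) r *: im r = - im c.
  by rewrite -(ims c) -sumrN; apply: eq_bigr => r _; rewrite ffunE scaleNr.
have ims0 : \sum_r (0 : cayley F) r *: im r = 0.
  by rewrite big1 // => r _; rewrite ffunE scale0r.
have [||f [bf fM fP]] := @basis_aut im.
- case=> [b|[b i]] [c|[c j]] /=.
  + have idNN : idem (- - w) = idem w by rewrite opprK.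
    case: b c => -[] /=; rewrite ?ims ?ims0 /=.
    * exact: idem_idem.
    * have := @idem_idemN _ (- w) NwNw; by rewrite opprK.
    * exact: idem_idemN.
    * exact: idem_idem.
  + have [h1 _ h2 _] := peirce_idem char2 (xP j).
    have [] := peirce_idem char2 (yP j); rewrite opprK => h3 _ h4 _.
    by case: b c => -[] /=; rewrite ?ims ?ims0 /=.
  + have [_ h1 _ h2] := peirce_idem char2 (xP i).
    have [] := peirce_idem char2 (yP i); rewrite opprK => _ h3 _ h4.
    by case: b c => -[] /=; rewrite ?ims ?ims0 /=.
  have Z3' (k : 'Z_3) : [/\ (k == k + 1) = false, (k + 1 == k) = false,
    (k + 1 + 1 == k) = false & (k == k + 1 + 1) = false].
    by elim/Z3_cases: k.
  case: b c => -[] /=.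
  + case: (Z3_succ i j) => [->|->|->].
    * have [-> _ _ _] := Z3' i; rewrite ims0.
      exact: (peirce_sqr char2 (yP i)).
    * by rewrite eqxx ims /= yy.
    have [_ _ _ ->] := Z3' j; rewrite eqxx imsN /= -yy.
    exact: (peirce_anti char2 (yP _) (yP _)).
  + by rewrite yx; case: eqP; rewrite ?ims0 ?imsN.
  + by rewrite xy; case: eqP; rewrite ?ims0 ?imsN.
  case: (Z3_succ i j) => [->|->|->].
  * have [-> _ _ _] := Z3' i; rewrite ims0.
    exact: (peirce_sqr char2 (xP i)).
  * rewrite eqxx ims /= /y.
    by have [_ _ -> ->] := Z3 i.
  have [_ _ _ ->] := Z3' j; rewrite eqxx imsN /= /y.
  have [_ _ -> ->] := Z3 j.
  exact: (peirce_anti char2 (xP _) (xP _)).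
- case=> [b|[[] i]] /=.
  + rewrite -/(ce F b) ce_oct tr_oct /=.
    by case: b => /=; rewrite tr_idem // ?addr0 ?add0r.
  + by rewrite -/(cv F i) cv_oct tr_oct addr0 (peirce_tr char2 (yP i)).
  by rewrite -/(cu F i) cu_oct tr_oct addr0 (peirce_tr char2 (xP i)).
by exists f; split=> // *; apply: fP.
Qed.

End CanonicalBasis.

(** * The trace of homogeneous elements *)

Section HomogeneousTrace.
Variables (F : fieldType) (G : zmodType).
Hypothesis char2 : 2%N \notin [pchar F].
Variable A : G -> {vspace cayley F}.
Hypothesis gA : is_grading (@cmul F) A.
Let dA : direct_decomposition fullv A := gA.1.
Local Notation C1 := (cone F).
Let cbl := @cmul_bilinear F.
Let n2 := neq2 char2.

Lemma cone_hom : C1 \in A 0.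
Proof. by apply: grading_one gA _ (@cmul1 F) (@cmulx1 F). Qed.

Lemma cone_neq0 : C1 != 0 :> cayley F.
Proof. by apply/eqP => /(congr1 (@tr F)); rewrite tr1 tr0; apply/eqP. Qed.

(** In 2 x^2 = 2 tr(x) x - 2 n(x) 1 neither x^2, of degree 2g, nor 1 contributes to degree g; what
    is left is 2 tr(x) x = 0. *)
Lemma tr_hom g x : g != 0 -> x \in A g -> tr x = 0.
Proof.
move=> g0 xg; have e := cmul_anti x x.
have xx : cmul x x + cmul x x \in A (g + g) by apply: memvD; apply: gA.2.
have gg : g + g != g by rewrite -subr_eq0 addrK.
have := congr1 (hcomp A g) e; rewrite (hcomp_ne dA xx gg) linearB /= linearZ /=.
rewrite (hcomp_ne dA cone_hom) 1?eq_sym // scaler0 subr0.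
rewrite (hcomp_id dA) ?memvD ?memvZ // -scalerDl => /esym/eqP.
rewrite scaler_eq0 => /orP[|/eqP->]; last exact: tr0.
by rewrite -mulr2n -mulr_natl mulf_eq0 (negPf n2) => /eqP.
Qed.

Lemma tr_hcomp g x : tr x = 0 -> tr (hcomp A g x) = 0.
Proof.
move=> x0; have [g0|g0] := eqVneq g 0; last exact: tr_hom g0 (hcomp_mem dA g x).
have [s us sP] := hcomp_sum dA; move: x0; rewrite {1}(sP x) tr_sum g0.
have [s0|s0] := boolP (0 \in s).
  rewrite (perm_big _ (perm_to_rem s0)) big_cons /= big_seq big1 ?addr0 // => k.
  by rewrite mem_rem_uniq // inE => /andP[k0 _]; apply: tr_hom k0 (hcomp_mem dA k x).
move=> _; have -> : hcomp A 0 x = 0; last exact: tr0.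
rewrite [X in hcomp A 0 X](sP x) linear_sum big_seq big1 // => k ks.
by apply: (hcomp_ne dA (hcomp_mem dA k x)); apply: contraNneq s0 => <-.
Qed.

End HomogeneousTrace.

(** * Gradings of C with a skew element of degree 0 *)

Section Classification.
Variables (F : closedFieldType) (G : zmodType).
Hypothesis char2 : 2%N \notin [pchar F].
Variable A : G -> {vspace cayley F}.
Hypothesis gA : is_grading (@cmul F) A.
Let dA : direct_decomposition fullv A := gA.1.
Implicit Types (w x y z : cayley F).
Local Notation C1 := (cone F).
Let cbl := @cmul_bilinear F.
Let n2 := neq2 char2.

Lemma tr_hom_mul g k x y : g + k != 0 -> x \in A g -> y \in A k -> tr (cmul x y) = 0.
Proof. by move=> gk xg yk; apply: (tr_hom char2 gA gk); apply: gA.2. Qed.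

(** The trace vanishes in nonzero degrees, so the nondegenerate form tr(x y) pairs degree g with
    degree -g. *)
Lemma tr_pair_hom g x : x \in A g -> x != 0 -> exists2 y,
  y \in A (- g) & tr (cmul x y) != 0.
Proof.
move=> xg xn.
have /boolp.existsNP[z /eqP xz] : ~ (forall z, tr (cmul x z) = 0).
  by move=> H; move: xn; rewrite (tr_mul_nondeg H) eqxx.
exists (hcomp A (- g) z); first exact: hcomp_mem.
apply: contraNneq xz => e; have [s _ sP] := hcomp_sum dA.
rewrite (sP z) cmul_sumr tr_sum big1 // => k _.
have [->//|kg] := eqVneq k (- g); apply: (tr_hom_mul _ xg (hcomp_mem dA k z)).
by rewrite addrC addr_eq0.
Qed.

Lemma normalize g x c : x \in A g -> tr x = 0 -> tr (cmul x x) != 0 -> c != 0 ->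
  exists y, [/\ y \in A g, tr y = 0 & cmul y y = c *: C1].
Proof.
move=> xg x0 xx c0.
have [d dd] := closed_root (tr (cmul x x) / 2%:R / c) (isT : (0 < 2)%N).
have d0 : d != 0.
  apply: contraNneq xx => d0; move: dd; rewrite d0 expr0n /= => /esym/eqP.
  by rewrite !mulf_eq0 !invr_eq0 (negPf n2) (negPf c0) !orbF.
exists (d^-1 *: x); split; [by rewrite memvZ|by rewrite trZ x0 mulr0|].
rewrite cmulZl cmulZr skew_sqr // !scalerA; congr (_ *: _).
have -> : tr (cmul x x) / 2%:R = d ^+ 2 * c by rewrite dd divfK.
by rewrite expr2; field.
Qed.

(** The trace form is nondegenerate on the skew elements of degree 0. If w is isotropic, take y'
    with tr(w y') != 0: either y' or w + y' is anisotropic, and it can be scaled to square 1. *)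
Lemma degree0_unit w : w \in A 0 -> tr w = 0 -> w != 0 ->
  exists z, [/\ z \in A 0, tr z = 0 & cmul z z = C1].
Proof.
move=> wA w0 wn.
suff [z [zA z0 zz]] : exists z, [/\ z \in A 0, tr z = 0 & tr (cmul z z) != 0].
  have [y [yA y0 yy]] := normalize zA z0 zz (oner_neq0 F).
  by exists y; rewrite yy scale1r.
have [ww|] := eqVneq (tr (cmul w w)) 0; last by exists w.
have [y] := tr_pair_hom wA wn; rewrite oppr0 => yA wy.
have [a [y' [y0 ey]]] := skew_part char2 y.
have yA' : y' \in A 0.
  by rewrite (_ : y' = y - a *: C1) ?memvB ?memvZ ?(cone_hom gA) // ey addrC addKr.
have wy' : tr (cmul w y') != 0.
  by move: wy; rewrite ey cmulDr cmulZr cmulx1 trD trZ w0 mulr0 add0r.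
have [yy|] := eqVneq (tr (cmul y' y')) 0; last by exists y'.
exists (w + y'); split; [exact: memvD|by rewrite trD w0 y0 addr0|].
rewrite cmulDl !cmulDr !trD ww yy addr0 add0r (tr_mulC y') -mulr2n -mulr_natl.
by rewrite mulf_neq0.
Qed.

Lemma not_spanned (X : seq (cayley F)) : (size X < 8)%N ->
  exists g z, z \in A g /\ z \notin <<X>>%VS.
Proof.
move=> sX.
apply: boolp.contrapT => H.
have : (\dim (fullv : {vspace cayley F}) <= size X)%N.
  apply: leq_trans (dim_span X); apply: dimvS; apply/subvP => z _.
  elim/(homogeneous_ind dA): z => [z t|| g z zg]; [exact: memvD|exact: mem0v|].
  by apply: boolp.contrapT => /negP zX; apply: H; exists g, z.
rewrite dimvf leqNgt => /negP; apply.
have -> : dim (cayley F) = 8%N; last by [].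
have -> : dim (cayley F) = (#|cayley_idx| * 1)%N by [].
by rewrite card_sum card_prod card_bool card_ord.
Qed.

Section DegreeZeroUnit.
Variable w : cayley F.
Hypotheses (wA : w \in A 0) (w0 : tr w = 0) (ww : cmul w w = C1).

Lemma cayley_peirce z : exists a b u v,
  [/\ peirce w u, peirce (- w) v & z = a *: C1 + b *: w + (u + v)].
Proof.
have [a [z' [z0 ->]]] := skew_part char2 z.
pose b := tr (cmul w z') / 2%:R; pose t := z' - b *: w.
have t0 : tr t = 0 by rewrite trD trN trZ z0 w0 mulr0 subr0.
have wt : tr (cmul w t) = 0.
  by rewrite cmulDr (bmulN cbl) cmulZr ww trD trN trZ tr1 divfK ?subrr.
have [uP vP] := peirce_split char2 w0 ww t0 wt.
exists a, b, (2%:R^-1 *: (t + cmul w t)), (2%:R^-1 *: (t - cmul w t)); split=> //.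
by rewrite -scalerDr addrACA subrr addr0 (scale_half_two char2) /t -addrA (addrC (b *:
  w)) subrK.
Qed.

(** The Peirce space of w is totally isotropic and orthogonal to 1 and w, so it can only be paired
    with that of -w. *)
Lemma peirce_nondeg u : peirce w u -> u != 0 ->
  exists2 v, peirce (- w) v & tr (cmul u v) != 0.
Proof.
move=> uP un; apply: boolp.contrapT => H; move/eqP: un; apply.
apply: tr_mul_nondeg => z.
have [a [b [u' [v [uP' vP ->]]]]] := cayley_peirce z.
rewrite !cmulDr !trD !cmulZr !trZ cmulx1 (peirce_tr char2 uP).
rewrite uP.2 trN (peirce_tr char2 uP) (peirce_tr0 char2 uP uP') oppr0 !mulr0 !add0r.
by apply/eqP; apply: boolp.contrapT => /negP uv; apply: H; exists v.
Qed.
End DegreeZeroUnit.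

Section PeirceTriple.
Variable w : cayley F.
Hypotheses (wA : w \in A 0) (w0 : tr w = 0) (ww : cmul w w = C1).
Let Nw0 := trNw w0.
Let NwNw := NwNw ww.

Lemma peirce_lin a x y : peirce w x -> peirce w y -> peirce w (a *: x + y).
Proof.
move=> [e1 e2] [e3 e4]; split; rewrite ?cmulDr ?cmulDl ?cmulZr ?cmulZl ?e1 ?e2 ?e3 ?e4 //.
by rewrite scalerN opprD.
Qed.

(* Otherwise C would be spanned by 1, w, x1 and v. *)
Lemma peirce_nonspan : exists x1 x2 v, [/\ peirce w x1, peirce w x2, peirce (- w) v,
  x2 != 0 & tr (cmul x1 v) != 0 /\ tr (cmul x2 v) = 0].
Proof.
apply: boolp.contrapT => H.
have key x1 v : peirce w x1 -> peirce (- w) v -> tr (cmul x1 v) != 0 ->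
    forall x, peirce w x -> x = (tr (cmul x v) / tr (cmul x1 v)) *: x1.
  move=> x1P vP x1v x xP; apply/eqP; rewrite -subr_eq0; apply: boolp.contrapT => /negP ne.
  apply: H; exists x1, (x - (tr (cmul x v) / tr (cmul x1 v)) *: x1), v; split=> //.
    by rewrite addrC -scaleNr; apply: peirce_lin.
  by split=> //; rewrite cmulDl (bNmul cbl) cmulZl trD trN trZ divfK ?subrr.
have [X sX XP] : exists2 X : seq (cayley F), (size X < 8)%N & forall z, z \in <<X>>%VS.
  have [[x1 [x1P x1n]]|no] := boolp.EM (exists x1, peirce w x1 /\ x1 != 0); last first.
    have u0 u : peirce w u -> u = 0.
      by move=> uP; apply/eqP; apply: boolp.contrapT => /negP un; apply: no; exists u.
    exists [:: C1; w] => // z; have [a [b [u [v [/u0-> vP ->]]]]] :=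
      cayley_peirce w0 ww z.
    have -> : v = 0.
      apply/eqP; apply: boolp.contrapT => /negP vn.
      have [u' /peirceNN /u0->] := peirce_nondeg Nw0 NwNw vP vn.
      by rewrite (bmul0 cbl) tr0 eqxx.
    by rewrite !addr0 memvD // memvZ // memv_span // !inE eqxx ?orbT.
  have [v vP x1v] := peirce_nondeg w0 ww x1P x1n.
  exists [:: C1; w; x1; v] => // z;
    have [a [b [u [t [uP tP ->]]]]] := cayley_peirce w0 ww z.
  rewrite (key _ _ x1P vP x1v u uP).
  have -> : t = (tr (cmul x1 t) / tr (cmul x1 v)) *: v.
    apply/eqP; rewrite -subr_eq0; apply: boolp.contrapT => /negP ne.
    set t' := t - _ in ne.
    have tP' : peirce (- w) t'.
      have [a1 a2] := (peirceN _ _).1 tP; have [a3 a4] := (peirceN _ _).1 vP.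
      apply/peirceN; split; rewrite /t' ?cmulDr ?cmulDl ?(bmulN cbl) ?(bNmul cbl)
        ?cmulZr ?cmulZl ?a1 ?a2 ?a3 ?a4 //.
      by rewrite scalerN opprD.
    have [u' /peirceNN u'P] := peirce_nondeg Nw0 NwNw tP' ne.
    rewrite (key _ _ x1P vP x1v u' u'P) cmulZr trZ (tr_mulC t') /t' cmulDr (bmulN cbl)
      cmulZr.
    by rewrite trD trN trZ divfK // subrr mulr0 eqxx.
  by rewrite !memvD // !memvZ // memv_span // !inE eqxx ?orbT.
have [g [z [_]]] := not_spanned sX; by rewrite XP.
Qed.

(** Right alternation with tr(x2 v) = 0 gives (x1 x2) v = - (x1 v) x2 = - tr(x1 v) x2, which is
    nonzero. So x1 x2 != 0, and being in the Peirce space of -w it pairs nontrivially with some c in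
    that of w. *)
Lemma peirce_triple : exists a b c, [/\ peirce w a, peirce w b, peirce w c
  & tr (cmul (cmul a b) c) != 0].
Proof.
have [x1 [x2 [v [x1P x2P vP x2n [x1v x2v]]]]] := peirce_nonspan.
exists x1, x2; have mP := peirceM x1P x2P.
have mn : cmul x1 x2 != 0.
  have := right_alt x2 v x1; rewrite skew_anti ?(peirce_tr char2 x2P) ?(peirce_tr char2
    vP) //.
  rewrite x2v scale0r (bmul0 cbl) (peirce_mulN char2 w0 ww x1P vP) cmulZl.
  have [-> _ _ _] := peirce_idem char2 x2P.
  move=> e; apply: contraNneq x2n => m0; move: e; rewrite m0 (b0mul cbl) add0r => /eqP.
  by rewrite scaler_eq0 (negPf x1v).
have [c /peirceNN cP mc] := peirce_nondeg Nw0 NwNw mP mn.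
by exists c; split.
Qed.

Lemma peirce_hcomp g x : peirce w x -> peirce w (hcomp A g x).
Proof.
case=> e1 e2; split.
  by have := hcomp_mull cbl gA g x wA; rewrite add0r e1.
by have := hcomp_mulr cbl gA g x wA; rewrite addr0 e2 linearN.
Qed.

(** Peirce spaces of [w] are graded as [w] has degree 0. Expanding the trilinear form tr((x y) z)
    over homogeneous components, some term is nonzero. *)
Lemma peirce_triple_hom : exists a b c (x y z :
  cayley F), [/\ x \in A a, y \in A b, z \in A c,
  [/\ peirce w x, peirce w y & peirce w z] & tr (cmul (cmul x y) z) != 0].
Proof.
have [x [y [z [xP yP zP]]]] := peirce_triple.
move=> n0; apply: boolp.contrapT => H; move/eqP: n0; apply.
have [s _ sP] := hcomp_sum dA.
rewrite (sP x) (cmul_suml _ _ y) (cmul_suml _ _ z) tr_sum big1 // => a _.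
rewrite (sP y) (cmul_sumr s (fun k => hcomp A k y)) (cmul_suml _ _ z) tr_sum big1 // =>
  b _.
rewrite (sP z) (cmul_sumr s (fun k => hcomp A k z)) tr_sum big1 // => c _.
apply/eqP; apply: boolp.contrapT => /negP n0; apply: H.
exists a, b, c, (hcomp A a x), (hcomp A b y), (hcomp A c z).
by split; rewrite ?hcomp_mem //; split; apply: peirce_hcomp.
Qed.

(** Only the third vector is rescaled to reach the trace -1. A nonzero trace forces degree 0, so the
    three degrees add up to 0. *)
Lemma peirce_triple_basis (X : 'Z_3 -> cayley F) (gamma : 'Z_3 -> G) :
  (forall i, X i \in A (gamma i)) -> (forall i, peirce w (X i)) ->
  tr (cmul (cmul (X 0) (X 1)) (X 2%:R)) != 0 ->
  \sum_i gamma i = 0 /\ exists f : 'End(cayley F),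
  [/\ bijective f, {morph f : x y / cmul x y}
    & forall p, f (cbase F p) \in A (deg1 gamma p)].
Proof.
move=> XA XP n0; set k := tr _ in n0.
pose Y (i : 'Z_3) := if i == 2%:R then (- k^-1) *: X i else X i.
have YA i : Y i \in A (gamma i) by rewrite /Y; case: eqP => // _; apply: memvZ.
have YP i : peirce w (Y i).
  rewrite /Y; case: eqP => // _; rewrite -[_ *: _]addr0; apply: peirce_lin => //.
  by rewrite /peirce (bmul0 cbl) (b0mul cbl) oppr0.
have k1 : tr (cmul (cmul (Y 0) (Y 1)) (Y 2%:R)) = -1.
  by rewrite /Y /= cmulZr trZ mulNr mulVf.
have gs : \sum_i gamma i = 0.
  rewrite big_Z3; apply/eqP; apply: contraT => g0.
  have := tr_hom char2 gA g0 (gA.2 _ _ _ _ (gA.2 _ _ _ _ (YA 0) (YA 1)) (YA 2%:R)).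
  by rewrite k1 => /eqP; rewrite oppr_eq0 oner_eq0.
split=> //; have [f [bf fM fe fu fv]] := canonical_basis char2 w0 ww YP k1.
exists f; split=> // -[b'|[[] i]] /=.
- rewrite -/(ce F b') fe; case: b'; rewrite memvZ // memvD ?(cone_hom gA) ?memvN //.
- rewrite -/(cv F i) fv.
  have -> : - gamma i = gamma (i + 1) + gamma (i + 2%:R).
    apply/eqP; rewrite eq_sym -addr_eq0; apply/eqP; move: gs; rewrite big_Z3 => <-.
    elim/Z3_cases: i.
    - rewrite -[RHS]addrA [RHS]addrC.
      by congr (gamma _ + gamma _ + gamma _); apply: val_inj.
    - rewrite [RHS]addrC [RHS]addrA; by congr (gamma _ + gamma _ + gamma _);
        apply: val_inj.
    - by congr (gamma _ + gamma _ + gamma _); apply: val_inj.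
  exact: gA.2.
by rewrite -/(cu F i) fu.
Qed.

Lemma cayley_grading1 : exists gamma : 'Z_3 -> G,
  \sum_i gamma i = 0 /\ exists f : 'End(cayley F),
  [/\ bijective f, {morph f : x y / cmul x y}
    & forall p, f (cbase F p) \in A (deg1 gamma p)].
Proof.
have [a [b [c [x [y [z [xA yA zA [xP yP zP] n0]]]]]]] := peirce_triple_hom.
exists (fun i : 'Z_3 => if i == 0 then a else if i == 1 then b else c).
apply: (@peirce_triple_basis (fun i => if i == 0 then x else if i == 1 then y else z)).
- by elim/Z3_cases.
- by elim/Z3_cases.
exact: n0.
Qed.

End PeirceTriple.

End Classification.

(** * Gradings of C without nonzero skew elements of degree 0 *)

Section Classification2.
Variables (F : closedFieldType) (G : zmodType).
Hypothesis char2 : 2%N \notin [pchar F].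
Variable A : G -> {vspace cayley F}.
Hypothesis gA : is_grading (@cmul F) A.
Let dA : direct_decomposition fullv A := gA.1.
Implicit Types (w x y z : cayley F).
Local Notation C1 := (cone F).
Let cbl := @cmul_bilinear F.
Let n2 := neq2 char2.
Hypothesis A0 : forall x, x \in A 0 -> tr x = 0 -> x = 0.

Lemma degree0_scalar x : x \in A 0 -> exists a, x = a *: C1.
Proof.
move=> xA; have [a [y [y0 e]]] := skew_part char2 x; exists a.
have yA : y \in A 0 by rewrite (_ :
  y = x - a *: C1) ?memvB ?memvZ ?cone_hom // e addrC addKr.
by rewrite e (A0 yA y0) addr0.
Qed.

(** If x^2 = 0, pick y of degree -g with tr(x y) != 0. Then x y = a 1 by its degree, and 0 = x^2 y =
    x (x y) = a x gives a = 0, a contradiction. *)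
Lemma hom_nonisotropic g x : g != 0 -> x \in A g -> x != 0 -> tr (cmul x x) != 0.
Proof.
move=> g0 xg xn; apply/eqP => xx0.
have xx : cmul x x = 0.
  by rewrite (skew_sqr char2 (tr_hom char2 gA g0 xg)) xx0 mul0r scale0r.
have [y yg xy] := tr_pair_hom char2 gA xg xn.
have := gA.2 _ _ _ _ xg yg; rewrite subrr => /degree0_scalar[a ea].
have := left_alt2 char2 x y; rewrite xx (b0mul cbl) ea cmulZr cmulx1 => /eqP.
rewrite scaler_eq0 (negPf xn) orbF => /eqP a0.
by move: xy; rewrite ea a0 scale0r tr0 eqxx.
Qed.

Lemma hom_order2 g x : g != 0 -> x \in A g -> x != 0 -> g + g = 0.
Proof.
move=> g0 xg xn; apply/eqP; apply: contraT => gg.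
by have := hom_nonisotropic g0 xg xn; rewrite (tr_hom_mul char2 gA gg xg xg) eqxx.
Qed.

Lemma hom_normalize g x c : g != 0 -> x \in A g -> x != 0 -> c != 0 ->
  exists y, [/\ y \in A g, tr y = 0 & cmul y y = c *: C1].
Proof.
move=> g0 xg xn c0.
exact: (normalize char2 xg (tr_hom char2 gA g0 xg) (hom_nonisotropic g0 xg xn) c0).
Qed.

(** As x y has degree 2g = 0, it is a scalar a; then x^2 y = x (x y) = a x, and x^2 is a nonzero
    scalar. *)
Lemma hom_line g x y : g != 0 -> x \in A g -> x != 0 -> y \in A g -> y \in <[x]>%VS.
Proof.
move=> g0 xg xn yg; have gg := hom_order2 g0 xg xn.
have := gA.2 _ _ _ _ xg yg; rewrite gg => /degree0_scalar[a ea].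
have x0 := tr_hom char2 gA g0 xg; have xx := hom_nonisotropic g0 xg xn.
have := left_alt2 char2 x y; rewrite ea cmulZr cmulx1 (skew_sqr char2 x0) cmulZl cmul1
  => e.
have k0 : tr (cmul x x) / 2%:R != 0 by rewrite mulf_neq0 // invr_eq0.
apply/vlineP; exists ((tr (cmul x x) / 2%:R)^-1 * a).
by rewrite -scalerA e scalerA mulVf ?scale1r.
Qed.

(** Choose homogeneous x, y, z outside the spans of 1, then of 1, x, then of 1, x, y, x y, all of
    dimension below 8. Since nonzero components are lines, a vector outside the span has a degree
    not yet met. *)
Lemma elementary_triple : exists a b c, [/\ a != 0, b \notin [:: 0; a],
  c \notin [:: 0; a; b; a + b] &
  exists x y z, [/\ x \in A a, y \in A b, z \in A c & [/\ x != 0, y != 0 & z != 0]]].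
Proof.
have neq0 (X : seq (cayley F)) z : z \notin <<X>>%VS -> z != 0.
  by apply: contraNneq => ->; apply: mem0v.
have span0 (X : seq (cayley F)) z : C1 \in X -> z \in A 0 -> z \in <<X>>%VS.
  by move=> X1 /degree0_scalar[k ->]; rewrite memvZ // memv_span.
have spang (X : seq (cayley F)) g x z :
  g != 0 -> x \in A g -> x != 0 -> x \in X -> z \in A g -> z \in <<X>>%VS.
  move=> g0 xg xn xX zg; have /vlineP[k ->] := hom_line g0 xg xn zg.
  by rewrite memvZ // memv_span.
have [a [x [xa xX]]] := not_spanned gA (X := [:: C1]) isT.
have a0 : a != 0 by apply: contraNneq xX => a0; apply: span0; rewrite ?inE // -a0.
have xn := neq0 _ _ xX.
have [b [y [yb yX]]] := not_spanned gA (X := [:: C1; x]) isT.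
have b0 : b != 0 by apply: contraNneq yX => b0; apply: span0; rewrite ?inE ?eqxx // -b0.
have ba : b != a by apply: contraNneq yX => ba; apply: (spang _ a x);
  rewrite ?inE ?eqxx ?orbT // -ba.
have yn := neq0 _ _ yX.
have ab0 : a + b != 0.
  by apply: contraNneq ba => e; apply/eqP; apply: (addrI a);
    rewrite e (hom_order2 a0 xa xn).
have xyn : cmul x y != 0.
  apply/eqP => xy0; have := left_alt2 char2 x y; rewrite xy0 (bmul0 cbl).
  rewrite (skew_sqr char2 (tr_hom char2 gA a0 xa)) cmulZl cmul1 => /esym/eqP.
  rewrite scaler_eq0 (negPf yn) orbF mulf_eq0 invr_eq0 (negPf n2) orbF.
  by rewrite (negPf (hom_nonisotropic a0 xa xn)).
have xyab := gA.2 _ _ _ _ xa yb.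
have [c [z [zc zX]]] := not_spanned gA (X := [:: C1; x; y; cmul x y]) isT.
exists a, b, c; split=> //.
- by rewrite !inE negb_or b0 ba.
- rewrite !inE !negb_or; apply/and4P; split.
  + by apply: contraNneq zX => e; apply: span0; rewrite ?inE ?eqxx // -e.
  + by apply: contraNneq zX => e; apply: (spang _ a x); rewrite ?inE ?eqxx ?orbT // -e.
  + by apply: contraNneq zX => e; apply: (spang _ b y); rewrite ?inE ?eqxx ?orbT // -e.
  + by apply: contraNneq zX => e; apply: (spang _ (a + b) (cmul x y));
      rewrite ?inE ?eqxx ?orbT // -e.
by exists x, y, z; split=> //; split=> //; apply: neq0 zX.
Qed.

(** Take w, v, t of degrees a, b, c in the roles of e_1 - e_2, u_1 + v_1, u_2 + v_2. The Peirce
    parts of v and t for w give images of u_1, v_1, u_2, v_2, and u_3 = v_1 v_2 the remaining one.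
    Their traces are those required because w, v, t, w v are pairwise orthogonal where needed. *)
Lemma cayley_grading2 a b c x y z : a != 0 -> b \notin [:: 0; a] ->
  c \notin [:: 0; a; b; a + b] -> x \in A a -> y \in A b -> z \in A c ->
  x != 0 -> y != 0 -> z != 0 ->
  exists f : 'End(cayley F), [/\ bijective f, {morph f : x y / cmul x y}
    & forall j, f (uvw_base F j) \in A (deg2 a b c j)].
Proof.
move=> a0; rewrite !inE !negb_or => /andP[b0 ba] /and4P[c0 ca cb cab] xa yb zc xn yn zn.
have aa := hom_order2 a0 xa xn; have bb := hom_order2 b0 yb yn.
have cc := hom_order2 c0 zc zn.
have [w [wA w0]] := hom_normalize a0 xa xn (oner_neq0 F); rewrite scale1r => ww.
have nN1 : -1 != 0 :> F by rewrite oppr_eq0 oner_eq0.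
(* In the model (e_1 - e_2)^2 = 1, whereas u_i + v_i has square u_i v_i + v_i u_i = -1. *)
have [v [vA v0 vv]] := hom_normalize b0 yb yn nN1.
have [t [tA t0 tt]] := hom_normalize c0 zc zn nN1.
move=> {x y z xa yb zc xn yn zn}.
have sum0 (g k : G) : g + g = 0 -> g != k -> g + k != 0.
  by move=> gg gk; apply: contra gk => /eqP e; rewrite -(inj_eq (addrI g)) gg e.
have wv0 : tr (cmul w v) = 0 by apply: (tr_hom_mul char2 gA _ wA vA);
  rewrite sum0 // eq_sym.
have wt0 : tr (cmul w t) = 0 by apply: (tr_hom_mul char2 gA _ wA tA);
  rewrite sum0 // eq_sym.
have vt0 : tr (cmul v t) = 0 by apply: (tr_hom_mul char2 gA _ vA tA);
  rewrite sum0 // eq_sym.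
have wvt0 : tr (cmul (cmul w v) t) = 0.
  apply: (tr_hom_mul char2 gA _ (gA.2 _ _ _ _ wA vA) tA); rewrite sum0 1?eq_sym //.
  by rewrite addrACA aa bb addr0.
have [X0P Y0P] := peirce_split char2 w0 ww v0 wv0.
have [X1P Y1P] := peirce_split char2 w0 ww t0 wt0.
set X0 := _ *: (v + _) in X0P; set Y0 := _ *: (v - _) in Y0P.
set X1 := _ *: (t + _) in X1P; set Y1 := _ *: (t - _) in Y1P.
have ev : v = X0 + Y0.
  by rewrite -scalerDr addrACA subrr addr0 (scale_half_two char2).
have et : t = X1 + Y1.
  by rewrite -scalerDr addrACA subrr addr0 (scale_half_two char2).
have ewv : cmul w v = X0 - Y0.
  by rewrite -scalerBr opprB addrC addrA subrK (scale_half_two char2).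
have sq X Y : peirce w X -> peirce (- w) Y -> cmul (X + Y) (X + Y) = - C1 -> tr (cmul X
  Y) = -1.
  move=> XP YP; rewrite cmulDl !cmulDr (peirce_sqr char2 XP) (peirce_sqr char2 YP)
    add0r addr0.
  rewrite (skew_anti (peirce_tr char2 XP) (peirce_tr char2 YP)) => /eqP.
  rewrite -[- C1]scaleN1r -subr_eq0 -scalerBl scaler_eq0 (negPf (cone_neq0 char2)) orbF
    subr_eq0.
  by move/eqP.
have XY0 : tr (cmul X0 Y0) = -1 by apply: (sq _ _ X0P Y0P); rewrite -ev vv scaleN1r.
have XY1 : tr (cmul X1 Y1) = -1 by apply: (sq _ _ X1P Y1P); rewrite -et tt scaleN1r.
(* tr(v t) and tr((w v) t) are the sum and the difference of the two mixed traces, so both of these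
   vanish. *)
have d1 : tr (cmul X0 Y1) + tr (cmul Y0 X1) = 0.
  rewrite -vt0 ev et cmulDl !cmulDr !trD (peirce_tr0 char2 X0P X1P) (peirce_tr0 char2
    Y0P Y1P).
  by rewrite add0r addr0.
have d2 : tr (cmul X0 Y1) - tr (cmul Y0 X1) = 0.
  rewrite -wvt0 ewv et cmulDl !cmulDr !(bNmul cbl) !trD !trN.
  by rewrite (peirce_tr0 char2 X0P X1P) (peirce_tr0 char2 Y0P Y1P) oppr0 add0r addr0.
have X0Y1 : tr (cmul X0 Y1) = 0.
  have := congr2 +%R d1 d2; rewrite addrACA subrr !addr0 -mulr2n -mulr_natl => /eqP.
  by rewrite mulf_eq0 (negPf n2) => /eqP.
have X1Y0 : tr (cmul X1 Y0) = 0 by rewrite tr_mulC; move: d1; rewrite X0Y1 add0r.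
pose X2 := cmul Y0 Y1.
have X2P : peirce w X2 by apply/peirceNN; apply: peirceM.
have c1 : cmul X1 X2 = Y0.
  have := left_alt X1 Y0 Y1.
  rewrite (skew_anti (peirce_tr char2 X1P) (peirce_tr char2 Y0P)) X1Y0 scale0r (b0mul
    cbl).
  rewrite (peirce_mulN char2 w0 ww X1P Y1P) XY1 scaleN1r (bmulN cbl) => /eqP.
  have [_ _ _] := peirce_idem char2 Y0P; rewrite opprK => ->.
  by rewrite subr_eq0 => /eqP.
have c2 : cmul X2 X0 = Y1.
  rewrite (peirce_anti char2 X2P X0P); have := left_alt X0 Y0 Y1.
  rewrite (skew_anti (peirce_tr char2 X0P) (peirce_tr char2 Y0P)) XY0 scaleN1r (bNmul
    cbl) cmul1.
  rewrite (peirce_mulN char2 w0 ww X0P Y1P) X0Y1 scale0r (bmul0 cbl) addr0 => ->.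
  by rewrite opprK.
pose X (i : 'Z_3) := if i == 0 then X0 else if i == 1 then X1 else X2.
have XP i : peirce w (X i) by elim/Z3_cases: i.
have X012 : tr (cmul (cmul (X 0) (X 1)) (X 2%:R)) = -1.
  by rewrite -[LHS]/(tr (cmul (cmul X0 X1) X2)) tr_mulA c1.
have [f [bf fM fe fu fv]] := canonical_basis char2 w0 ww XP X012.
exists f; split=> // -[[j1 j2] j3].
have f1 : f C1 = C1 by rewrite /cone linearD /= !fe (idemD char2).
have fw : f (ce F false - ce F true) = w by rewrite linearB /= !fe (idemB char2).
have fv' : f (cu F 0 + cv F 0) = v.
  by rewrite linearD /= fu fv -[cmul _ _]/(cmul X1 X2) c1 ev.
have ft : f (cu F 1 + cv F 1) = t.
  by rewrite linearD /= fu fv -[cmul _ _]/(cmul X2 X0) c2 et.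
rewrite /uvw_base /deg2 /= !fM; apply: gA.2; first apply: gA.2.
- by case: j1; rewrite ?fw ?f1 ?(cone_hom gA).
- by case: j2; rewrite ?fv' ?f1 ?(cone_hom gA).
- by case: j3; rewrite ?ft ?f1 ?(cone_hom gA).
Qed.

End Classification2.

(** * Invariants of the gradings on the tensor square *)

Section TensorGradingSkew.
Variable F : fieldType.
Hypothesis char2 : 2%N \notin [pchar F].
Variables (G : zmodType).
Implicit Types (x y : cayley F).
Local Notation C1 := (cone F).

Section One.
Variables (h : G) (chi : G -> F) (A : quot_cyc h -> {vspace cayley F}).
Hypotheses (oh : order2 h) (chiP : is_character chi) (chih : chi h = -1)
  (gA : is_grading (@cmul F) A).
Let dA : direct_decomposition fullv A := gA.1.
Local Notation pi := (\pi_(quot_cyc h)%qT).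
Local Notation T := (tensor_grading chi A).

Lemma tensor_grading_grading : is_grading (@tmul F) T.
Proof. by have [] := tensor_gradingP char2 oh chiP chih gA. Qed.

Lemma mem_tensor_grading g x : tr x = 0 -> x \in A (pi g) -> emb x (chi g *: x) \in T g.
Proof. by have [_] := tensor_gradingP char2 oh chiP chih gA; apply. Qed.

(** The elements [emb x (chi g *: x)] known to have degree g already span [tskew]: for u homogeneous
    in C, both [emb u 0] and [emb 0 u] are combinations of two of them, in the two degrees lifting
    that of u. So they exhaust the skew elements of each degree. *)
Lemma tensor_grading_skew g z : z \in T g -> z \in tskew F ->
  exists x, [/\ tr x = 0, x \in A (pi g) & z = emb x (chi g *: x)].
Proof.
have n2 := neq2 char2.
have dT := tensor_grading_grading.1; have [nz chiM] := chiP.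
move=> zT zS; rewrite -(hcomp_id dT zT); move: g {zT}.
pose E z := forall g, exists x, [/\ tr x = 0,
  x \in A (pi g) & hcomp T g z = emb x (chi g *: x)].
rewrite -/(E z).
have ED z1 z2 : E z1 -> E z2 -> E (z1 + z2).
  move=> E1 E2 g; have [x1 [t1 A1 e1]] := E1 g; have [x2 [t2 A2 e2]] := E2 g.
  exists (x1 + x2); split; [by rewrite trD t1 t2 addr0|exact: memvD|].
  by rewrite linearD /= e1 e2 -embD scalerDr.
have Eh k x : tr x = 0 -> x \in A (pi k) -> E (emb x (chi k *: x)).
  move=> x0 xA g; have mk := mem_tensor_grading x0 xA.
  have [<-|kg] := eqVneq k g; first by exists x; rewrite (hcomp_id dT mk).
  exists 0; rewrite tr0 mem0v (hcomp_ne dT mk kg) scaler0; split=> //.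
  by rewrite /emb tens0 t0ens addr0.
have [x [y [x0 y0 ->]]] := (tskewE z).1 zS.
have hx q u : tr u = 0 -> u \in A q -> E (emb u 0) /\ E (emb 0 u).
  move=> u0 uA; have eq1 : pi (repr q) = q by apply: reprK.
  have eq2 : pi (repr q + h) = q by rewrite -eq1; apply/(pi_eqP oh); right; rewrite eq1.
  set k := repr q in eq1 eq2; split.
    have -> : emb u 0 = emb (2%:R^-1 *: u) (chi k *: (2%:R^-1 *: u)) +
        emb (2%:R^-1 *: u) (chi (k + h) *: (2%:R^-1 *: u)).
      rewrite -embD -scalerDr -mulr2n -scaler_nat scalerA mulVf // scale1r; congr emb.
      by rewrite (character_addh chiP chih) scaleNr subrr.
    by apply: (ED _ _); apply: (Eh _ _); rewrite ?trZ ?u0 ?mulr0 ?memvZ ?eq1 ?eq2.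
  (* As chi(k + h) = - chi(k), opposite multiples of u cancel in the first factor and add in the
     second. *)
  have -> : emb 0 u = emb ((2%:R * chi k)^-1 *: u) (chi k *: ((2%:R * chi k)^-1 *: u)) +
      emb (- (2%:R * chi k)^-1 *: u) (chi (k + h) *: (- (2%:R * chi k)^-1 *: u)).
    rewrite -embD -scalerDl subrr scale0r (character_addh chiP chih) !scalerA -scalerDl.
    congr emb; rewrite -[LHS]scale1r; congr (_ *: _); have := nz k; move=> nk; field.
    by rewrite n2 nk.
  by apply: (ED _ _); apply: (Eh _ _); rewrite ?trZ ?u0 ?mulr0 ?memvZ ?eq1 ?eq2.
have E0 : E 0.
  by move=> g; exists 0; rewrite tr0 mem0v linear0 scaler0 /emb tens0 t0ens addr0.
have -> : emb x y = emb x 0 + emb 0 y by rewrite -embD addr0 add0r.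
have [s _ sP] := hcomp_sum dA.
have e0D u v : emb (u + v) 0 = emb u 0 + emb v 0 :> cayley2 F by rewrite -embD addr0.
have e1D u v : emb 0 (u + v) = emb 0 u + emb 0 v :> cayley2 F by rewrite -embD addr0.
have e0 : emb 0 0 = 0 :> cayley2 F by rewrite /emb tens0 t0ens addr0.
apply: (ED _ _).
  rewrite (sP x) (big_morph (fun u => emb u 0) e0D e0).
  apply: big_ind => // q _.
  by case: (hx q (hcomp A q x)); rewrite ?(tr_hcomp char2 gA) ?hcomp_mem.
rewrite (sP y) (big_morph (fun u => emb 0 u) e1D e0).
apply: big_ind => // q _.
by case: (hx q (hcomp A q y)); rewrite ?(tr_hcomp char2 gA) ?hcomp_mem.
Qed.

Lemma tensor_grading_theta g z : z \in T g -> z \in tskew F -> theta z \in T (g + h).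
Proof.
move=> zT zS; have [x [x0 xA ->]] := tensor_grading_skew zT zS.
rewrite (theta_emb char2) ?trZ ?x0 ?mulr0 //.
rewrite -scaleNr -(character_addh chiP chih); apply: mem_tensor_grading => //.
by have -> : pi (g + h) = pi g by apply/(pi_eqP oh); right.
Qed.

End One.

Lemma aut_inverse (V : vectType F) (mul : V -> V -> V) (f : 'End(V)) :
  bijective f -> {morph f : x y / mul x y} ->
  [/\ cancel f (f^-1)%VF, cancel (f^-1)%VF f, bijective (f^-1)%VF &
      {morph (f^-1)%VF : x y / mul x y}].
Proof.
move=> bf fM.
have k0 : lker f == 0%VS by apply/lker0P/bij_inj.
have fK := lker0_lfunK k0; have f'K := lker0_lfunVK k0.
split=> //; first by exists f.
by move=> x y; apply: (bij_inj bf); rewrite f'K fM !f'K.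
Qed.

Lemma morph_tr (f : 'End(cayley F)) x : {morph f : x y / cmul x y} ->
  tr x = 0 -> tr (f x) = 0.
Proof.
move=> fM /(skew_commutators char2)[a [b [c [d ->]]]].
rewrite linearD /= trD /commutator !linearB /= !fM.
by rewrite -!/(commutator _ _ _) !tr_commutator addr0.
Qed.

(** [psi] identifies the first factor with the second and [eta] moves the grading [B] read off [Gam]
    to [A]. The isomorphism is eta (x) (eta psi^-1), which sends [emb x (chi g *: psi x)] to
    [emb (eta x) (chi g *: eta x)]. *)
Lemma graded_iso_tensor_grading (h : G) (chi : G -> F)
    (A B : quot_cyc h -> {vspace cayley F}) (Gam : G -> {vspace cayley2 F})
    (psi eta : 'End(cayley F)) :
  order2 h -> is_character chi -> chi h = -1 -> is_grading (@cmul F) A ->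
  is_grading (@tmul F) Gam ->
  bijective psi -> {morph psi : x y / cmul x y} ->
  bijective eta -> {morph eta : x y / cmul x y} ->
  (forall q x, x \in B q -> eta x \in A q) ->
  (forall g z, z \in Gam g -> z \in tskew F -> exists x,
     [/\ tr x = 0, x \in B (\pi_(quot_cyc h)%qT g) & z = emb x (chi g *: psi x)]) ->
  graded_iso (@tmul F) Gam (tensor_grading chi A).
Proof.
move=> oh chiP chih gA gG bpsi psiM beta etaM BA SP.
have [psiK psi'K bpsi' psi'M] := aut_inverse bpsi psiM.
have [etaK eta'K beta' eta'M] := aut_inverse beta etaM.
have [f fP] := tens_map eta (eta \o psi^-1)%VF false.
have [f' f'P] := tens_map (eta^-1)%VF (psi \o eta^-1)%VF false.
have [Dl Dr _ _] := @tmul_bilinear F.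
have fM : {morph f : z t / tmul z t}.
  move=> z t; elim/tens_ind: z t => [z z' ez ez' t|x y];
    first by rewrite Dl !linearD /= Dl ez ez'.
  elim/tens_ind => [z z' ez ez'|x' y']; first by rewrite Dr !linearD /= Dr ez ez'.
  by rewrite tmul_tens !fP tmul_tens etaM !comp_lfunE psi'M etaM.
have bf : bijective f.
  exists f'; elim/tens_ind => [z z' ez ez'|x y].
  - by rewrite !linearD /= ez ez'.
  - by rewrite fP f'P !comp_lfunE etaK /= etaK psi'K.
  - by rewrite !linearD /= ez ez'.
  - by rewrite f'P fP !comp_lfunE eta'K /= psiK eta'K.
exists f; split=> // g.
apply: (tskew_grading_unique char2 (A := fun g => (f @: Gam g)%VS)).
- exact: push_grading.
- exact: tensor_grading_grading.
move=> {}g _ /memv_imgP[z zG ->] fzS.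
have zS : z \in tskew F.
  have [fK _ bf' f'M] := aut_inverse bf fM.
  by rewrite -(fK z); apply: tskew_aut.
have [x [x0 xB ->]] := SP g z zG zS.
have -> : f (emb x (chi g *: psi x)) = emb (eta x) (chi g *: eta x).
  have e1 (k : 'End(cayley F)) : bijective k -> {morph k : x y / cmul x y} -> k C1 = C1.
    move=> [k' kK k'K] kM; have := kM C1 (k' C1); rewrite cmul1 k'K cmulx1.
    by [].
  rewrite /emb linearD /= !fP !comp_lfunE /= linearZ /= psiK linearZ /=.
  by rewrite !e1.
apply: mem_tensor_grading => //; last exact: BA.
exact: morph_tr.
Qed.

(* The degree of theta is an invariant, since f theta f^-1 = theta or - theta. *)
Lemma graded_iso_degree (h h' : G) (chi chi' : G -> F)
    (A : quot_cyc h -> {vspace cayley F}) (A' : quot_cyc h' -> {vspace cayley F}) :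
  order2 h -> is_character chi -> chi h = -1 -> is_grading (@cmul F) A ->
  order2 h' -> is_character chi' -> chi' h' = -1 -> is_grading (@cmul F) A' ->
  graded_iso (@tmul F) (tensor_grading chi A) (tensor_grading chi' A') -> h = h'.
Proof.
move=> oh chiP chih gA oh' chiP' chih' gA' [f [bf fM fT]].
have [fK f'K bf' f'M] := aut_inverse bf fM.
have n2 := neq2 char2.
have fS z : z \in tskew F -> f z \in tskew F by apply: tskew_aut.
have f'S z : z \in tskew F -> (f^-1)%VF z \in tskew F by apply: tskew_aut.
pose Th := (f \o linfun (@theta F) \o f^-1)%VF.
have ThE z : Th z = f (theta ((f^-1)%VF z)).
  by rewrite /Th !comp_lfunE /= (linfunE (@theta_linear F)).
have [||a [b ab]] := centroidP char2 (T := Th).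
- by move=> z zS; rewrite ThE fS // theta_tskew // f'S.
- move=> z t zS tS; rewrite !ThE.
  have cM u v : (f^-1)%VF (commutator (@tmul F) u v) = commutator (@tmul F) ((f^-1)%VF
    u) ((f^-1)%VF v).
    by rewrite /commutator linearB /= !f'M.
  rewrite cM theta_commutator ?f'S // /commutator linearB /= !fM f'K.
  by [].
have gT := tensor_grading_grading oh chiP chih gA.
have gT' := tensor_grading_grading oh' chiP' chih' gA'.
have [g [z [zT zS zn]]] := tskew_neq0 char2 gT.
have wT' : f z \in tensor_grading chi' A' g by rewrite -fT memv_img.
have thT' := tensor_grading_theta oh' chiP' chih' gA' wT' (fS _ zS).
have thT := tensor_grading_theta oh chiP chih gA zT zS.
have fthT : f (theta z) \in tensor_grading chi' A' (g + h) by rewrite -fT memv_img.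
have e1 : f (theta z) = a *: f z + b *: theta (f z) by rewrite -ab ?fS // ThE fK.
have dT' := gT'.1.
have fzn : f z != 0 by apply: contraNneq zn => e; apply/eqP/(bij_inj bf);
  rewrite e linear0.
have hk : g + h != g by rewrite -subr_eq0 addrAC subrr add0r oh.1.
have hk' : g + h' != g by rewrite -subr_eq0 addrAC subrr add0r oh'.1.
(* In [e1] the left side has degree g + h, and the right side has terms of degrees g and g + h'. If
   h != h', it would vanish, whereas [theta z] does not. *)
apply/eqP; apply: contraT => hh'.
have ne : g + h' != g + h by rewrite (inj_eq (addrI g)) eq_sym.
have := congr1 (hcomp (tensor_grading chi' A') (g + h)) e1.
rewrite (hcomp_id dT' fthT) [RHS]linearD !linearZ /= (hcomp_ne dT' wT') 1?eq_sym //.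
rewrite (hcomp_ne dT' thT' ne) !scaler0 addr0 => /eqP.
rewrite -(inj_eq (bij_inj bf')) fK linear0 => /eqP th0.
by move: zn; rewrite -(thetaK char2 zS) th0 theta0 eqxx.
Qed.

Lemma graded_iso_sym (V : vectType F) (mul : V -> V -> V) (A B : G -> {vspace V}) :
  graded_iso mul A B -> graded_iso mul B A.
Proof.
move=> [f [bf fM fT]]; have [fK f'K bf' f'M] := aut_inverse bf fM.
exists (f^-1)%VF; split=> // g; rewrite -fT -limg_comp.
have -> : (f^-1 \o f)%VF = \1%VF by apply/lfunP => x; rewrite comp_lfunE fK id_lfunE.
by rewrite lim1g.
Qed.

(** For a lift g of q, f sends [emb x (chi g *: x)] to a skew element of degree g, hence to
    [emb x' (chi' g *: x')]. The map from x to x' is linear and injective. *)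
Lemma graded_iso_dim_le (h : G) (chi chi' : G -> F) (A A' :
  quot_cyc h -> {vspace cayley F}) q :
  order2 h -> is_character chi -> chi h = -1 -> is_grading (@cmul F) A ->
  is_character chi' -> chi' h = -1 -> is_grading (@cmul F) A' ->
  graded_iso (@tmul F) (tensor_grading chi A) (tensor_grading chi' A') ->
  (\dim (A q :&: cskew F) <= \dim (A' q :&: cskew F))%N.
Proof.
move=> oh chiP chih gA chiP' chih' gA' [f [bf fM fT]].
pose g := repr q; have eg : \pi_(quot_cyc h)%qT g = q by apply: reprK.
pose p0 x := pr1 (f (emb x (chi g *: x))).
have lin : linear p0.
  move=> a x y; rewrite /p0.
  have -> : chi g *: (a *: x + y) = a *: (chi g *: x) + chi g *: y.
    by rewrite scalerDr !scalerA mulrC.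
  by rewrite embD embZ linearD linearZ /= /pr1 contrD contrZ.
have pP x : x \in (A q :&: cskew F)%VS -> exists x',
    [/\ tr x' = 0, x' \in A' q & f (emb x (chi g *: x)) = emb x' (chi' g *: x')].
  rewrite memv_cap => /andP[xA /cskewP x0].
  have xT : emb x (chi g *: x) \in tensor_grading chi A g by apply: mem_tensor_grading;
    rewrite // eg.
  have fxS : f (emb x (chi g *: x)) \in tskew F.
    by apply: tskew_aut => //; apply: emb_skew; rewrite ?trZ ?x0 ?mulr0.
  have fxT : f (emb x (chi g *: x)) \in tensor_grading chi' A' g by rewrite -fT memv_img.
  have [x' [t' A'x e]] := tensor_grading_skew oh chiP' chih' gA' fxT fxS.
  by exists x'; rewrite -eg.
have pE x x' : tr x' = 0 -> f (emb x (chi g *: x)) = emb x' (chi' g *: x') -> linfun p0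
  x = x'.
  by move=> t0 e; rewrite (linfunE lin) /p0 e pr1_emb // trZ t0 mulr0.
have ker : (A q :&: cskew F :&: lker (linfun p0) = 0)%VS.
  apply/eqP; rewrite -subv0; apply/subvP => x; rewrite memv_cap => /andP[xA].
  have [x' [t0 _ e]] := pP x xA; rewrite memv_ker (pE _ _ t0 e) => /eqP x'0.
  move: e; rewrite x'0 scaler0 memv0 /emb !tens0 !t0ens addr0 => /eqP.
  rewrite -(linear0 f) (inj_eq (bij_inj bf)) => /eqP e0.
  have x0 : tr x = 0 by move: xA; rewrite memv_cap => /andP[_ /cskewP].
  have : emb x (chi g *: x) = emb 0 0 by rewrite /emb [LHS]e0 tens0 t0ens addr0.
  case/(emb_inj char2); rewrite ?tr0 ?trZ ?x0 ?mulr0 //.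
  by move=> ->.
rewrite -(limg_dim_eq ker); apply: dimvS; apply/subvP => _ /memv_imgP[x xA ->].
have [x' [t0 A'x e]] := pP x xA; rewrite (pE _ _ t0 e) memv_cap A'x.
exact/cskewP.
Qed.

Lemma graded_iso_dim (h : G) (chi chi' : G -> F) (A A' :
  quot_cyc h -> {vspace cayley F}) q :
  order2 h -> is_character chi -> chi h = -1 -> is_grading (@cmul F) A ->
  is_character chi' -> chi' h = -1 -> is_grading (@cmul F) A' ->
  graded_iso (@tmul F) (tensor_grading chi A) (tensor_grading chi' A') ->
  \dim (A q :&: cskew F) = \dim (A' q :&: cskew F).
Proof.
move=> oh chiP chih gA chiP' chih' gA' iso; apply/eqP; rewrite eqn_leq.
rewrite (graded_iso_dim_le _ oh chiP chih gA chiP' chih' gA' iso).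
exact: (graded_iso_dim_le _ oh chiP' chih' gA' chiP chih gA (graded_iso_sym iso)).
Qed.

End TensorGradingSkew.

(** * The two families of gradings *)

Section BasisGrading.
Variables (F : fieldType) (V : vectType F) (mul : V -> V -> V) (G : zmodType).
Variables (J : finType) (b : J -> V) (deg : J -> G) (c : J -> V -> F).
Hypotheses (bl : bilinear_mul mul)
  (cD : forall j x y, c j (x + y) = c j x + c j y)
  (cb : forall j k, c j (b k) = (j == k)%:R)
  (cZ : forall j a x, c j (a *: x) = a * c j x)
  (bc : forall x, x = \sum_j c j x *: b j).
Local Notation B := (basis_grading b deg).

Lemma mem_basis_grading j : b j \in B (deg j).
Proof.
by rewrite /basis_grading (bigD1 j) ?eqxx //=; apply: (subvP (addvSl _ _));
  apply: memv_line.
Qed.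

Lemma basis_grading_dd : direct_decomposition fullv B.
Proof.
apply: (@direct_decompositionI _ _ _ _ _ (fun g x => \sum_(j | deg j == g) c j x *: b j)).
- by move=> g; apply: subvf.
- move=> x _; exists [seq deg j | j <- enum J]; rewrite (bc x).
  apply: memv_suml => j _; apply: memvZ.
  by apply: (memv_sum_seq _ (mem_basis_grading j)); apply: map_f; rewrite mem_enum.
- move=> g x y; rewrite -big_split; apply: eq_bigr => j _.
  by rewrite cD scalerDl.
- move=> g x /memv_sumP[u uP ->].
  have c0 j : c j 0 = 0 by rewrite -(scale0r 0) cZ mul0r.
  apply: eq_bigr => j jg; have /vlineP[k ek] := uP j jg.
  rewrite (bigD1 j) //= cD ek cZ cb eqxx mulr1 (big_morph (c j) (cD j) (c0 j)) big1
    ?addr0 //.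
  move=> i /andP[ig ij]; have /vlineP[l ->] := uP i ig.
  by rewrite cZ cb eq_sym (negPf ij) mulr0.
move=> g k x /memv_sumP[u uP ->] kg; rewrite big1 // => j jg.
have c0 : c j 0 = 0 by rewrite -(scale0r 0) cZ mul0r.
rewrite (big_morph (c j) (cD j) c0) big1 ?scale0r // => i ik.
have /vlineP[l ->] := uP i ik; rewrite cZ cb.
case: eqP => [e|_]; last by rewrite mulr0.
by move: kg; rewrite -(eqP ik) -e (eqP jg) eqxx.
Qed.

Lemma basis_grading_grading :
  (forall j k, mul (b j) (b k) \in B (deg j + deg k)) -> is_grading mul B.
Proof.
move=> bM; split; first exact: basis_grading_dd.
have [Dl Dr Zl Zr] := bl.
move=> g k _ _ /memv_sumP[u uP ->] /memv_sumP[v vP ->].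
rewrite (big_morph (fun w => mul w _) (fun x y => Dl x y _) (b0mul bl _)).
apply: memv_suml => i /eqP ig; have /vlineP[l ->] := uP i (introT eqP ig).
rewrite (big_morph (mul _) (Dr _) (bmul0 bl _)).
apply: memv_suml => j /eqP jk; have /vlineP[m ->] := vP j (introT eqP jk).
by rewrite Zl Zr !memvZ // -ig -jk.
Qed.

Lemma basis_grading_dim g : \dim (B g) = #|[pred j | deg j == g]|.
Proof.
have dir : directv (\sum_(j | deg j == g) <[b j]>).
  apply/directv_sum_independent => u uP u0 j jg; have /vlineP[k ek] := uP j jg.
  have c0 i : c i 0 = 0 by rewrite -(scale0r 0) cZ mul0r.
  have := congr1 (c j) u0; rewrite c0 (big_morph (c j) (cD j) (c0 j)) (bigD1 j) //=.
  rewrite ek cZ cb eqxx mulr1 big1 ?addr0; first by move=> ->; rewrite scale0r.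
  move=> i /andP[ig ij]; have /vlineP[l ->] := uP i ig.
  by rewrite cZ cb eq_sym (negPf ij) mulr0.
rewrite (directvP dir) /= -sum1_card; apply: eq_bigr => j _.
rewrite dim_vline; suff -> : b j != 0 by [].
apply/eqP => bj0; have := cb j j; rewrite bj0 -(scale0r 0) cZ mul0r eqxx => /esym/eqP.
by rewrite oner_eq0.
Qed.

End BasisGrading.

(** * The two model gradings of C and their dimensions *)

Section CayleyBasisGradings.
Variables (F : fieldType) (G : zmodType).
Hypothesis char2 : 2%N \notin [pchar F].
Local Notation C1 := (cone F).
Let cbl := @cmul_bilinear F.

Let coord (j : cayley_idx) (x : cayley F) : F := x j.

Lemma cbase_coord :
  [/\ forall j x y, coord j (x + y) = coord j x + coord j y,
      forall j k, coord j (cbase F k) = (j == k)%:R,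
      forall j a x, coord j (a *: x) = a * coord j x
    & forall x, x = \sum_j coord j x *: cbase F j].
Proof.
split=> *; rewrite /coord ?ffunE // 1?eq_sym //.
exact: cbase_sum.
Qed.

Lemma Gamma1_grading (gamma : 'Z_3 -> G) : \sum_i gamma i = 0 ->
  is_grading (@cmul F) (Gamma1_C F gamma).
Proof.
move=> gs; have [cD cb cZ bc] := cbase_coord.
apply: (basis_grading_grading cbl cD cb cZ bc) => p q.
have mem r g : deg1 gamma r = g -> cbase F r \in Gamma1_C F gamma g.
  by move=> <-; apply: mem_basis_grading.
have g3 i : gamma i + gamma (i + 1) = - gamma (i + 2%:R).
  apply/eqP; rewrite -addr_eq0; apply/eqP; move: gs; rewrite big_Z3 => <-.
  elim/Z3_cases: i.
  - by congr (gamma _ + gamma _ + gamma _); apply: val_inj.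
  - rewrite -[RHS]addrA [RHS]addrC.
    by congr (gamma _ + gamma _ + gamma _); apply: val_inj.
  - by rewrite [RHS]addrC [RHS]addrA; congr (gamma _ + gamma _ + gamma _); apply: val_inj.
have cm : cmul (cbase F p) (cbase F q) = cbase_mul F p q.
  rewrite /cmul (bigD1 p) //= (bigD1 q) //= !ffunE !eqxx mul1r scale1r.
  rewrite !big1 ?addr0 // => [i ip|i iq].
    by rewrite big1 // => j _; rewrite !ffunE eq_sym (negPf ip) mul0r scale0r.
  by rewrite !ffunE (eq_sym q) (negPf iq) mulr0 scale0r.
rewrite cm; case: p q {cm} => [b1|[b1 i]] [b2|[b2 j]] /=.
- by case: ifP => _; rewrite ?mem0v //; apply: mem; rewrite /= addr0.
- by case: ifP => _; rewrite ?mem0v //; apply: mem; rewrite /= add0r.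
- by case: ifP => _; rewrite ?mem0v //; apply: mem; rewrite /= addr0.
case: eqP => [<-|/eqP b12].
  case: eqP => [->|_].
    by apply: mem => /=; case: b1; rewrite /= -1?opprD g3 ?opprK.
  case: eqP => [->|_]; rewrite ?mem0v // memvN.
  by apply: mem => /=; rewrite [RHS]addrC; case: b1; rewrite /= -1?opprD g3 ?opprK.
case: eqP => [->|_]; rewrite ?mem0v // memvN; apply: mem => /=.
by case: b1 b2 b12 => -[] //= _; rewrite ?addNr ?subrr.
Qed.

Lemma Gamma1_dim (gamma : 'Z_3 -> G) g :
  \dim (Gamma1_C F gamma g) = #|[pred p | deg1 gamma p == g]|.
Proof.
have [cD cb cZ bc] := cbase_coord.
exact: (basis_grading_dim _ cD cb cZ).
Qed.

(** The coordinates dual to [uvw_base]. The last sign is reversed because (u v) w = v_3 - u_3. *)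
Let uvw_coord (j : bool * bool * bool) (x : cayley F) : F :=
  match j with
  | (false, false, false) => x (inl false) + x (inl true)
  | (true, false, false) => x (inl false) - x (inl true)
  | (false, true, false) => x (inr (false, 0)) + x (inr (true, 0))
  | (true, true, false) => x (inr (false, 0)) - x (inr (true, 0))
  | (false, false, true) => x (inr (false, 1)) + x (inr (true, 1))
  | (true, false, true) => x (inr (false, 1)) - x (inr (true, 1))
  | (false, true, true) => x (inr (false, 2%:R)) + x (inr (true, 2%:R))
  | (true, true, true) => x (inr (true, 2%:R)) - x (inr (false, 2%:R))
  end / 2%:R.

Lemma uvw_oct j : uvw_base F j = match j with
  | (false, false, false) => oct 1 1 0 0 0 0 0 0
  | (true, false, false) => oct 1 (-1) 0 0 0 0 0 0
  | (false, true, false) => oct 0 0 1 0 0 1 0 0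
  | (true, true, false) => oct 0 0 1 0 0 (-1) 0 0
  | (false, false, true) => oct 0 0 0 1 0 0 1 0
  | (true, false, true) => oct 0 0 0 1 0 0 (-1) 0
  | (false, true, true) => oct 0 0 0 0 1 0 0 1
  | (true, true, true) => oct 0 0 0 0 (-1) 0 0 1
  end.
Proof.
by case: j => -[[] []] []; rewrite /uvw_base /=; oct_ring.
Qed.

Lemma uvw_coordP :
  [/\ forall j x y, uvw_coord j (x + y) = uvw_coord j x + uvw_coord j y,
      forall j k, uvw_coord j (uvw_base F k) = (j == k)%:R,
      forall j a x, uvw_coord j (a *: x) = a * uvw_coord j x
    & forall x, x = \sum_j uvw_coord j x *: uvw_base F j].
Proof.
have n2 := neq2 char2.
split.
- by move=> [[[] []] []] x y; rewrite /uvw_coord !ffunE /=; field.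
- move=> [[[] []] []] [[[] []] []]; rewrite uvw_oct /uvw_coord !ffunE /=; by field.
- by move=> [[[] []] []] a x; rewrite /uvw_coord !ffunE /GRing.scale /=; field.
move=> x; rewrite (eq_bigr (fun j => uvw_coord (j.1.1, j.1.2,
  j.2) x *: uvw_base F (j.1.1, j.1.2, j.2))); last by case=> -[].
rewrite -(pair_bigA _ (fun j k => uvw_coord (j.1, j.2, k) x *: uvw_base F (j.1, j.2,
  k))) /=.
rewrite -(pair_bigA _ (fun i j => \sum_k uvw_coord (i, j, k) x *: uvw_base F (i, j,
  k))) /=.
rewrite !big_bool !uvw_oct /uvw_coord.
elim/oct_ind: x => a b u0 u1 u2 v0 v1 v2; rewrite !ffunE /= !octZ !octD.
by congr (oct _ _ _ _ _ _ _ _); field.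
Qed.

(** C as a twisted group algebra of (Z/2)^3, with [s] equal to 1 or -1. *)
Lemma uvw_mul j k : exists s, cmul (uvw_base F j) (uvw_base F k) =
  s *: uvw_base F (addb j.1.1 k.1.1, addb j.1.2 k.1.2, addb j.2 k.2).
Proof.
case: j k => -[[] []] [] [[[] []] []] /=; rewrite !uvw_oct;
  first [by exists 1; oct_ring | by exists (-1); oct_ring].
Qed.

Lemma Gamma2_grading (a b c : G) : a *+ 2 = 0 -> b *+ 2 = 0 -> c *+ 2 = 0 ->
  is_grading (@cmul F) (Gamma2_C F a b c).
Proof.
move=> a2 b2 c2; have [cD cb cZ bc] := uvw_coordP.
apply: (basis_grading_grading cbl cD cb cZ bc) => j k.
have [s ->] := uvw_mul j k; apply: memvZ.
rewrite (_ : deg2 a b c j + deg2 a b c k =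
  deg2 a b c (addb j.1.1 k.1.1, addb j.1.2 k.1.2, addb j.2 k.2)).
  exact: mem_basis_grading.
have addb2 (d : G) (p q : bool) : d *+ 2 = 0 -> d *+ p + d *+ q = d *+ (p (+) q).
  by move=> d2; case: p q => -[]; rewrite ?mulr0n ?mulr1n ?addr0 ?add0r // -mulr2n.
by rewrite /deg2 /= addrACA addb2 // addrACA addb2 // addb2.
Qed.

Lemma Gamma2_dim (a b c : G) g :
  \dim (Gamma2_C F a b c g) = #|[pred j | deg2 a b c j == g]|.
Proof.
have [cD cb cZ bc] := uvw_coordP.
exact: (basis_grading_dim _ cD cb cZ).
Qed.

Lemma uvw_neq0 j : uvw_base F j != 0.
Proof.
have [cD cb cZ bc] := uvw_coordP.
apply/eqP => bj0; have := cb j j; rewrite bj0 -(scale0r 0) cZ mul0r eqxx => /esym/eqP.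
by rewrite oner_eq0.
Qed.

Lemma uvw000 : uvw_base F (false, false, false) = C1.
Proof. by rewrite uvw_oct cone_oct. Qed.

End CayleyBasisGradings.

(** * Subgroups isomorphic to (Z/2)^3 and their generators *)

Section ElementaryAbelian.
Variable K : zmodType.
Implicit Types (a b c : K) (H : set K).

Lemma mulrb_odd a (n : nat) : a *+ 2 = 0 -> a *+ n = a *+ odd n.
Proof.
move=> a2; rewrite -{1}(odd_double_half n) mulrnDr -mul2n mulrnA a2.
by rewrite mul0rn addr0.
Qed.

Lemma mulrz_bool a (n : int) : a *+ 2 = 0 -> exists e : bool, a *~ n = a *+ e.
Proof.
move=> a2; have aN : - a = a by apply/eqP; rewrite eq_sym -addr_eq0 -mulr2n a2.
case: n => n; first by exists (odd n); rewrite -pmulrn mulrb_odd.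
exists (odd n.+1); rewrite NegzE mulrNz -pmulrn mulrb_odd //.
by case: (odd n.+1); rewrite ?mulr1n ?aN // mulr0n oppr0.
Qed.

Lemma generated3_deg2 H a b c : a *+ 2 = 0 -> b *+ 2 = 0 -> c *+ 2 = 0 ->
  generated3 H a b c -> forall x, H x <-> exists j, x = deg2 a b c j.
Proof.
move=> a2 b2 c2 -> x; split=> [[i [j [k ->]]]|[[[i j] k] ->]].
  have [e1 ->] := mulrz_bool i a2; have [e2 ->] := mulrz_bool j b2.
  by have [e3 ->] := mulrz_bool k c2; exists (e1, e2, e3).
by exists (i : nat), (j : nat), (k : nat); rewrite /deg2 /= -!pmulrn.
Qed.

Lemma generated3_order2 H a b c : elem_abelian8 H -> generated3 H a b c ->
  [/\ a *+ 2 = 0, b *+ 2 = 0 & c *+ 2 = 0].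
Proof.
case=> f [_ Hf] gen.
have H2 x : H x -> x *+ 2 = 0.
  rewrite Hf => -[v _ <-]; rewrite -raddfMn.
  suff -> : v *+ 2 = 0 by rewrite raddf0.
  by apply/matrixP => i j; rewrite mulmxnE mxE; apply/val_inj; case: (v i j) => -[|[|]].
by split; apply: H2; rewrite gen; [exists 1, 0, 0|exists 0, 1, 0|exists 0, 0, 1];
  rewrite ?mulr1z ?mulr0z ?addr0 ?add0r.
Qed.

(** [deg2 a b c] maps eight indices onto a group with eight elements. *)
Lemma generated3_inj H a b c : elem_abelian8 H -> generated3 H a b c ->
  injective (deg2 a b c).
Proof.
move=> eH gen; have [a2 b2 c2] := generated3_order2 eH gen.
have HP := generated3_deg2 a2 b2 c2 gen; case: eH => f [fi Hf].
have /boolp.choice[s sP] : forall v : 'rV['Z_2]_3, exists j, f v = deg2 a b c j.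
  by move=> v; apply/HP; rewrite Hf; exists v.
have si : injective s by move=> u v e; apply: fi; rewrite !sP e.
have [s' sK s'K] : bijective s.
  apply: inj_card_bij => //.
  by rewrite card_mx !card_prod !card_bool card_ord.
move=> j k e; rewrite -(s'K j) -(s'K k); congr s; apply: fi.
by rewrite !sP !s'K.
Qed.

(** The three conditions on a, b, c exclude exactly the seven nontrivial relations modulo 2. *)
Lemma generated3_elem_abelian8 a b c : a *+ 2 = 0 -> b *+ 2 = 0 -> c *+ 2 = 0 ->
  a != 0 -> b \notin [:: 0; a] -> c \notin [:: 0; a; b; a + b] ->
  exists H : set K, elem_abelian8 H /\ generated3 H a b c.
Proof.
move=> a2 b2 c2 a0; rewrite !inE !negb_or => /andP[b0 ba] /and4P[c0 ca cb cab].
pose g (v : 'rV['Z_2]_3) := a *+ (v 0 0 : nat) + b *+ (v 0 1 : nat) + c *+ (v 0 2%:R :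
  nat).
have gD : zmod_morphism g.
  have mB (d : K) (p q : 'Z_2) : d *+ 2 = 0 -> d *+ (p - q : 'Z_2)%R = d *+ p - d *+ q.
    move=> d2; have dN : - d = d by apply/eqP; rewrite eq_sym -addr_eq0 -mulr2n d2.
    case: p q => -[|[|//]] ip [[|[|//]] iq].
    - by rewrite (_ : (Ordinal ip - Ordinal iq)%R = 0) ?subrr //; apply: val_inj.
    - by rewrite (_ : (Ordinal ip - Ordinal iq)%R = 1) ?sub0r ?mulr1n ?dN //;
        apply: val_inj.
    - by rewrite (_ : (Ordinal ip - Ordinal iq)%R = 1) ?subr0 //; apply: val_inj.
    - by rewrite (_ : (Ordinal ip - Ordinal iq)%R = 0) ?subrr //; apply: val_inj.
  by move=> u v; rewrite /g !mxE !mB // !opprD [RHS]addrACA; congr (_ + _);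
    rewrite [RHS]addrACA.
pose m := GRing.isZmodMorphism.Build 'rV['Z_2]_3 K g gD.
pose f : {additive 'rV['Z_2]_3 -> K} := HB.pack g m.
have fi : injective f.
  apply: raddf_inj => v; rewrite -[f v]/(g v) /g.
  have eqN (d e : K) : d *+ 2 = 0 -> d + e = 0 -> e = d.
    by rewrite mulr2n => d2 e0; apply: (addrI d); rewrite e0 d2.
  have zero (i : 'I_3) : (v 0 i : nat) = 0%N \/ (v 0 i : nat) = 1%N.
    by case: (v 0 i) => -[|[|//]] ? ; [left|right].
  have ab2 : (a + b) *+ 2 = 0 by rewrite mulrnDl a2 b2 addr0.
  case: (zero 0) (zero 1) (zero 2%:R) => e0 [] e1 [] e2;
    rewrite e0 e1 e2 ?mulr0n ?mulr1n ?addr0 ?add0r => h.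
  - apply/matrixP => i j; rewrite !mxE ord1; apply: val_inj.
    by move: j; elim/Z3_cases; rewrite ?e0 ?e1 ?e2.
  - by rewrite h eqxx in c0.
  - by rewrite h eqxx in b0.
  - by rewrite (eqN _ _ b2 h) eqxx in cb.
  - by rewrite h eqxx in a0.
  - by rewrite (eqN _ _ a2 h) eqxx in ca.
  - by rewrite (eqN _ _ a2 h) eqxx in ba.
  - by rewrite (eqN _ _ ab2 h) eqxx in cab.
exists (range f); split; first by exists f.
apply/seteqP; split=> [_ [v _ <-]|x [i [j [k ->]]]].
  exists (v 0 0 : nat), (v 0 1 : nat), (v 0 2%:R : nat).
  by rewrite -!pmulrn.
have [e1 ->] := mulrz_bool i a2; have [e2 ->] := mulrz_bool j b2.
have [e3 ->] := mulrz_bool k c2.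
exists (\row_(i < 3) (nth false [:: e1; e2; e3] i)%:R) => //.
rewrite -[f _]/(g _) /g !mxE /=.
by case: e1 e2 e3 => -[] [].
Qed.

End ElementaryAbelian.

(** * Triples of degrees determined by multiplicities *)

Section Triples.
Variable K : zmodType.
Implicit Types (gamma : 'Z_3 -> K).

(** If the signs are mixed, one entry z has a sign opposite to that of the two others. Comparing the
    two zero sums gives - z = z, so the sign of that entry may be changed. *)
Lemma triple_sign gamma gamma' : \sum_i gamma i = 0 -> \sum_i gamma' i = 0 ->
  (forall i, gamma' i = gamma i \/ gamma' i = - gamma i) ->
  (forall i, gamma' i = gamma i) \/ (forall i, gamma' i = - gamma i).
Proof.
rewrite !big_Z3 => s s' H.
have e0 (x y z : K) : x + y + z = 0 -> x + y - z = 0 -> - z = z.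
  by move=> <- /addrI.
have e1 (x y z : K) : x + y + z = 0 -> - x - y + z = 0 -> - z = z.
  move=> s1 s2; apply: (e0 (- x) (- y)) => //.
  by rewrite -opprD -opprD s1 oppr0.
have rot (x y z : K) : x + y + z = 0 -> y + z + x = 0 by rewrite -addrA addrC.
have rot' (x y z : K) : x + y + z = 0 -> z + x + y = 0 by rewrite addrC addrA.
case: (H 0) (H 1) (H 2%:R) => h0 [] h1 [] h2; move: s'; rewrite h0 h1 h2 => s'.
- by left; elim/Z3_cases.
- by left; elim/Z3_cases; rewrite ?h2 ?(e0 _ _ _ s s').
- by left; elim/Z3_cases; rewrite ?h1 ?(e0 _ _ _ (rot' _ _ _ s) (rot' _ _ _ s')).
- by right; elim/Z3_cases; rewrite ?h0 // (e1 _ _ _ (rot _ _ _ s) (rot _ _ _ s')).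
- by left; elim/Z3_cases; rewrite ?h0 // ?(e0 _ _ _ (rot _ _ _ s) (rot _ _ _ s')).
- by right; elim/Z3_cases; rewrite ?h1 // (e1 _ _ _ (rot' _ _ _ s) (rot' _ _ _ s')).
- by right; elim/Z3_cases; rewrite ?h2 // (e1 _ _ _ s s').
- by right; elim/Z3_cases.
Qed.

(** The common length recovers the multiplicity of the exceptional element. *)
Lemma perm_eq_but (T : eqType) (z : T) (s t : seq T) : size s = size t ->
  (forall x, x != z -> count_mem x s = count_mem x t) -> perm_eq s t.
Proof.
move=> st H; apply/allP => x _ /=; apply/eqP.
have [->|] := eqVneq x z; last exact: H.
have pf : perm_eq (filter (predC1 z) s) (filter (predC1 z) t).
  apply/allP => y _ /=; apply/eqP; rewrite !count_filter.
  have e : predI (pred1 y) (predC1 z) =1 if y == z then pred0 else pred1 y.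
    move=> w /=; case: (eqVneq y z) => [->|yz]; first by case: (w == z).
    by rewrite /=; case: (eqVneq w y) => [->|]; rewrite ?yz.
  rewrite !(eq_count e); case: eqVneq => [_|]; first by rewrite !count_pred0.
  exact: H.
have := perm_size pf; rewrite !size_filter => e.
have := count_predC (pred1 z) s; have := count_predC (pred1 z) t.
have pC : predC (pred1 z) =1 predC1 z by [].
by rewrite !(eq_count pC) e st => <- /addIn.
Qed.

(** The number of basis elements of degree q != 0 counts the i with gamma_i = q and those with -
    gamma_i = q. This determines the multiset of classes {gamma_i, - gamma_i}, hence gamma up to a
    permutation and individual signs; [triple_sign] makes the signs uniform. *)
Lemma triple_sim_count gamma gamma' : \sum_i gamma i = 0 -> \sum_i gamma' i = 0 ->
  (forall q, q != 0 -> #|[pred p | deg1 gamma p == q]| = #|[pred p | deg1 gamma' p ==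
    q]|) ->
  triple_sim gamma gamma'.
Proof.
move=> s s' H.
have cnt g q : q != 0 -> #|[pred p | deg1 g p == q]| =
    (\sum_(i : 'Z_3) ((g i == q) + (- g i == q)))%N.
  move=> q0; rewrite -sum1_card big_mkcond /= big_cayley_idx /=.
  rewrite !inE /= !(eq_sym 0) (negPf q0) big_split /= !big_Z3 /=.
  have ifE (b : bool) : (if b then 1%N else 0%N) = b by case: b.
  by rewrite !ifE.
(* r x is a representative of {x, - x}. *)
pose r (x : K) := choose (pred2 x (- x)) x.
have rP x : r x = x \/ r x = - x.
  by have /orP[/eqP->|/eqP->] : pred2 x (- x) (r x); [apply: chooseP;
    rewrite /= eqxx|left|right].
have rN x : r (- x) = r x.
  rewrite /r (@eq_choose _ (pred2 (- x) (- - x)) (pred2 x (- x))); last first.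
    by move=> y /=; rewrite opprK orbC.
  by apply: choose_id; rewrite /= eqxx ?orbT.
have rE x y : (r x == r y) = (x == y) || (- x == y).
  apply/eqP/orP => [e|[/eqP->|/eqP<-]]; rewrite ?rN //.
  case: (rP x) (rP y) => ex [] ey; rewrite ex ey in e.
  - by left; rewrite e.
  - by right; rewrite e opprK.
  - by right; rewrite e.
  - by left; rewrite (oppr_inj e).
have rr x : r (r x) = r x by case: (rP x) => e; rewrite {1}e ?rN.
have r0 : r 0 = 0 by case: (rP 0) => // ->; rewrite oppr0.
have key : perm_eq [tuple r (gamma' i) | i < 3] [tuple r (gamma i) | i < 3].
  apply: (@perm_eq_but _ 0) => [|x x0]; first by rewrite !size_tuple.
  have cm (g : 'Z_3 -> K) : count_mem x [tuple r (g i) | i < 3] = (\sum_(i :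
    'Z_3) (r (g i) == x))%N.
    rewrite /= count_map -sum1_count big_enum_cond big_mkcond /=.
    by apply: eq_bigr => i _; case: (_ == x).
  rewrite !cm; have [rx|rx] := eqVneq (r x) x; last first.
    have z g : (r g == x) = false by apply: contraNF rx => /eqP <-; rewrite rr.
    by rewrite !big1 // => i _; rewrite z.
  have := H x x0; rewrite !cnt //.
  have red g : (r g == x) = (g == x) || (- g == x) by rewrite -{1}rx rE.
  under [in X in _ -> X]eq_bigr => i _ do rewrite red.
  under [in X in _ -> _ = X]eq_bigr => i _ do rewrite red.
  (* When - x = x each index is counted twice, otherwise at most once. *)
  have [xN|xN] := eqVneq (- x) x.
    have gN g : (- g == x) = (g == x) by rewrite -{1}xN eqr_opp.
    have e (g : 'Z_3 -> K) : (\sum_(i : 'Z_3) ((g i == x) + (- g i == x)))%N =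
        (2 * \sum_(i : 'Z_3) ((g i == x) || (- g i == x)))%N.
      by rewrite big_distrr; apply: eq_bigr => i _; rewrite gN orbb; case: (_ == x).
    by rewrite !e => /eqP; rewrite eqn_mul2l /= => /eqP.
  have e (g : 'Z_3 -> K) : (\sum_(i : 'Z_3) ((g i == x) + (- g i == x)))%N =
      (\sum_(i : 'Z_3) ((g i == x) || (- g i == x)))%N.
    apply: eq_bigr => i _; have [->|] := eqVneq (g i) x; last by [].
    by rewrite (negPf xN).
  by rewrite !e.
have /tuple_permP[p pE] := key.
pose gp i := gamma (p i).
have gps : \sum_i gp i = 0.
  by apply: etrans s; rewrite [RHS](reindex_inj (@perm_inj _ p)).
have gpP i : gamma' i = gp i \/ gamma' i = - gp i.
  have /eqP : r (gamma' i) = r (gp i).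
    have := congr1 (fun t => nth 0 t i) pE.
    rewrite -!tnth_nth !tnth_mktuple. by [].
  rewrite rE => /orP[/eqP->|/eqP<-]; [by left|by right; rewrite opprK].
exists p; case: (triple_sign gps s' gpP) => h; by [left|right].
Qed.

End Triples.

Lemma inverse_graded (F : fieldType) (V : vectType F) (mul : V -> V -> V) (G : zmodType)
    (A B : G -> {vspace V}) (f : 'End(V)) : bilinear_mul mul ->
  is_grading mul A -> is_grading mul B -> bijective f -> {morph f : x y / mul x y} ->
  (forall g x, x \in B g -> f x \in A g) ->
  forall g x, x \in A g -> (f^-1)%VF x \in B g.
Proof.
move=> bl gA gB bf fM fBA g x xA; have [fK f'K _ _] := aut_inverse bf fM.
have e : (fun g => (f @: B g)%VS) =1 A.
  apply: sub_grading_eq gA.1 _; first exact: (push_grading gB bf fM).1.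
  by move=> k; apply/subvP => _ /memv_imgP[y yB ->]; apply: fBA.
by move: xA; rewrite -e => /memv_imgP[y yB ->]; rewrite fK.
Qed.

Lemma basis_grading_map (F : fieldType) (V : vectType F) (G : zmodType)
    (J : finType) (b : J -> V) (deg : J -> G) (A : G -> {vspace V}) (f : 'End(V)) :
  (forall j, f (b j) \in A (deg j)) ->
  forall g x, x \in basis_grading b deg g -> f x \in A g.
Proof.
move=> fb g x /memv_sumP[u uP ->]; rewrite linear_sum; apply: memv_suml => j jg.
have /vlineP[k ->] := uP j jg; rewrite linearZ /= -(eqP jg).
exact: memvZ.
Qed.

(** * Graded-simple skew elements *)

Section GradedSimpleTensor.
Variables (F : fieldType) (G : zmodType) (h : G) (chi : G -> F).
Variable Gam : G -> {vspace cayley2 F}.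
Hypotheses (char2 : 2%N \notin [pchar F]) (oh : order2 h)
  (chiP : is_character chi) (chih : chi h = -1) (gG : is_grading (@tmul F) Gam)
  (thG : forall g z, z \in Gam g -> z \in tskew F -> theta z \in Gam (g + h)).
Let dG : direct_decomposition fullv Gam := gG.1.
Local Notation C1 := (cone F).
Local Notation pi := (\pi_(quot_cyc h)%qT).
Implicit Types (x y : cayley F).

(** Degree q of the coarsening to G/<h>. By [coarseE] the choice of the lift [repr q] is
    immaterial. *)
Let coarse (q : quot_cyc h) : {vspace cayley2 F} := (Gam (repr q) + Gam (repr q + h))%VS.

Lemma coarseE g z : z \in coarse (pi g) <-> exists u v,
  [/\ u \in Gam g, v \in Gam (g + h) & z = u + v].
Proof.
have /(pi_eqP oh) e : pi (repr (pi g)) = pi g by apply: reprK.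
have hh : h + h = 0 by rewrite -mulr2n oh.2.
split=> [/memv_addP[u uG [v vG ->]]|[u [v [uG vG ->]]]]; case: e => e.
- by exists u, v; rewrite -e.
- exists v, u; split; rewrite -?e // 1?addrC //.
  by move: vG; rewrite e -addrA hh addr0.
- by apply: memv_add; rewrite e.
rewrite addrC; apply: memv_add; rewrite e //.
by rewrite -addrA hh addr0.
Qed.

(** In the coarsening [theta] has degree 0, so C (x) 1 is a graded subspace; [B] is its grading read
    on C. *)
Let B (q : quot_cyc h) : {vspace cayley F} :=
  (linfun (fun x : cayley F => tens x C1) @^-1: coarse q)%VS.

Lemma memB q x : (x \in B q) = (tens x C1 \in coarse q).
Proof. by rewrite /B -memv_preim (linfunE (tens_linear_l C1)). Qed.

(** x (x) 1 is half of z + theta z for z = [emb x y], and these two have degrees g and g + h. *)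
Lemma theta_projection g x y : tr x = 0 -> tr y = 0 -> emb x y \in Gam g ->
  x \in B (pi g).
Proof.
move=> x0 y0 zG; have n2 := neq2 char2.
have th := thG zG (emb_skew x0 y0).
rewrite memB; apply/coarseE; exists (2%:R^-1 *: emb x y), (2%:R^-1 *: theta (emb x y)).
rewrite !memvZ //; split=> //; rewrite theta_emb // -scalerDr -embD subrr -mulr2n.
rewrite -scaler_nat -[in RHS](scaler0 _ 2%:R) embZ scalerA mulVf // scale1r.
by rewrite /emb tens0 addr0.
Qed.

Lemma B_grading : is_grading (@cmul F) B.
Proof.
have n2 := neq2 char2.
have one := grading_one (@tmul_bilinear F) gG (@tmul1 F) (@tmulx1 F).
have hs (x : cayley F) : contr (@half_tr F) (tens x C1) = x.
  by rewrite contr_tens half_trE tr1 mulfV ?scale1r.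
have hs0 : contr (@half_tr F) 0 = 0.
  by rewrite -(tens0 0) contr_tens scaler0.
split.
  apply: (@direct_decompositionI _ _ _ _ _ (fun q x => contr (@half_tr F)
     (hcomp Gam (repr q) (tens x C1) + hcomp Gam (repr q + h) (tens x C1)))).
  - by move=> g; apply: subvf.
  - move=> x _; have [a [x' [x0 ->]]] := skew_part char2 x.
    have [s _ sP] := hcomp_sum dG.
    exists (0 :: [seq pi g | g <- s]); rewrite big_cons; apply: memv_add.
      apply: memvZ; rewrite memB -(raddf0 pi); apply/coarseE.
      by exists (tens C1 C1), 0; rewrite mem0v addr0.
    rewrite -(pr1_emb char2 x' (@tr0 F)) (sP (emb x' 0)) /pr1.
    have c0 : contr (@half_tr F) 0 = 0 by rewrite -(scale0r 0) contrZ scale0r.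
    rewrite (big_morph (contr (@half_tr F)) (contrD _) c0) big_seq.
    apply: memv_suml => g gs; apply: (@memv_sum_seq _ _ _ _ _ (pi g)); first exact: map_f.
    have := tskew_hcomp char2 g gG (emb_skew x0 (@tr0 F)).
    move: (hcomp_mem dG g (emb x' 0)) => zG /tskewE[u [v [u0 v0 e]]].
    rewrite e -/(pr1 _) (pr1_emb char2 u v0); apply: (theta_projection u0 v0).
    by rewrite -e.
  - by move=> q x y; rewrite tensDl !linearD /= addrACA contrD.
  - move=> q x; rewrite memB => /memv_addP[u uG [v vG e]];
      rewrite e !linearD /= (hcomp_id dG uG) (hcomp_id dG vG).
    have gh : repr q + h != repr q by rewrite -subr_eq0 addrAC subrr add0r oh.1.
    by rewrite (hcomp_ne dG vG gh) (hcomp_ne dG uG) 1?eq_sym // addr0 add0r -e hs.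
  - move=> q k x; rewrite memB => /memv_addP[u uG [v vG ->]] kq.
    have ph g : pi (g + h) = pi g by apply/(pi_eqP oh); right.
    have ne m m' w : w \in Gam m -> pi m != pi m' -> hcomp Gam m' w = 0.
      by move=> wG mm; apply: (hcomp_ne dG wG); apply: contraNneq mm => ->.
    rewrite !linearD /= !(ne _ _ _ uG) ?(ne _ _ _ vG) ?ph ?reprK // !addr0.
    exact: hs0.
move=> q k x y; rewrite !memB => /memv_addP[u uG [v vG e]] /memv_addP[u' uG' [v' vG' e']].
rewrite -[q]reprK -[k]reprK -(piD h); apply/coarseE.
have hh : h + h = 0 by rewrite -mulr2n oh.2.
exists (tmul u u' + tmul v v'), (tmul u v' + tmul v u'); split.
- apply: memvD; first exact: gG.2.
  rewrite (_ : repr q + repr k = (repr q + h) + (repr k + h)); first exact: gG.2.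
  by rewrite addrACA hh addr0.
- apply: memvD; first by rewrite -addrA; apply: gG.2.
  by rewrite addrAC; apply: gG.2.
have [Dl Dr _ _] := @tmul_bilinear F.
rewrite -{1}(cmul1 C1) -tmul_tens e e' Dl !Dr -!addrA; congr (_ + _).
by rewrite [RHS]addrC -addrA.
Qed.

(* D = chi^-1 anticommutes with theta on tskew, hence carries C (x) 1 to 1 (x) C;
   this defines psi by D (x (x) 1) = 1 (x) psi x. *)
Lemma coordinate_grading : exists (A : quot_cyc h -> {vspace cayley F}) (psi :
  'End(cayley F)),
  [/\ is_grading (@cmul F) A, bijective psi, {morph psi : x y / cmul x y} &
      forall g z, z \in Gam g -> z \in tskew F -> exists x,
        [/\ tr x = 0, x \in A (pi g) & z = emb x (chi g *: psi x)]].
Proof.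
have n2 := neq2 char2.
have one := grading_one (@tmul_bilinear F) gG (@tmul1 F) (@tmulx1 F).
have [D [DG bD DM]] := character_aut (@tmul_bilinear F) gG (characterV chiP).
have [nz chiM] := chiP.
have DS z : z \in tskew F -> D z \in tskew F by apply: tskew_aut.
have Dth z : z \in tskew F -> theta (D z) = - D (theta z).
  elim/(tskew_hom_ind char2 gG) => [u v hu hv||g u uG uS].
  - by rewrite linearD /= !thetaD linearD /= hu hv opprD.
  - by rewrite linear0 theta0 linear0 oppr0.
  rewrite (DG _ _ uG) (DG _ _ (thG uG uS)) thetaZ (character_addh chiP chih).
  by rewrite invrN scaleNr opprK.
pose p0 x := contl (@half_tr F) (D (tens x C1)).
have lin : linear p0.
  by move=> a x y; rewrite /p0 tensDl tensZl linearD linearZ /= contlD contlZ.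
pose psi := linfun p0.
have hs (y : cayley F) : contl (@half_tr F) (tens C1 y) = y.
  by rewrite contl_tens half_trE tr1 mulfV ?scale1r.
have Dpsi_skew x : tr x = 0 -> exists2 y, tr y = 0 & D (emb x 0) = emb 0 y.
  move=> x0; have xS := emb_skew x0 (@tr0 F).
  have := DS _ xS => /tskewE[u [v [u0 v0 e]]].
  exists v => //; have := Dth _ xS; rewrite e !theta_emb ?tr0 // oppr0 e.
  move=> e2; suff -> : u = 0 by [].
  apply: (two_eq0 char2); have : emb (- u) (- v) = emb u (- v).
    by rewrite e2 -!scaleN1r embZ.
  by case/(emb_inj char2); rewrite ?trN ?u0 ?v0 ?oppr0.
have D1 : D (tens C1 C1) = tens C1 C1.
  by rewrite (DG _ _ one) (character0 chiP) invr1 scale1r.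
have Dpsi x : D (tens x C1) = tens C1 (psi x).
  suff [y e] : exists y, D (tens x C1) = tens C1 y.
    by rewrite e /psi (linfunE lin) /p0 e hs.
  have [a [x' [x0 ->]]] := skew_part char2 x; have [y y0 e] := Dpsi_skew x' x0.
  exists (a *: C1 + y); rewrite tensDl tensZl linearD linearZ /= D1.
  move: e; rewrite /emb tens0 t0ens addr0 add0r => ->.
  by rewrite (tensDr _ (a *: C1)) tensZr.
have psiM : {morph psi : x y / cmul x y}.
  move=> x y; rewrite -[LHS]hs -[RHS]hs -Dpsi -{1}(cmul1 C1) -tmul_tens DM !Dpsi.
  by rewrite tmul_tens cmul1.
have ker0 : lker psi == 0%VS.
  rewrite -subv0; apply/subvP => x; rewrite memv_ker memv0 => /eqP e.
  have := Dpsi x; rewrite e tens0 => /eqP; rewrite -(linear0 D) (inj_eq (bij_inj bD)).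
  move=> /eqP tx; have := contr_tens (@half_tr F) x C1.
  rewrite tx half_trE tr1 mulfV // scale1r => <-.
  by apply/eqP/ffunP => p; rewrite !ffunE big1 // => q _; rewrite !ffunE mulr0.
exists B, psi; split=> //; first exact: B_grading.
  by exists (psi^-1)%VF; [apply: lker0_lfunK|apply: lker0_lfunVK].
move=> g z zG /tskewE[x [y [x0 y0 e]]]; rewrite e in zG *.
exists x; split=> //; first exact: theta_projection x0 y0 zG.
congr emb; have zS := emb_skew x0 y0.
have [v v0 ev] := Dpsi_skew x x0.
have ex : emb x 0 = 2%:R^-1 *: (emb x y + theta (emb x y)).
  rewrite theta_emb // -embD subrr -mulr2n -scaler_nat.
  by rewrite -[in RHS](scaler0 _ 2%:R) embZ scalerA mulVf // scale1r.
(* D multiplies z by chi(g)^-1 and theta z by its opposite, so it sends half of z + theta z to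
   chi(g)^-1 times half of z - theta z, which is 1 (x) y. Hence psi x = chi(g)^-1 y. *)
have eD : D (emb x 0) = (chi g)^-1 *: emb 0 y.
  rewrite ex linearZ linearD /= (DG _ _ zG) (DG _ _ (thG zG zS)) (character_addh chiP
    chih).
  rewrite invrN scaleNr -scalerBr theta_emb // scalerA mulrC -scalerA; congr (_ *: _).
  rewrite -scaleN1r -embZ !scaleN1r opprK -embD subrr -mulr2n -scaler_nat.
  by rewrite -[in LHS](scaler0 _ 2%:R) embZ scalerA mulVf // scale1r.
have : tens C1 (psi x) = (chi g)^-1 *: tens C1 y.
  by rewrite -Dpsi; move: eD; rewrite /emb tens0 t0ens addr0 add0r.
move/(congr1 (contl (@half_tr F))); rewrite contlZ !hs => ->.
by rewrite scalerA mulfV // scale1r.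
Qed.

End GradedSimpleTensor.

(** * Classification and isomorphisms of the gradings on C *)

Section CayleyIsomorphisms.
Variables (F : closedFieldType) (G : zmodType).
Hypothesis char2 : 2%N \notin [pchar F].
Implicit Types (x y : cayley F).
Let cbl := @cmul_bilinear F.

Lemma cayley_grading_class (A : G -> {vspace cayley F}) : is_grading (@cmul F) A ->
  (exists gamma : 'Z_3 -> G, \sum_i gamma i = 0 /\ exists f : 'End(cayley F),
     [/\ bijective f, {morph f : x y / cmul x y}
       & forall q x, x \in Gamma1_C F gamma q -> f x \in A q]) \/
  (exists (H : set G) (a b c : G), [/\ elem_abelian8 H, generated3 H a b c &
     exists f : 'End(cayley F), [/\ bijective f, {morph f : x y / cmul x y}
       & forall q x, x \in Gamma2_C F a b c q -> f x \in A q]]).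
Proof.
move=> gA.
have [[w [wA w0 wn]]|no] := boolp.EM (exists w, [/\ w \in A 0, tr w = 0 & w != 0]).
  have [v [vA v0 vv]] := degree0_unit char2 gA wA w0 wn.
  have [gamma [gs [f [bf fM fA]]]] := cayley_grading1 char2 gA vA v0 vv.
  by left; exists gamma; split=> //; exists f; split=> //; apply: basis_grading_map.
right; have A0 x : x \in A 0 -> tr x = 0 -> x = 0.
  by move=> xA x0; apply/eqP; apply: boolp.contrapT => /negP xn; apply: no; exists x.
have [a [b [c [a0 bX cX [x [y [z [xa yb zc [xn yn zn]]]]]]]]] :=
  elementary_triple char2 gA A0.
have [f [bf fM fA]] := cayley_grading2 char2 gA A0 a0 bX cX xa yb zc xn yn zn.
have o2 g u : g != 0 -> u \in A g -> u != 0 -> g *+ 2 = 0.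
  by move=> g0 uA un; rewrite mulr2n; apply: (hom_order2 char2 gA A0 g0 uA un).
have [b0 c0] : b != 0 /\ c != 0.
  by move: bX cX; rewrite !inE !negb_or => /andP[-> _] /andP[-> _].
have [H [eH gen]] := generated3_elem_abelian8 (o2 _ _ a0 xa xn) (o2 _ _ b0 yb yn) (o2 _
  _ c0 zc zn) a0 bX cX.
exists H, a, b, c; split=> //; exists f; split=> //; exact: basis_grading_map.
Qed.

(** The permuted u_i are again a homogeneous Peirce triple for e_1 - e_2. For opposite degrees the
    permuted v_i are one for e_2 - e_1. *)
Lemma Gamma1_triple_sim (gamma gamma' : 'Z_3 -> G) : \sum_i gamma i = 0 ->
  triple_sim gamma gamma' -> exists f : 'End(cayley F),
  [/\ bijective f, {morph f : x y / cmul x y}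
    & forall q x, x \in Gamma1_C F gamma' q -> f x \in Gamma1_C F gamma q].
Proof.
move=> gs [s sP]; have gA := Gamma1_grading F gs.
have [cD cb cZ bc] := cbase_coord F.
have mem p : cbase F p \in Gamma1_C F gamma (deg1 gamma p) by apply: mem_basis_grading.
pose d := ce F false - ce F true.
have d0 : tr d = 0 := tr_ce_diff F.
have dd : cmul d d = cone F by rewrite /d; oct_ring.
have dA : d \in Gamma1_C F gamma 0.
  by apply: memvB; [apply: (mem (inl false))|apply: (mem (inl true))].
have uP i : peirce d (cu F i).
  by split; rewrite /d; elim/Z3_cases: i; oct_ring.
have vP i : peirce (- d) (cv F i).
  by split; rewrite /d; elim/Z3_cases: i; oct_ring.
have si i j : (s i == s j) = (i == j) by rewrite (inj_eq (@perm_inj _ s)).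
have [n01 n02 n12] : [/\ s 0 != s 1, s 0 != s 2%:R & s 1 != s 2%:R] by rewrite !si.
have tru i j k : i != j -> i != k -> j != k -> tr (cmul (cmul (cu F i) (cu F j)) (cu F
  k)) != 0.
  elim/Z3_cases: i; elim/Z3_cases: j; elim/Z3_cases: k => // _ _ _;
    rewrite !octs /= !(mulr0, mul0r, mulr1, mul1r, addr0, add0r, subr0, sub0r, oppr0,
      opprK);
    by rewrite ?oppr_eq0 oner_eq0.
have trv i j k : i != j -> i != k -> j != k -> tr (cmul (cmul (cv F i) (cv F j)) (cv F
  k)) != 0.
  elim/Z3_cases: i; elim/Z3_cases: j; elim/Z3_cases: k => // _ _ _;
    rewrite !octs /= !(mulr0, mul0r, mulr1, mul1r, addr0, add0r, subr0, sub0r, oppr0,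
      opprK);
    by rewrite ?oppr_eq0 oner_eq0.
case: sP => sP.
  have XA i : cu F (s i) \in Gamma1_C F gamma (gamma' i).
    by rewrite sP; apply: (mem (inr (false, s i))).
  have [_ [f [bf fM fA]]] := peirce_triple_basis char2 gA dA d0 dd XA (fun i =>
    uP (s i)) (tru _ _ _ n01 n02 n12).
  by exists f; split=> //; apply: basis_grading_map.
have XA i : cv F (s i) \in Gamma1_C F gamma (gamma' i).
  by rewrite sP; apply: (mem (inr (true, s i))).
have ndA : - d \in Gamma1_C F gamma 0 by rewrite memvN.
have [_ [f [bf fM fA]]] := peirce_triple_basis char2 gA ndA (trNw d0) (NwNw dd) XA (fun
  i => vP (s i)) (trv _ _ _ n01 n02 n12).
by exists f; split=> //; apply: basis_grading_map.
Qed.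

Lemma Gamma2_degree0 (a b c : G) x : injective (deg2 a b c) ->
  x \in Gamma2_C F a b c 0 -> exists k, x = k *: cone F.
Proof.
move=> inj; have d0 : deg2 a b c (false, false, false) = 0.
  by rewrite /deg2 /= !mulr0n !addr0.
rewrite /Gamma2_C /basis_grading (eq_bigl (pred1 (false, false, false))); last first.
  by move=> j; rewrite -d0 (inj_eq inj).
by rewrite big_pred1_eq uvw000 => /vlineP.
Qed.

(** The grading for a, b, c has F1 in degree 0 and nonzero elements in the degrees a', b', c', so
    [cayley_grading2] applies to it with these generators. *)
Lemma Gamma2_generators (H : set G) (a b c a' b' c' : G) : elem_abelian8 H ->
  generated3 H a b c -> generated3 H a' b' c' -> exists f : 'End(cayley F),
  [/\ bijective f, {morph f : x y / cmul x y}
    & forall q x, x \in Gamma2_C F a' b' c' q -> f x \in Gamma2_C F a b c q].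
Proof.
move=> eH gen gen'.
have [a2 b2 c2] := generated3_order2 eH gen;
  have [a2' b2' c2'] := generated3_order2 eH gen'.
have inj := generated3_inj eH gen; have inj' := generated3_inj eH gen'.
have HP := generated3_deg2 a2 b2 c2 gen; have HP' := generated3_deg2 a2' b2' c2' gen'.
have gA := Gamma2_grading char2 a2 b2 c2.
have n2 := neq2 char2.
have A0 x : x \in Gamma2_C F a b c 0 -> tr x = 0 -> x = 0.
  move=> /(Gamma2_degree0 inj)[k ->]; rewrite trZ tr1 => /eqP.
  by rewrite mulf_eq0 (negPf n2) orbF => /eqP->; rewrite scale0r.
have ex j : exists x, x \in Gamma2_C F a b c (deg2 a' b' c' j) /\ x != 0.
  have [k ->] := (HP _).1 ((HP' _).2 (ex_intro _ j erefl)).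
  by exists (uvw_base F k); rewrite uvw_neq0 // mem_basis_grading.
have dE : [/\ deg2 a' b' c' (false, false, false) = 0, deg2 a' b' c' (true, false,
  false) = a',
   deg2 a' b' c' (false, true, false) = b', deg2 a' b' c' (true, true, false) = a' + b'
   & deg2 a' b' c' (false, false, true) = c'].
  by rewrite /deg2 /= !mulr0n !mulr1n !addr0 !add0r.
have [d0 da db dab dc] := dE.
have ne j k : j != k -> deg2 a' b' c' j != deg2 a' b' c' k by rewrite (inj_eq inj').
have a0 : a' != 0 by have := ne (true, false, false) (false, false, false) isT;
  rewrite da d0.
have bX : b' \notin [:: 0; a'].
  have := ne (false, true, false) (true, false, false) isT.
  have := ne (false, true, false) (false, false, false) isT.
  by rewrite db da d0 !inE negb_or => -> ->.
have cX : c' \notin [:: 0; a'; b'; a' + b'].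
  have := ne (false, false, true) (true, true, false) isT.
  have := ne (false, false, true) (false, true, false) isT.
  have := ne (false, false, true) (true, false, false) isT.
  have := ne (false, false, true) (false, false, false) isT.
  by rewrite dc dab db da d0 !inE !negb_or => -> -> -> ->.
have [x [xa xn]] := ex (true, false, false); have [y [yb yn]] := ex (false, true, false).
have [z [zc zn]] := ex (false, false, true); rewrite da in xa; rewrite db in yb;
  rewrite dc in zc.
have [f [bf fM fA]] := cayley_grading2 char2 gA A0 a0 bX cX xa yb zc xn yn zn.
by exists f; split=> //; apply: basis_grading_map.
Qed.

End CayleyIsomorphisms.

Section TensorIsomorphisms.
Variables (F : closedFieldType) (G : zmodType) (h : G).
Hypotheses (char2 : 2%N \notin [pchar F]) (oh : order2 h).

(* A second character chi' is absorbed by the automorphism of C acting on A_q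
   as the scalar (chi / chi')(q). *)
Lemma tensor_grading_iso (chi chi' : G -> F) (A A' : quot_cyc h -> {vspace cayley F})
    (f : 'End(cayley F)) :
  is_character chi -> chi h = -1 -> is_character chi' -> chi' h = -1 ->
  is_grading (@cmul F) A -> is_grading (@cmul F) A' ->
  bijective f -> {morph f : x y / cmul x y} ->
  (forall q x, x \in A' q -> f x \in A q) ->
  graded_iso (@tmul F) (tensor_grading chi A) (tensor_grading chi' A').
Proof.
move=> chiP chih chiP' chih' gA gA' bf fM fA.
pose c (q : quot_cyc h) := chi (repr q) / chi' (repr q).
have cpi g : c (\pi_(quot_cyc h)%qT g) = chi g / chi' g.
  have /(pi_eqP oh) : \pi_(quot_cyc h)%qT (repr (\pi_(quot_cyc h)%qT g)) =
    \pi_(quot_cyc h)%qT g.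
    by apply: reprK.
  rewrite /c => -[->|->] //.
  by rewrite !(character_addh, chih, chih') // invrN mulrNN.
have cc : is_character c.
  split=> [q|q q']; first by rewrite mulf_neq0 ?invr_eq0 ?chiP.1 ?chiP'.1.
  by rewrite -[q]reprK -[q']reprK -(piD h) !cpi chiP.2 chiP'.2 invfM mulrACA.
have [D [DA bD DM]] := character_aut (@cmul_bilinear F) gA cc.
have [fK f'K bf' f'M] := aut_inverse bf fM.
apply: (graded_iso_tensor_grading char2 (B := A) oh chiP' chih' gA' _ bD DM bf' f'M).
- exact: tensor_grading_grading.
- exact: (inverse_graded (@cmul_bilinear F) gA gA' bf fM fA).
move=> g z zT zS; have [x [x0 xA ->]] := tensor_grading_skew char2 oh chiP chih gA zT zS.
exists x; split=> //; rewrite (DA _ _ xA) cpi scalerA mulrCA mulfV ?mulr1 //.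
exact: chiP'.1.
Qed.

End TensorIsomorphisms.

Theorem corollary3p17 (F : closedFieldType) (charF : 2%N \notin [pchar F])
    (G : zmodType) :
  [/\ forall Gamma : G -> {vspace cayley2 F},
        is_grading (@tmul F) Gamma ->
        graded_simple (commutator (@tmul F)) (tskew F)
          (fun g => tskew F :&: Gamma g)%VS ->
        (exists (h : G) (chi : G -> F) (gamma : 'Z_3 -> quot_cyc h),
           params1 chi gamma /\
           graded_iso (@tmul F) Gamma (Gamma1_CC chi gamma)) \/
        (exists (h : G) (chi : G -> F) (H : set (quot_cyc h))
                (a b c : quot_cyc h),
           params2 chi H a b c /\
           graded_iso (@tmul F) Gamma (Gamma2_CC chi a b c)),
      forall (h : G) (chi : G -> F) (gamma : 'Z_3 -> quot_cyc h)
             (h' : G) (chi' : G -> F) (H' : set (quot_cyc h'))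
             (a' b' c' : quot_cyc h'),
        params1 chi gamma -> params2 chi' H' a' b' c' ->
        ~ graded_iso (@tmul F) (Gamma1_CC chi gamma) (Gamma2_CC chi' a' b' c'),
      forall (h : G) (chi : G -> F) (gamma : 'Z_3 -> quot_cyc h)
             (h' : G) (chi' : G -> F) (gamma' : 'Z_3 -> quot_cyc h'),
        params1 chi gamma -> params1 chi' gamma' ->
        graded_iso (@tmul F) (Gamma1_CC chi gamma) (Gamma1_CC chi' gamma') <->
        exists e : h = h',
          triple_sim (ecast k ('Z_3 -> quot_cyc k) e gamma) gamma'
    & forall (h : G) (chi : G -> F) (H : set (quot_cyc h)) (a b c : quot_cyc h)
             (h' : G) (chi' : G -> F) (H' : set (quot_cyc h'))
             (a' b' c' : quot_cyc h'),
        params2 chi H a b c -> params2 chi' H' a' b' c' ->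
        graded_iso (@tmul F) (Gamma2_CC chi a b c) (Gamma2_CC chi' a' b' c') <->
        exists e : h = h', ecast k (set (quot_cyc k)) e H = H'].
Proof.
split.
- move=> Gam gG simple.
  have [h [oh thG]] := theta_degree charF gG simple.
  have [chi [chiP chih]] := character_order2 charF oh.
  have [A [psi [gA bpsi psiM SP]]] := coordinate_grading charF oh chiP chih gG thG.
  have [[gamma [gs [f [bf fM fA]]]]|[H [a [b [c [eH gen [f [bf fM fA]]]]]]]] :=
    cayley_grading_class charF gA.
    left; exists h, chi, gamma; split=> //.
    have gA1 := Gamma1_grading F gs.
    have [fK f'K bf' f'M] := aut_inverse bf fM.
    apply: (graded_iso_tensor_grading charF oh chiP chih gA1 gG bpsi psiM bf' f'M _ SP).
    exact: (inverse_graded (@cmul_bilinear F) gA gA1 bf fM fA).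
  right; exists h, chi, H, a, b, c; split=> //.
  have [a2 b2 c2] := generated3_order2 eH gen.
  have gA1 := Gamma2_grading charF a2 b2 c2.
  have [fK f'K bf' f'M] := aut_inverse bf fM.
  apply: (graded_iso_tensor_grading charF oh chiP chih gA1 gG bpsi psiM bf' f'M _ SP).
  exact: (inverse_graded (@cmul_bilinear F) gA gA1 bf fM fA).
- move=> h chi gamma h' chi' H' a' b' c' [oh chiP chih gs] [oh' chiP' chih' eH gen] [f
    [bf fM fT]].
  have [a2 b2 c2] := generated3_order2 eH gen.
  have gA := Gamma1_grading F gs; have gA' := Gamma2_grading charF a2 b2 c2.
  (* In the first type (e_1 - e_2, chi(0) (e_1 - e_2)) gives a nonzero skew element of degree 0. In
     the second type the component of degree 0 is F1 in C, so no such element exists. *)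
  pose d := ce F false - ce F true.
  have d0 : tr d = 0 := tr_ce_diff F.
  have dn0 : d != 0 := ce_diff_neq0 F.
  have mem p : cbase F p \in Gamma1_C F gamma (deg1 gamma p) by apply: mem_basis_grading.
  have dA : d \in Gamma1_C F gamma (\pi_(quot_cyc h)%qT 0).
    rewrite raddf0.
    by apply: memvB; [apply: (mem (inl false))|apply: (mem (inl true))].
  have dT := mem_tensor_grading charF oh chiP chih gA d0 dA.
  have dS : emb d (chi 0 *: d) \in tskew F by apply: emb_skew; rewrite ?trZ ?d0 ?mulr0.
  have fdS := tskew_aut charF bf fM dS.
  have fdT : f (emb d (chi 0 *: d)) \in Gamma2_CC chi' a' b' c' 0 by rewrite -fT memv_img.
  have [x [x0 xA e]] := tensor_grading_skew charF oh' chiP' chih' gA' fdT fdS.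
  rewrite raddf0 in xA; have [k xk] := Gamma2_degree0 (generated3_inj eH gen) xA.
  have k0 : k = 0.
    move: x0; rewrite xk trZ tr1 => /eqP.
    by rewrite mulf_eq0 (negPf (neq2 charF)) orbF => /eqP.
  move: e; rewrite xk k0 scale0r scaler0 {2}/emb tens0 t0ens addr0 => /eqP.
  rewrite -(linear0 f) (inj_eq (bij_inj bf)) => /eqP e0.
  have : emb d (chi 0 *: d) = emb 0 0 by rewrite [LHS]e0 /emb tens0 t0ens addr0.
  case/(emb_inj charF); rewrite ?tr0 ?trZ ?d0 ?mulr0 // => dz.
  by rewrite dz eqxx in dn0.
- move=> h chi gamma h' chi' gamma' [oh chiP chih gs] [oh' chiP' chih' gs'].
  have gA := Gamma1_grading F gs; have gA' := Gamma1_grading F gs'.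
  split=> [iso|[e]].
    have e := graded_iso_degree charF oh chiP chih gA oh' chiP' chih' gA' iso.
    subst h'; exists erefl; apply: triple_sim_count => // q q0.
    have := graded_iso_dim charF q oh chiP chih gA chiP' chih' gA' iso.
    (* Outside degree 0 homogeneous elements have trace 0, so the skew part is the whole component
       and its dimension counts basis elements. *)
    have cap K : is_grading (@cmul F) K -> (K q :&: cskew F)%VS = K q.
      move=> gK; apply/capv_idPl/subvP => x xK; apply/cskewP.
      exact: (tr_hom charF gK q0 xK).
    by rewrite !cap // !Gamma1_dim.
  subst h' => /= sim.
  have [f [bf fM fA]] := Gamma1_triple_sim (F := F) charF gs sim.
  exact: (tensor_grading_iso charF oh chiP chih chiP' chih' gA gA' bf fM fA).
move=> h chi H a b c h' chi' H' a' b' c' [oh chiP chih eH gen] [oh' chiP' chih' eH' gen'].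
have [a2 b2 c2] := generated3_order2 eH gen.
have [a2' b2' c2'] := generated3_order2 eH' gen'.
have gA := Gamma2_grading charF a2 b2 c2; have gA' := Gamma2_grading charF a2' b2' c2'.
split=> [iso|[e]].
  have e := graded_iso_degree charF oh chiP chih gA oh' chiP' chih' gA' iso.
  subst h'; exists erefl => /=.
  have HP := generated3_deg2 a2 b2 c2 gen; have HP' := generated3_deg2 a2' b2' c2' gen'.
  have card q : q != 0 -> #|[pred j | deg2 a b c j == q]| = #|[pred j | deg2 a' b' c' j
    == q]|.
    move=> q0; have := graded_iso_dim charF q oh chiP chih gA chiP' chih' gA' iso.
    have cap K : is_grading (@cmul F) K -> (K q :&: cskew F)%VS = K q.
      move=> gK; apply/capv_idPl/subvP => x xK; apply/cskewP.
      exact: (tr_hom charF gK q0 xK).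
    by rewrite !cap // !Gamma2_dim.
  have ex (u v w q : quot_cyc h) :
    (exists j, q = deg2 u v w j) <-> (0 < #|[pred j | deg2 u v w j == q]|)%N.
    split=> [[j ->]|/card_gt0P[j]]; first by apply/card_gt0P; exists j; rewrite inE.
    by rewrite inE => /eqP <-; exists j.
  have z (u v w : quot_cyc h) : exists j, 0 = deg2 u v w j.
    by exists (false, false, false); rewrite /deg2 /= !mulr0n !addr0.
  (* The count covers nonzero q only; 0 lies in both subgroups. *)
  apply/seteqP; split=> q; rewrite HP HP'.
    by have [->|q0] := eqVneq q 0; [move=> _; apply: z|rewrite !ex card].
  by have [->|q0] := eqVneq q 0; [move=> _; apply: z|rewrite !ex card].
subst h' => /= HH; subst H'.
have [f [bf fM fA]] := Gamma2_generators (F := F) charF eH gen gen'.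
exact: (tensor_grading_iso charF oh chiP chih chiP' chih' gA gA' bf fM fA).
Qed.
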